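(* Let $\mathbb{K}$ be an algebraic number field. Let $a,b\in\mathbb{K}^{\mathbb{N}}$ be $C^2$-finite of order $r_1,r_2$, respectively, satisfying $C^2$-finite recurrences $\sum_{i=0}^{r_1}c_i(n)a(n+i)=0$ and $\sum_{i=0}^{r_2}\tilde c_i(n)b(n+i)=0$ for all $n\in\mathbb{N}$, and let $d$ be the torsion number of the eigenvalues appearing in these recurrences (i.e. of all eigenvalues of the $C$-finite sequences $c_0,\dots,c_{r_1},\tilde c_0,\dots,\tilde c_{r_2}$ taken together). Then: 1. the sequence $a+b$ (termwise sum) satisfies a $C^2$-finite recurrence over $\mathbb{K}$ of order at most $d(r_1+r_2)$, and 2. the sequence $ab$ (termwise product) satisfies a $C^2$-finite recurrence over $\mathbb{K}$ of order at most $d\,r_1r_2$. Furthermore, such recurrences can be computed.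
   Context: $\mathbb{N}=\{0,1,2,\dots\}$. A sequence $c\in\mathbb{K}^{\mathbb{N}}$ is called $C$-finite over $\mathbb{K}$ if it satisfies a linear recurrence $\gamma_0c(n)+\dots+\gamma_tc(n+t)=0$ for all $n\in\mathbb{N}$ with constants $\gamma_i\in\mathbb{K}$, $\gamma_t\ne0$. The characteristic polynomial of $c$ is the polynomial $\sum_{i=0}^{t-1}\gamma_ix^i+x^t\in\mathbb{K}[x]$ corresponding to the unique monic such recurrence of minimal order $t$. Over its splitting field it factors as $x^{n_0}\prod_{i=1}^m(x-\lambda_i)^{d_i}$ with pairwise distinct nonzero $\lambda_1,\dots,\lambda_m$; these $\lambda_i$ are called the eigenvalues of $c$. A $C^2$-finite recurrence over $\mathbb{K}$ of order $r$ for a sequence $a\in\mathbb{K}^{\mathbb{N}}$ is a relation $c_0(n)a(n)+\dots+c_r(n)a(n+r)=0$ valid for all $n\in\mathbb{N}$, where $c_0,\dots,c_r$ are $C$-finite sequences over $\mathbb{K}$ and there is $n_1\in\mathbb{N}$ with $c_r(n)\neq 0$ for all $n\ge n_1$. A sequence is $C^2$-finite over $\mathbb{K}$ if it satisfies such a recurrence. For nonzero algebraic numbers $\lambda_1,\dots,\lambda_m$, let $G=\langle\lambda_1,\dots,\lambda_m\rangle\le(\mathbb{C}^\times,\cdot)$ be the multiplicative group they generate and $T(G)$ its torsion subgroup (the elements of finite order). The torsion number of $\lambda_1,\dots,\lambda_m$ is $d=\exp(T(G))=\operatorname{lcm}(\operatorname{ord}(\lambda)\mid\lambda\in T(G))$.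 *)

(* Defs.v *)
From HB Require Import structures.
From mathcomp Require Import all_boot all_order all_algebra all_field.

Set Implicit Arguments.
Unset Strict Implicit.
Unset Printing Implicit Defensive.

Import Order.TTheory GRing.Theory Num.Theory.
Local Open Scope ring_scope.

(* A number field is [K : fieldExtType rat]; its eigenvalues
   live in [algC], into which [K] is embedded by [iota : {rmorphism K -> algC}].
   Sequences over [K] are functions [nat -> K]. *)

Section CFinite.
Variable K : fieldType.

(* The polynomial [p] stands for the recurrence with coefficients
   gamma_i = p`_i, of order t = deg p; gamma_t != 0 amounts to [p != 0]. *)
Definition satisfies_rec (p : {poly K}) (c : nat -> K) : Prop :=
  forall n : nat, \sum_(i < size p) p`_i * c (n + i)%N = 0.

Definition Cfinite (c : nat -> K) : Prop :=
  exists p : {poly K}, p != 0 /\ satisfies_rec p c.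

Definition is_char_poly (c : nat -> K) (p : {poly K}) : Prop :=
  [/\ p \is monic, satisfies_rec p c &
      forall q : {poly K},
        q \is monic -> satisfies_rec q c -> (size p <= size q)%N].

(* Coefficients c_0, ..., c_r that are admissible in a C^2-finite recurrence. *)
Definition C2coefs (r : nat) (c : 'I_r.+1 -> nat -> K) : Prop :=
  (forall i, Cfinite (c i)) /\
  (exists n1 : nat, forall n : nat, (n1 <= n)%N -> c ord_max n != 0).

Definition annihilates (r : nat) (c : 'I_r.+1 -> nat -> K) (a : nat -> K) :
    Prop :=
  forall n : nat, \sum_(i < r.+1) c i n * a (n + i)%N = 0.

Definition C2recurrence (r : nat) (c : 'I_r.+1 -> nat -> K) (a : nat -> K) :
    Prop :=
  C2coefs c /\ annihilates c a.

Definition C2finite_order_le (D : nat) (a : nat -> K) : Prop :=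
  exists r : nat, exists c : 'I_r.+1 -> nat -> K,
    (r <= D)%N /\ C2recurrence c a.

End CFinite.

Section Eigenvalues.
Variables (K : fieldType) (iota : {rmorphism K -> algC}).

Definition eigenvalue (c : nat -> K) (z : algC) : Prop :=
  z != 0 /\ exists p : {poly K}, is_char_poly c p /\ root (map_poly iota p) z.

Definition rec_eigenvalue (r1 r2 : nat) (c1 : 'I_r1.+1 -> nat -> K)
    (c2 : 'I_r2.+1 -> nat -> K) (z : algC) : Prop :=
  (exists i, eigenvalue (c1 i) z) \/ (exists i, eigenvalue (c2 i) z).

End Eigenvalues.

(* The multiplicative group generated by a set [E] of nonzero numbers. *)
Inductive mulgen (E : algC -> Prop) : algC -> Prop :=
| mulgen_in z : E z -> mulgen E z
| mulgen_1 : mulgen E 1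
| mulgen_M z w : mulgen E z -> mulgen E w -> mulgen E (z * w)
| mulgen_V z : mulgen E z -> mulgen E z^-1.

(* [k.-primitive_root z] says that [z] has finite multiplicative order [k]. *)
Definition torsion_exponent (E : algC -> Prop) (m : nat) : Prop :=
  forall (z : algC) (k : nat),
    mulgen E z -> k.-primitive_root z -> (k %| m)%N.

(* [d] is the lcm of the orders of the torsion elements, the lcm being given by
   its universal property since the torsion subgroup is not a [finType]. *)
Definition torsion_number (E : algC -> Prop) (d : nat) : Prop :=
  torsion_exponent E d /\
  forall m : nat, torsion_exponent E m -> (d %| m)%N.

(* Partial recursive functions of [k] arguments. *)
Inductive recfun : nat -> Type :=
| RZero k : recfun k
| RSucc : recfun 1
| RProj k (i : 'I_k) : recfun k
| RComp k m (f : recfun m) (g : 'I_m -> recfun k) : recfun k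
| RPrim k (f : recfun k) (g : recfun k.+2) : recfun k.+1
| RMu k (f : recfun k.+1) : recfun k.

(* [reval f v y]: on input [v], the computation of [f] halts with value [y].
   [RPrim] recurses on the first argument, [h] being the list of successive
   values; [RMu] searches for the first argument of [f], all the values
   computed before the first zero being required to exist. *)
Fixpoint reval (k : nat) (f : recfun k) : k.-tuple nat -> nat -> Prop :=
  match f in recfun k return k.-tuple nat -> nat -> Prop with
  | RZero _ => fun _ y => y = 0%N
  | RSucc => fun v y => y = (thead v).+1
  | RProj _ i => fun v y => y = tnth v i
  | RComp _ m f g => fun v y =>
      exists w : m.-tuple nat,
        (forall i, reval (g i) v (tnth w i)) /\ reval f w y
  | RPrim _ f g => fun v y =>
      exists h : nat -> nat,
        [/\ reval f [tuple of behead v] (h 0%N),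
            forall j, (j < thead v)%N ->
              reval g [tuple of j :: h j :: behead v] (h j.+1) &
            y = h (thead v)]
  | RMu _ f => fun v y =>
      reval f [tuple of y :: v] 0%N /\
      (forall j, (j < y)%N -> exists z, reval f [tuple of j :: v] z.+1)
  end.

(* Natural numbers as finite objects, through the bijection [CodeSeq.decode]
   from [nat] to [seq nat]: a rational is named by [:: p; q; s], standing for
   (p - q) / (s + 1), and an element of [K] by the names of its coordinates in
   a fixed basis.  An object may have several names. *)
Definition item (x i : nat) : nat := nth 0%N (CodeSeq.decode x) i.

Definition rat_of_code (x : nat) : rat :=
  ((item x 0)%:R - (item x 1)%:R) / (item x 2).+1%:R.

Section Codes.
Variable K : fieldExtType rat.

Definition elt_of_code (x : nat) : K :=
  \sum_(i < \dim {:K}) rat_of_code (item x i) *: (vbasis {:K})`_i.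

Definition elts_of_code (x : nat) : seq K :=
  [seq elt_of_code y | y <- CodeSeq.decode x].

(* A C-finite sequence is named by gamma_0, ..., gamma_(t-1) (with
   gamma_t = 1) together with its first t values. *)
Definition Cfinite_code (x : nat) (c : nat -> K) : Prop :=
  let g := elts_of_code (item x 0) in
  let u := elts_of_code (item x 1) in
  [/\ size u = size g,
      forall i : nat, (i < size g)%N -> c i = u`_i &
      forall n : nat,
        \sum_(i < size g) g`_i * c (n + i)%N + c (n + size g)%N = 0].

Definition rec_code (x r : nat) (c : 'I_r.+1 -> nat -> K) : Prop :=
  size (CodeSeq.decode x) = r.+1 /\ forall i : 'I_r.+1, Cfinite_code (item x i) (c i).

(* The program [f] turns names of C^2-finite recurrences of orders [r1], [r2]
   into a name of a C^2-finite recurrence of order at most [bound d r1 r2],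
   [d] being the torsion number, satisfied by [op a b] whenever [a] and [b]
   satisfy the given ones.  Nothing is required on other inputs. *)
Definition computes_closure (iota : {rmorphism K -> algC})
    (op : (nat -> K) -> (nat -> K) -> nat -> K)
    (bound : nat -> nat -> nat -> nat) (f : recfun 2) : Prop :=
  forall (x1 x2 r1 r2 : nat)
    (c1 : 'I_r1.+1 -> nat -> K) (c2 : 'I_r2.+1 -> nat -> K) (d : nat),
  C2coefs c1 -> C2coefs c2 ->
  rec_code x1 c1 -> rec_code x2 c2 ->
  torsion_number (rec_eigenvalue iota c1 c2) d ->
  exists (y r : nat) (e : 'I_r.+1 -> nat -> K),
    [/\ reval f [tuple x1; x2] y,
        rec_code y e,
        (r <= bound d r1 r2)%N,
        C2coefs e &
        forall a b : nat -> K,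
          annihilates c1 a -> annihilates c2 b -> annihilates e (op a b)].

End Codes.

(* Main.v *)
Require Import Defs.
From HB Require Import structures.
From mathcomp Require Import all_boot all_order all_algebra all_field.
From mathcomp Require Import zify ring.
From Stdlib Require Import Classical.

Set Implicit Arguments.
Unset Strict Implicit.
Unset Printing Implicit Defensive.

Import Order.TTheory GRing.Theory Num.Theory.
Local Open Scope ring_scope.

(** Let [E] be the shift of sequences.  A sequence killed by a product of operators
    [E - z] is C-finite with characteristic roots among the [z]; sums, products
    and shifts of such sequences are of the same kind, products of sequences
    having products of roots ([killM]).  Hence all sequences built from the
    coefficients of the two recurrences have their nonzero roots in the group
    generated by the eigenvalues, in which a root of unity has order dividing
    [d].

    The analytic heart is the theorem of Skolem, Mahler and Lech in the form of
    [class_dichotomy]: along each residue class modulo [d], such a sequence is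
    eventually zero or eventually nonzero.  It is proved by Hansel's argument.
    Coordinates and scaling reduce to monic integral recurrences, with
    characteristic polynomial [P].  For a prime [p] not dividing [P(0)], some power
    [x^m] is [1] modulo [(P, p)], so the values on a progression of difference [m]
    form a binomial series in multiples of powers of [p].  With infinitely many
    zeros, all its values are divisible by every power of [p]
    ([binomial_series_zeros]), so the series is zero.  Thus infinitely many zeros
    contain a full progression of them, and when no ratio of distinct roots is a
    root of unity the sequence is then zero ([nondegenerate_zero]).

    It follows that a matrix of such sequences has, along each class modulo [d], an
    eventually constant rank and an eventually nonzero minor of that size
    ([generic_minor]).  Cramer's rule then turns linear relations that hold for
    all large [n] into relations with C-finite coefficients valid for all [n]
    ([dependence_certificate]), and refutes the others by C-finite vectors
    ([independence_certificate]).

    For the bound on the order, put [R = r1 + r2] for the sum and [R = r1 * r2] for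
    the product.  The terms of the sum or product at [n + i] are, up to nonzero
    factors, a row [w_i(n)] of length [R] applied to the initial values at [n], and
    the rows form a cocycle.  Among [w_0, w_d, ..., w_(dR)], whose ranks are
    eventually constant on each class, one depends on its predecessors, and the
    cocycle carries this dependence up to [w_(dR)] ([cocycle_dependence],
    [sum_dependence], [prod_dependence]).  Steps of [d] are taken because the
    cocycle shifts [n], which must remain in its class.

    For the computation, a recurrence of order [D] is sought as a combination of
    the given recurrences.  A single unbounded search looks for a number naming
    the coefficients of the recurrence, the multipliers that prove it, and for
    each smaller order a vector proving that order impossible ([accepts]).  All
    of this is checked on finitely many values: orders of sequences are bounded
    in terms of their names, and whether a sequence has finitely many zeros is
    decided modulo a multiple of the orders of all roots of unity of the relevant
    degree ([eventually_nonzero_test]).  The certificates exist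
    ([accepts_complete]), and an accepted order is minimal ([accepts_sound]), so it
    is at most [d * R] although [d] is never computed.  As every C-finite sequence
    has a name, existence follows from computability
    ([computes_closure_order_le]). *)

(** * Polynomials acting on sequences by the shift *)

Section Action.
Variable F : idomainType.
Implicit Types (p q : {poly F}) (f g : nat -> F).

Definition act p f n := \sum_(i < size p) p`_i * f (n + i)%N.

Lemma act_widen p f n N : (size p <= N)%N ->
  act p f n = \sum_(i < N) p`_i * f (n + i)%N.
Proof.
move=> leN; rewrite /act (big_ord_widen N (fun i => p`_i * f (n + i)%N) leN).
rewrite big_mkcond /=; apply: eq_bigr => i _; case: ltnP => // le_i.
by rewrite nth_default // mul0r.
Qed.

Lemma eq_act p f g : f =1 g -> act p f =1 act p g.
Proof. by move=> eqfg n; apply: eq_bigr => i _; rewrite eqfg. Qed.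

Lemma act0l f n : act 0 f n = 0.
Proof. by rewrite /act size_poly0 big_ord0. Qed.

Lemma act0r p f : f =1 (fun _ => 0) -> act p f =1 (fun _ => 0).
Proof. by move=> f0 n; apply: big1 => i _; rewrite f0 mulr0. Qed.

Lemma actDl p q f n : act (p + q) f n = act p f n + act q f n.
Proof.
pose N := maxn (size p) (size q).
rewrite !(@act_widen _ f n N) ?leq_maxl ?leq_maxr //; last first.
  exact: leq_trans (size_polyD _ _) _.
by rewrite -big_split; apply: eq_bigr => i _; rewrite coefD mulrDl.
Qed.

Lemma actZl a p f n : act (a *: p) f n = a * act p f n.
Proof.
rewrite (@act_widen _ f n (size p)) ?size_scale_leq // /act big_distrr /=.
by apply: eq_bigr => i _; rewrite coefZ mulrA.
Qed.

Lemma actDr p f g n : act p (fun k => f k + g k) n = act p f n + act p g n.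
Proof. by rewrite -big_split; apply: eq_bigr => i _; rewrite mulrDr. Qed.

Lemma actZr p a f n : act p (fun k => a * f k) n = a * act p f n.
Proof. by rewrite big_distrr; apply: eq_bigr => i _; rewrite mulrCA. Qed.

Lemma actC a f n : act a%:P f n = a * f n.
Proof.
rewrite (@act_widen _ f n 1) ?size_polyC_leq1 // big_ord1 coefC eqxx.
by rewrite addn0.
Qed.

Lemma act1 f n : act 1 f n = f n.
Proof. by rewrite -polyC1 actC mul1r. Qed.

Lemma actXM p f n : act ('X * p) f n = act p f n.+1.
Proof.
rewrite (@act_widen _ f n (size p).+1); last first.
  by rewrite -commr_polyX (leq_trans (size_polyMleq _ _)) // size_polyX addn2.
rewrite big_ord_recl coefXM eqxx mul0r add0r; apply: eq_bigr => i _.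
by rewrite coefXM /= /bump /= add1n addnS addSn.
Qed.

Lemma act_shift p f k n : act p (fun m => f (m + k)%N) n = act p f (n + k)%N.
Proof. by apply: eq_bigr => i _; rewrite addnAC. Qed.

Lemma actM p q f n : act (p * q) f n = act p (act q f) n.
Proof.
elim/poly_ind: p n => [|p c IHp] n; first by rewrite mul0r !act0l.
rewrite mulrDl !actDl mul_polyC actZl actC; congr (_ + _).
by rewrite [p * 'X]commr_polyX -mulrA !actXM IHp.
Qed.

Lemma actXn k f n : act 'X^k f n = f (n + k)%N.
Proof.
elim: k n => [|k IHk] n; first by rewrite expr0 act1 addn0.
by rewrite exprS actXM IHk addnS addSn.
Qed.

Lemma actX f n : act 'X f n = f n.+1.
Proof. by rewrite -['X]expr1 actXn addn1. Qed.

(** The leading coefficient, being nonzero, determines each term from the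
    preceding ones. *)
Lemma act_window p f m : p != 0 -> act p f =1 (fun _ => 0) ->
  (forall i, (i < (size p).-1)%N -> f (m + i)%N = 0) ->
  forall n, (m <= n)%N -> f n = 0.
Proof.
move=> nz_p pf f0 n le_mn; rewrite -(subnKC le_mn); move: (n - m)%N => {n le_mn}.
have [t sz_p] : exists t, size p = t.+1.
  by exists (size p).-1; rewrite prednK // size_poly_gt0.
rewrite sz_p /= in f0; elim/ltn_ind => i IH.
case: (ltnP i t) => [/f0 // | le_ti].
have := pf (m + (i - t))%N; rewrite /act sz_p big_ord_recr /=.
rewrite big1 => [|[j lt_jt] _]; last first.
  by rewrite /= -addnA IH ?mulr0 //; lia.
rewrite add0r -addnA subnK // => /eqP; rewrite mulf_eq0 => /orP[|/eqP//].
by rewrite -[t]/(t.+1.-1) -sz_p -/(lead_coef p) lead_coef_eq0 (negPf nz_p).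
Qed.

(** Subsequences along an arithmetic progression turn [x] into [x^M]. *)
Lemma act_progression p f M j n :
  act p (fun k => f (M * k + j)%N) n = act (p \Po 'X^M) f (M * n + j)%N.
Proof.
elim/poly_ind: p n => [|p c IHp] n; first by rewrite comp_poly0 !act0l.
rewrite comp_poly_MXaddC !actDl !actC commr_polyX actXM IHp.
by rewrite [_ * 'X^M]mulrC actM actXn -addnA [(j + M)%N]addnC addnA -mulnSr.
Qed.

End Action.

Lemma act_dvdp (F : fieldType) (p q : {poly F}) f :
  p %| q -> act p f =1 (fun _ => 0) -> act q f =1 (fun _ => 0).
Proof. by move=> /dvdpP[r ->] pf n; rewrite actM; apply: act0r. Qed.

Lemma act_map (F F' : fieldType) (h : {rmorphism F -> F'}) (p : {poly F}) f n :
  act (map_poly h p) (fun k => h (f k)) n = h (act p f n).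
Proof.
rewrite rmorph_sum /act size_map_poly; apply: eq_bigr => i _.
by rewrite coef_map rmorphM.
Qed.

(** * Sequences killed by a list of characteristic roots *)

Section Kill.
Variable F : fieldType.
Implicit Types (Z W : seq F) (f g : nat -> F).

Definition rootpoly Z : {poly F} := \prod_(z <- Z) ('X - z%:P).

(** Allowing repeated and zero roots keeps the closure properties free of side
    conditions; polynomials and minimal orders only come back where a recurrence
    over the base field is needed. *)
Definition kill Z f := act (rootpoly Z) f =1 (fun _ => 0).

Lemma rootpoly_cons z Z : rootpoly (z :: Z) = ('X - z%:P) * rootpoly Z.
Proof. by rewrite /rootpoly big_cons. Qed.

Lemma rootpoly_cat Z W : rootpoly (Z ++ W) = rootpoly Z * rootpoly W.
Proof. by rewrite /rootpoly big_cat. Qed.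

Lemma rootpoly_monic Z : rootpoly Z \is monic.
Proof. exact: monic_prod_XsubC. Qed.

Lemma size_rootpoly Z : size (rootpoly Z) = (size Z).+1.
Proof. exact: size_prod_XsubC. Qed.

Lemma eq_kill Z f g : f =1 g -> kill Z f -> kill Z g.
Proof. by move=> eqfg kf n; rewrite -(eq_act _ eqfg). Qed.

Lemma act_XsubC z f n : act ('X - z%:P) f n = f n.+1 - z * f n.
Proof. by rewrite -polyCN actDl actX actC mulNr. Qed.

Lemma kill_nil f : kill [::] f <-> f =1 (fun _ => 0).
Proof. by split=> h n; have := h n; rewrite /rootpoly big_nil act1. Qed.

Lemma kill_cons z Z f :
  kill (z :: Z) f <-> kill Z (fun n => f n.+1 - z * f n).
Proof.
have eqd : act ('X - z%:P) f =1 (fun n => f n.+1 - z * f n) := act_XsubC z f.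
rewrite /kill rootpoly_cons mulrC.
by split=> h n; have := h n; rewrite actM ?(eq_act _ eqd) // -(eq_act _ eqd).
Qed.

Lemma kill_catl Z W f : kill Z f -> kill (Z ++ W) f.
Proof. by move=> kf; apply: act_dvdp kf; rewrite rootpoly_cat dvdp_mulr. Qed.

Lemma kill_catr Z W f : kill W f -> kill (Z ++ W) f.
Proof. by move=> kf; apply: act_dvdp kf; rewrite rootpoly_cat dvdp_mull. Qed.

Lemma killD Z W f g : kill Z f -> kill W g -> kill (Z ++ W) (fun n => f n + g n).
Proof.
move=> kf kg n; rewrite actDr (kill_catl W kf) (kill_catr Z kg) addr0 //.
Qed.

Lemma killZ Z a f : kill Z f -> kill Z (fun n => a * f n).
Proof. by move=> kf n; rewrite actZr kf mulr0. Qed.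

Lemma kill_shift Z f k : kill Z f -> kill Z (fun n => f (n + k)%N).
Proof. by move=> kf n; rewrite act_shift kf. Qed.

Lemma kill_window Z f m : kill Z f ->
  (forall i, (i < size Z)%N -> f (m + i)%N = 0) ->
  forall n, (m <= n)%N -> f n = 0.
Proof.
move=> kf f0; apply: (act_window (monic_neq0 (rootpoly_monic Z)) kf).
by rewrite size_rootpoly.
Qed.

(** Sequences with roots in [Z] and [W] multiply to a sequence with roots among
    the products: [E - zw] applied to [fg] is [(E - z)f * Eg + z f * (E - w)g],
    and each summand has lost one root.  The doubling at each step explains the
    bound on the number of roots. *)
Lemma killM (P : F -> Prop) Z W f g :
  (forall z w, z \in Z -> w \in W -> P (z * w)) ->
  kill Z f -> kill W g ->
  exists U, [/\ kill U (fun n => f n * g n), (size U < 2 ^ (size Z + size W))%N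
            & forall u, u \in U -> P u].
Proof.
have triv Z' W' f' g' : (forall n, f' n * g' n = 0) ->
    exists U, [/\ kill U (fun n => f' n * g' n),
      (size U < 2 ^ (size Z' + size W'))%N & forall u, u \in U -> P u].
  by move=> fg0; exists [::]; split=> //; [apply: (kill_nil _).2 | rewrite expn_gt0].
move: {2}(size Z + size W)%N (erefl (size Z + size W)%N) => k.
elim: k Z W f g => [|k IHk] [|z Z] [|w W] f g // szk PZW kf kg;
  try (by apply: triv => n; rewrite ((kill_nil f).1 kf) mul0r);
  try (by apply: triv => n; rewrite ((kill_nil g).1 kg) mulr0).
have kf' := (kill_cons _ _ _).1 kf; have kg' := (kill_cons _ _ _).1 kg.
rewrite /= in szk.
have kg1 : kill (w :: W) (fun n => g n.+1).
  by apply: eq_kill (kill_shift 1 kg) => n; rewrite addn1.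
case: (IHk Z (w :: W) _ _ _ _ kf' kg1).
- by rewrite /=; lia.
- by move=> a b aZ bW; apply: PZW => //; rewrite inE aZ orbT.
move=> U1 [k1 s1 P1].
case: (IHk (z :: Z) W _ _ _ _ (killZ z kf) kg').
- by rewrite /=; lia.
- by move=> a b aZ bW; apply: PZW => //; rewrite inE bW orbT.
move=> U2 [k2 s2 P2].
exists ((z * w) :: U1 ++ U2); split.
- apply: (kill_cons _ _ _).2; apply: eq_kill (killD k1 k2) => n /=; ring.
- have -> : ((size Z).+1 + (size W).+1 = (size Z + size W).+2)%N by lia.
  move: s1 s2; rewrite /= size_cat addnS [((size Z).+1 + size W)%N]addSn.
  by rewrite [X in _ -> _ -> (_ < X)%N]expnS mul2n -addnn; lia.
- move=> u; rewrite inE mem_cat => /or3P[/eqP-> | /P1 // | /P2 //].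
  by apply: PZW; rewrite inE eqxx.
Qed.

End Kill.

(** * Zeros of integer recurrences: Hansel's argument *)

(** Legendre's formula: [n!] contains at most [n / (p - 1)] factors [p]. *)
Lemma logn_fact_half p n : prime p -> (2 < p)%N -> (2 * logn p n`! <= n)%N.
Proof.
move=> pr_p p_gt2; rewrite logn_fact // big_add1 /=.
have: forall K m, (2 * \sum_(0 <= k < K) m %/ p ^ k.+1 <= m)%N; last exact.
elim=> [|K IHK] m; first by rewrite big_geq.
rewrite big_nat_recl // expn1.
under eq_bigr => k _ do rewrite expnS divnMA.
rewrite mulnDr; apply: leq_trans (_ : 2 * (m %/ p) + m %/ p <= m)%N.
  by rewrite leq_add2l.
have := leq_divM m p; nia.
Qed.

Section DividedCoefs.
Variable q : int.

(* The recursion [Q_j = F_(j+1) + a Q_(j+1)] propagates divisibility down from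
   the leading coefficient. *)
Lemma dvdz_coef_quotient (F Q : {poly int}) a h :
  F = Q * ('X - a%:P) -> (forall j, (h < j)%N -> (q %| F`_j)%Z) ->
  forall j, (h <= j)%N -> (q %| Q`_j)%Z.
Proof.
move=> defF dvF j; have := leq_addl j (size Q); move: {2}(size Q) => k.
elim: k j => [|k IHk] j le_k le_hj.
  by rewrite nth_default ?dvdz0 // -[j]addn0.
case: (ltnP j (size Q)) => [lt_j|?]; last by rewrite nth_default ?dvdz0.
have -> : Q`_j = F`_j.+1 + Q`_j.+1 * a.
  by rewrite defF mulrBr coefB coefMX coefMC /= subrK.
by apply: rpredD; [apply: dvF | apply/dvdz_mulr/IHk; rewrite ?addSnnS ?leqW].
Qed.

(** Each root is divided out in turn.  A quotient by a monic linear factor keeps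
    the divisibility of the high coefficients, one degree lower, until all
    coefficients of the last quotient are divisible by [q]. *)
Lemma dvdz_horner_roots (F : {poly int}) (s : seq int) t :
  uniq s -> (forall a, a \in s -> root F a) ->
  (forall j, (size s <= j)%N -> (q %| F`_j)%Z) -> (q %| F.[t])%Z.
Proof.
elim: s F => [|a s IHs] F /=.
  by move=> _ _ dvF; rewrite horner_coef; apply: rpred_sum => i _;
     apply/dvdz_mulr/dvF.
move=> /andP[a_s uniq_s] Fs dvF.
have /factor_theorem[Q defF] : root F a by apply: Fs; rewrite inE eqxx.
rewrite defF hornerM; apply/dvdz_mulr/IHs => //; last first.
  exact: dvdz_coef_quotient defF dvF.
move=> b b_s; have := Fs b; rewrite inE b_s orbT defF rootM root_XsubC.
by case/(_ isT)/orP=> // /eqP eq_ba; rewrite -eq_ba b_s in a_s.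
Qed.

End DividedCoefs.

(** The Newton basis: [n! / (n - i)!] as a polynomial in [n]. *)
Definition ffact_poly i : {poly int} := \prod_(j < i) ('X - (j%:Z)%:P).

Lemma ffact_poly_nat i n : (ffact_poly i).[n%:Z] = (n ^_ i)%:Z.
Proof.
elim: i => [|i IHi]; first by rewrite /ffact_poly big_ord0 hornerC.
rewrite /ffact_poly big_ord_recr hornerM -/(ffact_poly i) IHi ffactnSr PoszM.
rewrite hornerXsubC; case: (leqP i n) => [/subzn -> // | lt_ni].
by rewrite ffact_small // !mul0r.
Qed.

Lemma size_ffact_poly i : size (ffact_poly i) = i.+1.
Proof.
rewrite /ffact_poly -(big_mkord xpredT (fun j => 'X - (j%:Z)%:P)).
rewrite -(big_map Posz xpredT (fun z => 'X - z%:P)) size_prod_XsubC.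
by rewrite size_map size_iota subn0.
Qed.

Definition infinitely (P : nat -> Prop) := forall N, exists2 n, (N <= n)%N & P n.

Lemma infinitely_uniq P h : infinitely P ->
  exists s : seq nat, [/\ uniq s, size s = h & forall n, n \in s -> P n].
Proof.
move=> infP; elim: h => [|h [s [uniq_s sz_s Ps]]]; first by exists [::].
have [n le_n Pn] := infP (\max_(i <- s) i).+1; exists (n :: s); split.
- rewrite /= uniq_s andbT; apply/negP => n_s.
  have := @leq_bigmax_seq _ s xpredT (fun i => i) n n_s isT.
  by rewrite leqNgt le_n.
- by rewrite /= sz_s.
- by move=> k; rewrite inE => /orP[/eqP-> //|/Ps].
Qed.

(** A binomial series whose coefficients are divisible by growing powers of [p]
    interpolates its values: after multiplication by [N!] it is an integer
    polynomial, whose coefficients of degree at least [2k] carry [k] more factors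
    [p] than [N!] does.  Dividing by [2k] linear factors, one for each
    of [2k] zeros, only involves those coefficients, so all values are divisible
    by [p^k]. *)
Lemma binomial_series_zeros p (d : nat -> int) (b : nat -> int) :
    prime p -> (2 < p)%N ->
    (forall n, b n = \sum_(i < n.+1) 'C(n, i)%:Z * (p%:Z ^+ i * d i)) ->
    infinitely (fun n => b n = 0) ->
  forall n, b n = 0.
Proof.
move=> pr_p p_gt2 defb infb t.
have dv_bt k : ((p ^ k)%:Z %| b t)%Z.
  have [s [uniq_s sz_s bs]] := infinitely_uniq (2 * k) infb.
  pose N := maxn t (\max_(i <- s) i).
  (* [c i = N! / i!] clears the denominator of ['C(n, i) = n^_i / i!]. *)
  pose c i := ('C(N, i) * (N - i)`!)%N.
  have defc i : (i <= N)%N -> (c i * i`! = N`!)%N.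
    by move=> le_i; rewrite -(bin_fact le_i) /c; lia.
  pose F : {poly int} :=
    \sum_(i < N.+1) (p%:Z ^+ i * d i * (c i)%:Z) *: ffact_poly i.
  have FN n : (n <= N)%N -> F.[n%:Z] = N`!%:Z * b n.
    move=> le_nN; rewrite /F horner_sum defb mulr_sumr.
    rewrite (big_ord_widen N.+1 (fun i => N`!%:Z * ('C(n, i)%:Z * (p%:Z ^+ i * d i)))) //.
    rewrite [RHS]big_mkcond; apply: eq_bigr => i _.
    rewrite hornerZ ffact_poly_nat ltnS; case: leqP => [le_in | lt_ni].
      have /defc <- : (i <= N)%N by rewrite -ltnS.
      by rewrite -bin_ffact !PoszM; ring.
    by rewrite ffact_small // mulr0.
  have dvF j : (2 * k <= j)%N -> ((p ^ (k + logn p N`!))%:Z %| F`_j)%Z.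
    move=> le_kj; rewrite coef_sum; apply: rpred_sum => i _; rewrite coefZ.
    case: (ltnP i j) => [lt_ij | le_ji].
      by rewrite [_`_j]nth_default ?mulr0 ?dvdz0 // size_ffact_poly.
    apply/dvdz_mulr; rewrite mulrAC; apply/dvdz_mulr.
    have -> : p%:Z ^+ i * (c i)%:Z = (p ^ i * c i)%:Z by rewrite PoszM -!natz natrX.
    have le_iN : (i <= N)%N by rewrite -ltnS.
    have c_gt0 : (0 < c i)%N by rewrite muln_gt0 bin_gt0 le_iN fact_gt0.
    have p_i : (0 < p ^ i)%N by rewrite expn_gt0 prime_gt0.
    move: c_gt0 (defc _ le_iN); move: (c i) => ci c_gt0 defci.
    have pc_gt0 : (0 < p ^ i * ci)%N by rewrite muln_gt0 p_i.
    rewrite dvdzE !absz_nat pfactor_dvdn //.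
    rewrite -defci (lognM _ c_gt0) ?fact_gt0 // (lognM _ p_i c_gt0) pfactorK //.
    by have := logn_fact_half i pr_p p_gt2; lia.
  have : ((p ^ (k + logn p N`!))%:Z %| F.[t%:Z])%Z.
    apply: (@dvdz_horner_roots _ _ [seq n%:Z | n <- s]).
    - by rewrite map_inj_uniq // => x y [].
    - move=> a /mapP[n n_s ->]; rewrite rootE FN ?bs ?mulr0 //.
      rewrite leq_max; apply/orP; right.
      exact: (@leq_bigmax_seq _ s xpredT (fun i => i)).
    - by rewrite size_map sz_s.
  rewrite FN ?leq_maxl // !dvdzE abszM !absz_nat.
  have [|m co_m] := @pfactor_coprime p N`! pr_p; first exact: fact_gt0.
  set v := logn p N`! => ->.
  rewrite [(m * _)%N]mulnC addnC expnD -mulnA dvdn_pmul2l ?expn_gt0 ?prime_gt0 //.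
  by rewrite Gauss_dvdr // coprimeXl.
apply/eqP; rewrite -absz_eq0; case: posnP => // bt_gt0.
have := dv_bt `|b t|%N; rewrite dvdzE absz_nat => /(dvdn_leq bt_gt0).
by rewrite leqNgt ltn_expl // prime_gt1.
Qed.

Section PeriodModPrime.
Variables (P : {poly int}) (p : nat).

(** Membership in the ideal [(P, p)] of [Z[x]]. *)
Definition congr0 (H : {poly int}) := exists U V, H = P * U + p%:Z *: V.

(** [x] is invertible modulo [(P, p)] as soon as [P(0)] is. *)
Lemma congr0_cancelX H : coprimez P`_0 p%:Z -> congr0 ('X * H) -> congr0 H.
Proof.
move=> /coprimezP[[u v] /= uv1] [U [V defXH]].
have [S defP] : exists S, P = (P`_0)%:P + 'X * S.
  have /factor_theorem[S defS] : root (P - (P`_0)%:P) 0.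
    by rewrite rootE hornerD hornerN hornerC horner_coef0 subrr.
  exists S; move/eqP: defS; rewrite subr_eq => /eqP {1}->.
  by rewrite polyC0 subr0 addrC mulrC.
exists (u *: H - u *: (S * U)), (v *: H - u *: (S * V)).
have : H = u *: (P`_0 *: H) + v *: (p%:Z *: H).
  by rewrite !scalerA -scalerDl uv1 scale1r.
have -> : P`_0 *: H = P * H - S * ('X * H).
  by rewrite {2}defP -mul_polyC; ring.
rewrite defXH => {1}->; rewrite -!mul_polyC; ring.
Qed.

(** Pigeonhole on the remainders of the powers of [x]. *)
Lemma period_mod_prime : prime p -> P \is monic -> ~~ (p%:Z %| P`_0)%Z ->
  exists2 m, (0 < m)%N & congr0 ('X^m - 1).
Proof.
move=> pr_p mon_P p_P0.
have co_P0 : coprimez P`_0 p%:Z.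
  by rewrite coprimez_sym; move: p_P0; rewrite -(prime_coprime _ pr_p).
pose r i := Pdiv.CommonRing.rmodp 'X^i P; pose t := size P.
pose phi i : {ffun 'I_t -> 'F_p} := [ffun l : 'I_t => ((r i)`_l)%:~R].
have [i [j [lt_ij eq_phi]]] : exists i j : nat, (i < j)%N /\ phi i = phi j.
  pose g (i : 'I_(#|{: {ffun 'I_t -> 'F_p}}|).+1) := phi i.
  have /injectivePn[i [j ne_ij eq_g]] : ~~ injectiveb g.
    by apply/negP => /injectiveP/leq_card; rewrite card_ord ltnn.
  case: (ltngtP i j) => [lt_ij|lt_ji|/val_inj eq_ij].
  - by exists i, j.
  - by exists j, i.
  - by rewrite eq_ij eqxx in ne_ij.
exists (j - i)%N; first by rewrite subn_gt0.
suff: congr0 ('X^i * ('X^(j - i) - 1)).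
  move: ('X^(j - i) - 1) => H; elim: (i : nat) => [|k IHk].
    by rewrite expr0 mul1r.
  by rewrite exprS -mulrA => /(congr0_cancelX co_P0).
have [q defr] : exists q : nat -> {poly int}, forall k, 'X^k = P * q k + r k.
  exists (fun k => Pdiv.CommonRing.rdivp 'X^k P) => k.
  by rewrite {1}(Pdiv.RingMonic.rdivp_eq mon_P 'X^k) mulrC.
have nz_P : P != 0 by apply: monic_neq0.
have sz_r k : (size (r k) <= t)%N by apply/ltnW/Pdiv.CommonRing.ltn_rmodpN0.
pose D := r j - r i.
have dvD l : (p%:Z %| D`_l)%Z.
  case: (ltnP l t) => [lt_lt|le_tl]; last first.
    rewrite nth_default ?dvdz0 // (leq_trans (size_polyD _ _)) // size_polyN.
    by rewrite geq_max !(leq_trans (sz_r _)).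
  rewrite (dvdz_pcharf (pchar_Fp pr_p)) coefB rmorphB /= subr_eq0.
  by move/ffunP/(_ (Ordinal lt_lt)): eq_phi; rewrite !ffunE /= => ->.
have [V defV] : exists V, D = p%:Z *: V.
  exists (\poly_(l < size D) (D`_l %/ p%:Z)%Z); apply/polyP => l.
  rewrite coefZ coef_poly; case: ltnP => [_|?]; last by rewrite nth_default ?mulr0.
  by rewrite mulrC divzK.
exists (q j - q i), V.
rewrite -defV mulrBr mulr1 -exprD subnKC 1?ltnW // (defr j) (defr i) /D.
by ring.
Qed.

End PeriodModPrime.

(** Choose a prime [p] not dividing [P(0)] and [m] with [x^m = 1 + P U + p V].
    As [P] kills [f], shifting [n] times by [m] acts on [f] as [(1 + p V)^n], whose
    expansion presents [f (m n + j)] as a binomial series in [n]. *)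
Lemma integer_recurrence_zeros (P : {poly int}) (f : nat -> int) :
    P \is monic -> P`_0 != 0 -> act P f =1 (fun _ => 0) ->
  exists2 m, (0 < m)%N &
    forall j, infinitely (fun n => f (m * n + j)%N = 0) ->
    forall n, f (m * n + j)%N = 0.
Proof.
move=> mon_P nz_P0 Pf.
have [p lt_p pr_p] := prime_above (maxn 2 `|P`_0|).
have [p_gt2 p_gtP] : (2 < p)%N /\ (`|(P`_0)%R| < p)%N.
  by move: lt_p; rewrite gtn_max => /andP.
have p_P0 : ~~ (p%:Z %| P`_0)%Z.
  apply/negP; rewrite dvdzE absz_nat => /dvdn_leq.
  by rewrite absz_gt0 leqNgt p_gtP => /(_ nz_P0).
have [m m_gt0 [U [V defXm]]] := period_mod_prime pr_p mon_P p_P0.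
exists m => // j infj; pose d k := act (V ^+ k) f j.
apply: (@binomial_series_zeros p d (fun n => f (m * n + j)%N) pr_p p_gt2) => //.
have actXm k g : act P g =1 (fun _ => 0) ->
    act (('X^m - 1) ^+ k) g =1 (fun n => p%:Z ^+ k * act (V ^+ k) g n).
  elim: k g => [|k IHk] g Pg n; first by rewrite !expr0 mul1r.
  have eq1 : act ('X^m - 1) g =1 (fun n => p%:Z * act V g n).
    by move=> l; rewrite defXm [P * U]mulrC actDl actM (act0r _ Pg) actZl add0r.
  rewrite exprSr actM (eq_act _ eq1) actZr IHk; last first.
    by move=> l; rewrite -actM mulrC actM; apply: act0r.
  by rewrite -actM -exprSr mulrA -exprS.
move=> n; have -> : f (m * n + j)%N = act ((1 + ('X^m - 1)) ^+ n) f j.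
  by rewrite [1 + _]addrC subrK -exprM actXn addnC.
rewrite exprDn; under eq_bigr => i _ do rewrite expr1n mul1r.
have act_sum : forall (I : Type) (s : seq I) (G : I -> {poly int}),
    act (\sum_(i <- s) G i) f j = \sum_(i <- s) act (G i) f j.
  move=> I s G; elim: s => [|i s IHs]; first by rewrite !big_nil act0l.
  by rewrite !big_cons actDl IHs.
rewrite act_sum; apply: eq_bigr => i _.
by rewrite -scaler_nat actZl actXm // /d natz.
Qed.

(** * From algebraic numbers to integers *)

Notation pQtoC := (map_poly (ratr : rat -> algC)).

(** The product of the minimal polynomials over [Z].  A minimal polynomial with
    constant term zero is divisible by ['X], hence belongs to the root zero. *)
Lemma rational_multiple (Z : seq algC) : exists Q : {poly rat},
  [/\ Q \is monic, rootpoly Z %| pQtoC Q & 0 \notin Z -> Q`_0 != 0].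
Proof.
elim: Z => [|z Z [Q [mon_Q dvQ Q0]]].
  by exists 1; rewrite monic1 /rootpoly big_nil dvd1p coef1 oner_neq0.
have [p [def_p mon_p] dv_p] := minCpolyP z.
exists (p * Q); split; first by rewrite monicMl.
  by rewrite rootpoly_cons rmorphM dvdp_mul // dvdp_XsubCl dv_p.
rewrite inE negb_or => /andP[nz_z /Q0 nz_Q0].
rewrite coef0M mulf_neq0 // -horner_coef0 -rootE.
apply/negP=> /factor_theorem[r]; rewrite subr0 => def_pr.
have : root (pQtoC p) z by rewrite dv_p.
rewrite def_pr rmorphM /= map_polyX rootM dv_p rootX [_ == 0]eq_sym (negPf nz_z) orbF.
have nz_r : r != 0.
  by apply: contraTneq mon_p => r0; rewrite def_pr r0 mul0r monicE lead_coef0 eq_sym oner_eq0.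
by move=> /(dvdp_leq nz_r); rewrite def_pr size_mulX // ltnn.
Qed.

Section Coordinates.
Variables (K : fieldExtType rat) (iota : {rmorphism K -> algC}).

Lemma iota_alg (a : rat) : iota a%:A = ratr a.
Proof. exact: (fmorph_eq_rat (iota \o in_alg K)). Qed.

Lemma pQtoC_iota (Q : {poly rat}) :
  pQtoC Q = map_poly iota (map_poly (in_alg K) Q).
Proof. by rewrite -map_poly_comp; apply: eq_map_poly => a /=; rewrite -iota_alg. Qed.

Lemma kill_rational (Z : seq algC) (Q : {poly rat}) (c : nat -> K) :
  rootpoly Z %| pQtoC Q -> kill Z (fun n => iota (c n)) ->
  act (map_poly (in_alg K) Q) c =1 (fun _ => 0).
Proof.
move=> dvQ kc n; apply: (fmorph_inj iota); rewrite -act_map -pQtoC_iota rmorph0.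
exact: act_dvdp dvQ kc n.
Qed.

Definition coordK (i : 'I_(\dim {:K})) (x : K) : rat := coord (vbasis {:K}) i x.

Lemma coordK_eq0 (x : K) : (forall i, coordK i x = 0) -> x = 0.
Proof.
move=> x0; rewrite (coord_vbasis (memvf x)); apply: big1 => i _.
by rewrite [coord _ _ _]x0 scale0r.
Qed.

Lemma act_coordK (Q : {poly rat}) (c : nat -> K) i :
  act (map_poly (in_alg K) Q) c =1 (fun _ => 0) ->
  act Q (fun n => coordK i (c n)) =1 (fun _ => 0).
Proof.
move=> Qc n; transitivity (coordK i (act (map_poly (in_alg K) Q) c n)).
  rewrite /act /coordK size_map_poly linear_sum.
  by apply: eq_bigr => l _; rewrite coef_map /= mulr_algl linearZ.
by rewrite Qc /coordK linear0.
Qed.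

End Coordinates.

(** Scaling by powers of a common denominator turns a rational recurrence into
    a monic integral one with the same zeros. *)
Lemma rational_recurrence_zeros (Q : {poly rat}) (x : nat -> rat) :
    Q \is monic -> Q`_0 != 0 -> act Q x =1 (fun _ => 0) ->
  exists2 m, (0 < m)%N &
    forall j, infinitely (fun n => x (m * n + j)%N = 0) ->
    forall n, x (m * n + j)%N = 0.
Proof.
move=> mon_Q nz_Q0 Qx.
have [q [a nz_a defQ]] := rat_poly_scale Q.
have aR_nz : (a%:~R : rat) != 0 by rewrite intr_eq0.
have [t sz_Q] : exists t, size Q = t.+1.
  by exists (size Q).-1; rewrite prednK // size_poly_gt0 monic_neq0.
have Qt : Q`_t = 1 by have /monicP := mon_Q; rewrite lead_coefE sz_Q.
have aQ l : a%:~R * Q`_l = (q`_l)%:~R.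
  by rewrite defQ coefZ coef_map /= mulVKf.
(* [P] is the monic polynomial [a^t Q(x / a)], where [q = a Q] is integral. *)
pose P : {poly int} := \poly_(i < t.+1) (if i == t then 1 else a ^+ (t - i).-1 * q`_i).
have P_t : P`_t = 1 by rewrite coef_poly ltnSn eqxx.
have sz_P : size P = t.+1.
  apply/eqP; rewrite eqn_leq size_poly ltnNge; apply/negP => le_sz.
  by have := P_t; rewrite nth_default.
have PQ i : (i <= t)%N -> (P`_i)%:~R = a%:~R ^+ (t - i) * Q`_i :> rat.
  rewrite leq_eqVlt coef_poly ltnS => /orP[/eqP->|lt_it].
    by rewrite leqnn eqxx subnn Qt mulr1.
  rewrite (ltnW lt_it) (ltn_eqF lt_it) rmorphM /= rmorphXn /= -aQ mulrA -exprSr prednK //.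
  by rewrite subn_gt0.
pose D : int := \prod_(i < t) denq (x i).
have nz_D : (D%:~R : rat) != 0.
  by rewrite intr_eq0; apply/prodf_neq0 => i _; rewrite denq_eq0.
pose y n := D%:~R * (a%:~R ^+ n * x n) : rat.
have y_eq0 n : (y n == 0) = (x n == 0).
  by rewrite !mulf_eq0 (negPf nz_D) expf_eq0 (negPf aR_nz) andbF.
have Py n : \sum_(i < t.+1) (P`_i)%:~R * y (n + i)%N = 0.
  transitivity (D%:~R * a%:~R ^+ (n + t) * act Q x n); last by rewrite Qx mulr0.
  rewrite /act sz_Q mulr_sumr; apply: eq_bigr => i _.
  rewrite PQ -1?ltnS // /y.
  have -> : (n + t = (t - i) + (n + i))%N by have := ltn_ord i; lia.
  rewrite [X in D%:~R * X * _]exprD; ring.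
(* [D] clears the denominators of the initial values, and the recurrence, being
   monic and integral, propagates integrality. *)
have [f deff] : exists f : nat -> int, forall n, y n = (f n)%:~R.
  have int_y n : y n \is a Num.int.
    elim/ltn_ind: n => n IH; case: (ltnP n t) => [lt_nt|le_tn].
      rewrite /y /D (bigD1 (Ordinal lt_nt)) //= rmorphM /= -mulrA mulrCA.
      rewrite rpredM ?intr_int // mulrCA rpredM ?rpredX ?intr_int //.
      by rewrite mulrC -numqE intr_int.
    have := Py (n - t)%N; rewrite big_ord_recr /= P_t mul1r subnK // => /eqP.
    rewrite addrC addr_eq0 => /eqP ->; rewrite rpredN rpred_sum // => i _.
    by rewrite rpredM ?intr_int // IH //; have := ltn_ord i; lia.
  by exists (fun n => Num.floor (y n)) => n; rewrite floorK.
have [m m_gt0 zeros] : exists2 m, (0 < m)%N &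
    forall j, infinitely (fun n => f (m * n + j)%N = 0) ->
    forall n, f (m * n + j)%N = 0.
  apply: (@integer_recurrence_zeros P).
  - by rewrite monicE lead_coefE sz_P P_t.
  - have := PQ 0%N isT; rewrite -(eqr_int rat) => ->.
    by rewrite mulf_neq0 ?expf_neq0.
  - move=> n; apply: (@intr_inj rat); rewrite -[RHS](Py n) /act sz_P rmorph_sum.
    by apply: eq_bigr => i _; rewrite rmorphM /= -deff.
have f_eq0 n : f n = 0 <-> x n = 0.
  have eq0 : (f n == 0) = (x n == 0) by rewrite -(intr_eq0 rat) -deff y_eq0.
  by split=> /eqP fx0; apply/eqP; rewrite ?eq0 // -eq0.
exists m => // j infj n; apply: (f_eq0 _).1; apply: zeros => N.
by have [k le_k xk] := infj N; exists k => //; apply: (f_eq0 _).2.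
Qed.

(** * Skolem-Mahler-Lech *)

Lemma infinitely_class (P : nat -> Prop) m : (0 < m)%N -> infinitely P ->
  exists2 r, (r < m)%N & infinitely (fun n => P (m * n + r)%N).
Proof.
move=> m_gt0 infP; apply: NNPP => no_r.
have bound r : (r < m)%N -> exists N, forall n, (N <= n)%N -> ~ P (m * n + r)%N.
  move=> lt_r; apply: NNPP => no_N; apply: no_r; exists r => // N.
  apply: NNPP => no_n; apply: no_N; exists N => n le_n Pn; apply: no_n.
  by exists n.
have [N boundN] : exists N, forall r n, (r < m)%N -> (N <= n)%N -> ~ P (m * n + r)%N.
  elim: {1 3}m (leqnn m) => [|k IHk] le_km; first by exists 0%N.
  have [N1 N1P] := IHk (ltnW le_km); have [N2 N2P] := bound k le_km.
  exists (maxn N1 N2) => r n; rewrite ltnS leq_eqVlt geq_max.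
  by move=> /orP[/eqP->|lt_rk] /andP[le1 le2]; [apply: N2P | apply: N1P].
have [n le_n Pn] := infP (m * N.+1)%N.
apply: (boundN (n %% m)%N (n %/ m)%N) => //; first by rewrite ltn_mod.
  by rewrite leq_divRL // mulnC (leq_trans _ le_n) // leq_mul2l leqnSn orbT.
by rewrite mulnC -divn_eq.
Qed.

Section ZeroSets.
Variables (K : fieldExtType rat) (iota : {rmorphism K -> algC}).
Implicit Types (c : nat -> K) (Z : seq algC).

(** An infinite zero set of [c] contains a full arithmetic progression: the
    coordinates of [c] over the rationals vanish simultaneously. *)
Lemma infinitely_zero_progression Z c M j :
    (0 < M)%N -> 0 \notin Z -> kill Z (fun n => iota (c n)) ->
    infinitely (fun n => c (M * n + j)%N = 0) ->
  exists m s, (s < m)%N /\ forall n, c (M * (m * n + s) + j)%N = 0.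
Proof.
move=> M_gt0 Z0 kc infc.
have [Q [mon_Q dvQ Q0]] := rational_multiple Z; have {Q0} nz_Q0 := Q0 Z0.
have Qc := kill_rational dvQ kc.
pose x i n := coordK i (c n).
have [mu mu_gt0 zeros] : exists2 mu : 'I_(\dim {:K}) -> nat, forall i, (0 < mu i)%N &
    forall i j, infinitely (fun n => x i (mu i * n + j)%N = 0) ->
      forall n, x i (mu i * n + j)%N = 0.
  have ex i := rational_recurrence_zeros mon_Q nz_Q0 (act_coordK i Qc).
  have : forall i, exists m : nat, (0 < m)%N /\ forall j,
    infinitely (fun n => x i (m * n + j)%N = 0) -> forall n, x i (m * n + j)%N = 0.
    by move=> i; have [m ? ?] := ex i; exists m.
  move/fin_all_exists=> [mu muP]; exists mu => i; first by case: (muP i).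
  by case: (muP i) => _; apply.
pose m := (\prod_i mu i)%N; have m_gt0 : (0 < m)%N by apply: prodn_gt0.
have [s lt_sm infs] := infinitely_class m_gt0 infc.
exists m, s; split=> // n; apply: coordK_eq0 => i.
have [k defm] : exists k, m = (mu i * k)%N.
  by exists (\prod_(l | l != i) mu l)%N; rewrite /m (bigD1 i).
have k_gt0 : (0 < k)%N by move: m_gt0; rewrite defm muln_gt0 => /andP[].
have -> : (M * (m * n + s) + j = mu i * (M * k * n) + (M * s + j))%N.
  by rewrite defm; ring.
apply: zeros => N; have [l le_l cl] := infs N; exists (M * k * l)%N.
  by rewrite (leq_trans le_l) // leq_pmull // muln_gt0 M_gt0.
rewrite /x; have -> : (mu i * (M * k * l) + (M * s + j) = M * (m * l + s) + j)%N.
  by rewrite defm; ring.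
by rewrite cl /coordK linear0.
Qed.

End ZeroSets.

Lemma coprimep_rootpoly (F : fieldType) (Z W : seq F) :
  (forall z, z \in Z -> z \notin W) -> coprimep (rootpoly Z) (rootpoly W).
Proof.
elim: Z => [|z Z IHZ] disj; first by rewrite /rootpoly big_nil coprime1p.
rewrite rootpoly_cons coprimepMl coprimep_sym coprimep_XsubC.
rewrite root_prod_XsubC disj ?inE ?eqxx //= IHZ // => y yZ.
by apply: disj; rewrite inE yZ orbT.
Qed.

(** The indicator of the progression times [g] is a combination of the twists
    [w^(kn) g(n)] of [g] by the [m]-th roots of unity [w^k].  It vanishes, so [g]
    itself ([k = 0]) is a combination of the twists with [k > 0].  By the
    hypothesis on the ratios those have no root in common with [g], and a
    sequence killed by two coprime polynomials is zero. *)
Lemma nondegenerate_zero (Z : seq algC) (g : nat -> algC) m s :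
    (s < m)%N -> 0 \notin Z -> kill Z g ->
    (forall z z', z \in Z -> z' \in Z -> z ^+ m = z' ^+ m -> z = z') ->
    (forall n, g (m * n + s)%N = 0) ->
  forall n, g n = 0.
Proof.
case: m => // m lt_sm Z0 kg nondeg g0.
have [w prim_w] := C_prim_root_exists (ltn0Sn m).
pose h k n := (w ^+ k) ^+ n * g n.
pose Zk k := [seq w ^+ k * z | z <- Z].
have kh k : kill (Zk k) (h k).
  rewrite /Zk /h; elim: Z g kg {Z0 nondeg g0 h Zk} => [|z Z IHZ] g kg.
    by apply: (kill_nil _).2 => n; rewrite ((kill_nil _).1 kg) mulr0.
  apply: (kill_cons _ _ _).2; have := IHZ _ ((kill_cons _ _ _).1 kg).
  move=> /(killZ (w ^+ k)); apply: eq_kill => n.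
  by rewrite exprS; ring.
have kW : kill (flatten [seq Zk k.+1 | k <- iota 0 m])
    (fun n => \sum_(k < m) (w ^+ k.+1) ^- s * h k.+1 n).
  apply: eq_kill (_ : kill _ (fun n => \sum_(k <- iota 0 m) (w ^+ k.+1) ^- s * h k.+1 n)).
    move=> n; rewrite -(big_mkord xpredT (fun k => (w ^+ k.+1) ^- s * h k.+1 n)).
    by rewrite /index_iota subn0.
  elim: (iota 0 m) => [|k l IHl] /=.
    by apply: (kill_nil _).2 => n; rewrite big_nil.
  by apply: eq_kill (killD (killZ _ (kh k.+1)) IHl) => n; rewrite big_cons.
set W := flatten _ in kW.
(* The geometric sum [\sum_k w^(k (n - s))] vanishes unless [n = s] modulo
   [m.+1], and there [g] does. *)
have sumh n : g n + \sum_(k < m) (w ^+ k.+1) ^- s * h k.+1 n = 0.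
  transitivity (g n * \sum_(k < m.+1) (w ^+ n / w ^+ s) ^+ k).
    rewrite mulr_sumr big_ord_recl expr0 mulr1; congr (_ + _); apply: eq_bigr => k _.
    rewrite /h /bump /= ?add1n expr_div_n -!exprM ![(k.+1 * _)%N]mulnC; ring.
  have w_nz : w ^+ s != 0.
    apply/expf_neq0/eqP => w0; have := prim_expr_order prim_w.
    by rewrite w0 expr0n => /eqP; rewrite eq_sym oner_eq0.
  have [eq_ns|ne_ns] := eqVneq (n %% m.+1)%N s.
    by rewrite [n](divn_eq n m.+1) mulnC eq_ns g0 mul0r.
  apply/eqP; rewrite mulf_eq0; apply/orP; right.
  have ne1 : w ^+ n / w ^+ s - 1 != 0.
    apply: contraNneq ne_ns => /eqP; rewrite subr_eq0 => /eqP eq1.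
    have : w ^+ n == w ^+ s by rewrite -[w ^+ n](divfK w_nz) eq1 mul1r.
    by rewrite (eq_prim_root_expr prim_w) => /eqP ->; rewrite modn_small.
  have := subrX1 (w ^+ n / w ^+ s) m.+1.
  rewrite expr_div_n -!exprM ![(_ * m.+1)%N]mulnC !exprM (prim_expr_order prim_w).
  by rewrite !expr1n divr1 subrr => /esym/eqP; rewrite mulf_eq0 (negPf ne1).
have co : coprimep (rootpoly Z) (rootpoly W).
  apply: coprimep_rootpoly.
  move=> z zZ; apply/negP=> /flatten_mapP[k]; rewrite mem_iota add0n /= => lt_km.
  move=> /mapP[y yZ def_z].
  have eq_zy : z = y.
    apply: nondeg => //; rewrite def_z exprMn -exprM mulnC exprM.
    by rewrite (prim_expr_order prim_w) expr1n mul1r.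
  have nz_y : y != 0 by apply: contraNneq Z0 => <-.
  have : w ^+ k.+1 == w ^+ 0.
    by rewrite expr0 -(inj_eq (mulIf nz_y)) -def_z eq_zy mul1r.
  by rewrite (eq_prim_root_expr prim_w) mod0n modn_small.
have kgW : kill W g.
  by apply: eq_kill (killZ (-1) kW) => n; rewrite mulN1r -(addr0_eq (sumh n)) opprK.
have /Bezout_eq1_coprimepP[[u v] /= uv1] := co.
move=> n; rewrite -(act1 g n) -uv1 actDl !actM.
by rewrite (act0r _ kg) (act0r _ kgW) addr0.
Qed.

Lemma kill_progression (F : fieldType) (Z : seq F) f M j :
  kill Z f -> kill [seq z ^+ M | z <- Z] (fun n => f (M * n + j)%N).
Proof.
move=> kf n; rewrite act_progression; apply: act_dvdp kf _.
elim: Z => [|z Z IHZ]; first by rewrite /rootpoly !big_nil comp_polyC dvd1p.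
rewrite /= !rootpoly_cons comp_polyM dvdp_mul // dvdp_XsubCl.
by rewrite rootE horner_comp !hornerE subrr.
Qed.

(** A factor [E] of the operator is a shift, so a root zero only affects an
    initial segment. *)
Lemma kill_drop0 (F : fieldType) (Z : seq F) f k : kill Z f ->
  (size Z <= k)%N -> kill [seq z <- Z | z != 0] (fun n => f (n + k)%N).
Proof.
move=> kf le_k.
suff kf' : kill [seq z <- Z | z != 0] (fun n => f (n + count (pred1 0%R) Z)%N).
  have le_ck := leq_trans (count_size (pred1 0%R) Z) le_k.
  apply: eq_kill (kill_shift (k - count (pred1 0%R) Z) kf') => n.
  by rewrite -addnA subnK.
elim: Z f kf {le_k} => [|z Z IHZ] f kf.
  by apply: (kill_nil _).2 => n; rewrite ((kill_nil _).1 kf).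
have {}kf := (kill_cons _ _ _).1 kf; have := IHZ _ kf => /=.
case: (eqVneq z 0) => [->|nz_z] /=.
  by apply: eq_kill => n; rewrite mul0r subr0 add1n addnS.
by move=> kf'; apply: (kill_cons _ _ _).2; apply: eq_kill kf' => n; rewrite add0n.
Qed.

Section Dichotomy.
Variables (K : fieldExtType rat) (iota : {rmorphism K -> algC}).

(** If infinitely many terms of the class vanish, a whole progression of them
    does.  The roots of the subsequence are the [z ^+ M]; a ratio of two of them
    that is a root of unity comes from a ratio [z / z'] of order dividing [M], so
    it is one, and the subsequence is nondegenerate. *)
Lemma class_dichotomy (c : nat -> K) (Z : seq algC) M j :
    (0 < M)%N -> kill Z (fun n => iota (c n)) ->
    (forall z z' k, z \in Z -> z' \in Z -> z != 0 -> z' != 0 ->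
       k.-primitive_root (z / z') -> (k %| M)%N) ->
  (forall n, (size Z <= n)%N -> c (M * n + j)%N = 0) \/
  (exists N, forall n, (N <= n)%N -> c (M * n + j)%N != 0).
Proof.
move=> M_gt0 kc torM.
case: (classic (infinitely (fun n => c (M * n + j)%N = 0))) => [infc|fin]; last first.
  right; apply: NNPP => noN; apply: fin => N; apply: NNPP => no_n.
  apply: noN; exists N => n le_Nn; apply/eqP => cn; apply: no_n; exists n => //.
left; pose k := (M * size Z)%N; pose c' n := c (n + k)%N.
pose Z0 := [seq z <- Z | z != 0].
have kc' : kill Z0 (fun n => iota (c' n)).
  by apply: (kill_drop0 kc); rewrite leq_pmull.
have Z0_0 : 0 \notin Z0 by rewrite mem_filter eqxx.
have inf' : infinitely (fun n => c' (M * n + j)%N = 0).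
  move=> N; have [n le_n cn] := infc (N + size Z)%N; exists (n - size Z)%N.
    by rewrite leq_subRL ?(leq_trans (leq_addl _ _) le_n) // addnC.
  rewrite /c' /k addnAC -mulnDr subnK //.
  exact: leq_trans (leq_addl _ _) le_n.
have [m [s [lt_sm c0]]] := infinitely_zero_progression M_gt0 Z0_0 kc' inf'.
have g0 : forall n, iota (c' (M * n + j)%N) = 0.
  apply: (nondegenerate_zero lt_sm _ (kill_progression M j kc')).
  - apply/mapP=> [[z zZ0 /esym/eqP]]; rewrite expf_eq0 M_gt0 /= => /eqP z0.
    by rewrite -z0 zZ0 in Z0_0.
  - move=> _ _ /mapP[z zZ ->] /mapP[z' zZ' ->] eqm.
    move: zZ zZ'; rewrite !mem_filter => /andP[nz_z zZ] /andP[nz_z' zZ'].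
    have nz_z'M : z' ^+ M != 0 by rewrite expf_neq0.
    have zz'1 : (z / z') ^+ (M * m) = 1.
      by rewrite exprM expr_div_n expr_div_n eqm divff // expf_neq0.
    have [|l prim_l _] := prim_order_exists _ zz'1.
      by rewrite muln_gt0 M_gt0 (leq_ltn_trans _ lt_sm).
    have /dvdnP[e def_M] := torM _ _ _ zZ zZ' nz_z nz_z' prim_l.
    apply: (divIf nz_z'M); rewrite divff // -expr_div_n def_M mulnC exprM.
    by rewrite (prim_expr_order prim_l) expr1n.
  - by move=> n; rewrite c0 rmorph0.
move=> n le_n; apply: (fmorph_inj iota); rewrite rmorph0 -(g0 (n - size Z)%N).
by rewrite /c' /k addnAC -mulnDr subnK.
Qed.
End Dichotomy.

(** * Orders of roots of unity of bounded degree *)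

(** Each prime power [p^a] in [k] satisfies [p^a <= 2 * totient (p^a) <= 2 N], so it
    occurs among the factors of the factorial. *)
Lemma dvdn_fact_totient k N : (0 < k)%N -> (totient k <= N)%N ->
  (k %| (2 * N)`!)%N.
Proof.
move=> k_gt0 le_kN; apply/dvdn_partP => // p; rewrite mem_primes => /and3P[pr_p _ dv_pk].
have l_gt0 : (0 < logn p k)%N by rewrite logn_gt0 mem_primes pr_p k_gt0.
apply: dvdn_fact; rewrite part_gt0 p_part.
have le_tot : (totient (p ^ logn p k) <= totient k)%N.
  have [m co_pm {2}->] := pfactor_coprime pr_p k_gt0.
  rewrite totient_coprime; last by rewrite coprimeXr // coprime_sym.
  rewrite leq_pmull // totient_gt0; case: m co_pm {le_kN} => //.
  by rewrite /coprime gcdn0 => /eqP p1; rewrite p1 in pr_p.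
apply: leq_trans (leq_mul (leqnn 2) (leq_trans le_tot le_kN)).
rewrite totient_pfactor //; case: (logn p k) l_gt0 => // a _; rewrite expnS /=.
by have := prime_gt1 pr_p; nia.
Qed.

Section Acts.

(** Degrees are bounded without number fields: the rational span of a finite
    family stands for a field, and [acts] for membership in it. *)
Definition qspan (I : finType) (v : I -> algC) (y : algC) :=
  exists q : I -> rat, y = \sum_i ratr (q i) * v i.

Definition acts (I : finType) (v : I -> algC) (x : algC) :=
  forall i, qspan v (x * v i).

Section Span.
Variables (I : finType) (v : I -> algC).

Lemma qspan0 : qspan v 0.
Proof. by exists (fun _ => 0); rewrite big1 // => i _; rewrite rmorph0 mul0r. Qed.

Lemma qspanD y y' : qspan v y -> qspan v y' -> qspan v (y + y').
Proof.
move=> [q ->] [q' ->]; exists (fun i => q i + q' i).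
by rewrite -big_split; apply: eq_bigr => i _; rewrite rmorphD mulrDl.
Qed.

Lemma qspanZ a y : qspan v y -> qspan v (ratr a * y).
Proof.
move=> [q ->]; exists (fun i => a * q i).
by rewrite mulr_sumr; apply: eq_bigr => i _; rewrite rmorphM mulrA.
Qed.

Lemma qspan_sum (J : Type) (s : seq J) (y : J -> algC) :
  (forall j, qspan v (y j)) -> qspan v (\sum_(j <- s) y j).
Proof.
move=> vy; elim: s => [|j s IHs]; first by rewrite big_nil; apply: qspan0.
by rewrite big_cons; apply: qspanD.
Qed.

Lemma qspan_gen i : qspan v (v i).
Proof.
exists (fun j => (j == i)%:R); rewrite (bigD1 i) //= eqxx rmorph1 mul1r.
by rewrite big1 ?addr0 // => j /negPf->; rewrite rmorph0 mul0r.
Qed.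

Lemma acts_qspan x y : acts v x -> qspan v y -> qspan v (x * y).
Proof.
move=> vx [q ->]; rewrite mulr_sumr; apply: qspan_sum => i.
by rewrite mulrCA; apply: qspanZ.
Qed.

Lemma acts_rat a : acts v (ratr a).
Proof. by move=> i; apply/qspanZ/qspan_gen. Qed.

Lemma actsM x y : acts v x -> acts v y -> acts v (x * y).
Proof. by move=> vx vy i; rewrite -mulrA; apply: acts_qspan. Qed.

Lemma actsD x y : acts v x -> acts v y -> acts v (x + y).
Proof. by move=> vx vy i; rewrite mulrDl; apply: qspanD. Qed.

(* The inverse of an algebraic number is a rational polynomial in it. *)
Lemma actsV x : acts v x -> acts v x^-1.
Proof.
move=> vx; have [->|nz_x] := eqVneq x 0; first by rewrite invr0 -(rmorph0 ratr); apply: acts_rat.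
have [p [mon_p dv_p]] := rational_multiple [:: x]; rewrite inE eq_sym nz_x => /(_ isT) nz_p0.
have [r def_p] : exists r, p = r * 'X + (p`_0)%:P.
  have /factor_theorem[r] : root (p - (p`_0)%:P) 0.
    by rewrite rootE hornerD hornerN hornerC horner_coef0 subrr.
  by rewrite polyC0 subr0 => def_r; exists r; rewrite -def_r subrK.
have px0 : (pQtoC p).[x] = 0.
  by apply/rootP; rewrite -dvdp_XsubCl; move: dv_p; rewrite rootpoly_cons /rootpoly big_nil mulr1.
have -> : x^-1 = ratr (- p`_0)^-1 * (pQtoC r).[x].
  move: px0; rewrite def_p rmorphD rmorphM /= map_polyX map_polyC hornerD hornerM hornerX hornerC.
  rewrite -def_p => /eqP; rewrite addr_eq0 => /eqP rx.
  apply: (mulIf nz_x); rewrite -mulrA rx mulVf // invrN rmorphN mulrNN -rmorphM mulVf //.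
  by rewrite rmorph1.
apply: actsM; first exact: acts_rat.
elim/poly_ind: r {def_p} => [|r c IHr].
  by rewrite rmorph0 horner0 -(rmorph0 ratr); apply: acts_rat.
rewrite rmorphD rmorphM /= map_polyX map_polyC hornerD hornerM hornerX hornerC.
by apply: actsD; [apply: actsM | apply: acts_rat].
Qed.

(** A root of unity acting on a family of [N] numbers is an eigenvalue of a
    rational [N x N] matrix, hence has degree at most [N]. *)
Lemma acts_prim_root k x : (exists i, v i != 0) -> acts v x ->
  k.-primitive_root x -> (k %| (2 * #|I|)`!)%N.
Proof.
move=> [i0 nz_v] vx prim_x; apply: dvdn_fact_totient; first exact: prim_order_gt0 prim_x.
have [A defA] : exists A : 'I_#|I| -> 'I_#|I| -> rat, forall i,
    x * v (enum_val i) = \sum_j ratr (A i j) * v (enum_val j).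
  apply: (@fin_all_exists _ _ (fun i (q : 'I_#|I| -> rat) =>
    x * v (enum_val i) = \sum_j ratr (q j) * v (enum_val j))) => i.
  have [q ->] := vx (enum_val i); exists (q \o enum_val).
  by rewrite (reindex _ (onW_bij _ (@enum_val_bij I))).
pose B : 'M[algC]_#|I| := map_mx ratr (\matrix_(i, j) A j i).
have eigB : eigenvalue B x.
  apply/eigenvalueP; exists (\row_i v (enum_val i)).
    apply/rowP => i; rewrite !mxE defA; apply: eq_bigr => j _.
    by rewrite !mxE mulrC.
  apply: contraNneq nz_v => /rowP/(_ (enum_rank i0)); rewrite !mxE enum_rankK.
  by move->.
rewrite eigenvalue_root_char /B -map_char_poly in eigB.
have [p [def_p mon_p] dv_p] := minCpolyP x; rewrite dv_p in eigB.
have nz_chi := monic_neq0 (char_poly_monic (\matrix_(i, j) A j i)).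
have := dvdp_leq nz_chi eigB; rewrite size_char_poly.
rewrite -(size_map_poly (ratr : {rmorphism rat -> algC})) -def_p.
by rewrite (minCpoly_cyclotomic prim_x) size_cyclotomic ltnS.
Qed.

End Span.

(** Adjoining the root [z] multiplies the size of the family by [t]: the powers
    [z^a] with [a < t] suffice, the polynomial reducing [z^t]. *)
Lemma acts_adjoin (I : finType) (v : I -> algC) (p : {poly algC}) z t :
    p \is monic -> size p = t.+1 -> root p z -> (forall i, acts v p`_i) ->
  let v' (ia : I * 'I_t) := v ia.1 * z ^+ ia.2 in
  acts v' z /\ forall x, acts v x -> acts v' x.
Proof.
move=> mon_p sz_p /rootP pz0 vp v'.
have span_v' y (a : 'I_t) : qspan v y -> qspan v' (y * z ^+ a).
  move=> [q ->]; rewrite mulr_suml; apply: qspan_sum => i.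
  by rewrite -mulrA; apply/qspanZ/(qspan_gen v' (i, a)).
split=> [[i a]|x vx [i a]]; last first.
  by rewrite /v' mulrA; apply: span_v'.
rewrite /v' mulrCA -exprS; have [eq_t|lt_at] := eqVneq (a.+1) t; last first.
  have lt_a : (a.+1 < t)%N by rewrite ltn_neqAle lt_at ltn_ord.
  exact: (span_v' (v i) (Ordinal lt_a) (qspan_gen v i)).
have pt : p`_t = 1 by have /monicP := mon_p; rewrite lead_coefE sz_p.
have -> : z ^+ a.+1 = \sum_(l < t) - p`_l * z ^+ l.
  move/eqP: pz0; rewrite horner_coef sz_p big_ord_recr /= pt mul1r addrC addr_eq0 eq_t.
  by move/eqP->; rewrite -sumrN; apply: eq_bigr => l _; rewrite mulNr.
rewrite mulr_sumr; apply: qspan_sum => l; rewrite mulrA; apply: span_v'.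
have -> : v i * - p`_l = ratr (-1) * (p`_l * v i) by rewrite rmorphN rmorph1; ring.
by apply: qspanZ; apply: vp.
Qed.

End Acts.

Lemma acts_mulgen (E : algC -> Prop) (I : finType) (v : I -> algC) x :
  (forall z, E z -> acts v z) -> mulgen E x -> acts v x.
Proof.
move=> Ev; elim=> {x} [x /Ev //||x y _ vx _ vy|x _ vx].
- by rewrite -(rmorph1 ratr); apply: acts_rat.
- exact: actsM.
- exact: actsV.
Qed.

(** Adjoining the elements of [Z] one after the other yields a finite family on
    which the whole group acts, hence a bound on the degrees of its roots of
    unity. *)
Lemma torsion_exponent_exists (E : algC -> Prop) (Z : seq algC) :
  (forall z, E z -> z \in Z) -> exists2 M, (0 < M)%N & torsion_exponent E M.
Proof.
move=> EZ.
have [I [v [nz_v vZ]]] : exists (I : finType) (v : I -> algC),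
    (exists i, v i != 0) /\ forall z, z \in Z -> acts v z.
  elim: Z {EZ} => [|z Z [I [v [[i0 nz_i0] vZ]]]].
    by exists unit, (fun _ => 1); split=> //; exists tt; rewrite oner_eq0.
  have [Q [mon_Q dvQ _]] := rational_multiple [:: z].
  have Qz : root (pQtoC Q) z.
    by rewrite -dvdp_XsubCl; move: dvQ; rewrite rootpoly_cons /rootpoly big_nil mulr1.
  have [t sz_Q] : exists t, size (pQtoC Q) = t.+1.
    by exists (size Q).-1; rewrite size_map_poly prednK // size_poly_gt0 monic_neq0.
  have t_gt0 : (0 < t)%N.
    have nz_Q : pQtoC Q != 0 by rewrite map_poly_eq0 monic_neq0.
    by have := root_size_gt1 nz_Q Qz; rewrite sz_Q.
  have vQ i : acts v (pQtoC Q)`_i by rewrite coef_map; apply: acts_rat.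
  have mon_CQ : pQtoC Q \is monic by rewrite map_monic.
  have [vz' v'] := acts_adjoin mon_CQ sz_Q Qz vQ.
  exists (I * 'I_t)%type, (fun ia : I * 'I_t => v ia.1 * z ^+ ia.2); split.
    by exists (i0, Ordinal t_gt0); rewrite expr0 mulr1.
  by move=> y; rewrite inE => /orP[/eqP->|/vZ/v'].
exists (2 * #|I|)`!; first exact: fact_gt0.
move=> z k Gz prim_z; apply: (@acts_prim_root I v k z) => //.
by apply: (@acts_mulgen E _ _ z _ Gz) => y /EZ/vZ.
Qed.

Section RatioOrder.
Variables (K : fieldExtType rat) (iota : {rmorphism K -> algC}).

Lemma acts_basis (x : K) : acts (fun i : 'I_(\dim {:K}) => iota (vbasis {:K})`_i) (iota x).
Proof.
move=> i; exists (fun j => coordK j (x * (vbasis {:K})`_i)).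
rewrite -rmorphM {1}(coord_vbasis (memvf (x * _))) rmorph_sum.
by apply: eq_bigr => j _; rewrite -mulr_algl rmorphM iota_alg.
Qed.

(** The two roots generate an extension of [K] of degree at most [t * t]. *)
Lemma root_ratio_order (p : {poly K}) (t k : nat) (z z' : algC) :
    p \is monic -> size p = t.+1 ->
    root (map_poly iota p) z -> root (map_poly iota p) z' ->
    k.-primitive_root (z / z') ->
  (k %| (2 * (\dim {:K} * t * t))`!)%N.
Proof.
move=> mon_p sz_p pz pz'.
have mon_ip : map_poly iota p \is monic by rewrite map_monic.
have sz_ip : size (map_poly iota p) = t.+1 by rewrite size_map_poly.
pose v i := iota (vbasis {:K})`_i : algC.
have vp i : acts (fun i : 'I_(\dim {:K}) => v i) (map_poly iota p)`_i.
  by rewrite coef_map; apply: acts_basis.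
have [vz vv1] := acts_adjoin mon_ip sz_ip pz vp.
have [vz' vv2] := acts_adjoin mon_ip sz_ip pz' (fun i => vv1 _ (vp i)).
have t_gt0 : (0 < t)%N.
  by have := root_size_gt1 (monic_neq0 mon_ip) pz; rewrite sz_ip.
move/(acts_prim_root _ (actsM (vv2 _ vz) (actsV vz'))).
rewrite !card_prod !card_ord; apply.
have [i nz_i] : exists i : 'I_(\dim {:K}), (vbasis {:K})`_i != 0.
  apply: NNPP => no_i; have /eqP[] := oner_neq0 K.
  rewrite (coord_vbasis (memvf 1)) big1 // => i _.
  case: (eqVneq (vbasis {:K})`_i 0) => [->|nz_i]; first by rewrite scaler0.
  by case: no_i; exists i.
exists ((i, Ordinal t_gt0), Ordinal t_gt0).
by rewrite !expr0 !mulr1 fmorph_eq0.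
Qed.

End RatioOrder.

(** * Cramer's rule over sequences *)

(** With a nonzero minor [B] of maximal size, membership in the row space of [A]
    is expressed without divisions: [cramer_row] gives the coefficients of a
    combination of rows, up to the factor [\det B], and the vectors
    [cramer_col] lie in the kernel of [A] and span it, so they detect the rows
    outside.  All entries are polynomials in those of the given matrices, which is
    what makes C-finite certificates out of them. *)
Section Cramer.
Variables (F : fieldType) (N V r : nat) (A : 'M[F]_(N, V)).
Variables (f : 'I_r -> 'I_N) (g : 'I_r -> 'I_V).
Let B := mxsub f g A.
Hypotheses (nz_B : \det B != 0) (rkA : \rank A = r).

Lemma minor_factor : rowsub f A *m colsub g 1%:M = B.
Proof. by rewrite -mxsub_mul mulmx1. Qed.

Lemma sub_minor_rows : (A <= rowsub f A)%MS.
Proof.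
have uB : B \in unitmx by rewrite unitmxE unitfE.
rewrite -(geq_leqif (mxrank_leqif_sup (rowsub_sub f A))) rkA.
rewrite -[X in (X <= _)%N](mxrank_unit uB).
by rewrite -minor_factor mxrankM_maxl.
Qed.

Definition cramer_row (t : 'rV[F]_V) : 'rV[F]_r := colsub g t *m \adj B.

Lemma cramer_rowE t : (t <= A)%MS ->
  \det B *: t = cramer_row t *m rowsub f A.
Proof.
move=> /submx_trans/(_ sub_minor_rows)/submxP[y ->].
have -> : cramer_row (y *m rowsub f A) = \det B *: y.
  rewrite /cramer_row -mul_scalar_mx -scalar_mxC -mul_mx_adj mulmxA.
  by congr (_ *m _); apply/matrixP => i l; rewrite !mxE; apply: eq_bigr => k _; rewrite !mxE.
by rewrite scalemxAl.
Qed.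

Definition cramer_col (h : 'I_V) : 'cV[F]_V :=
  \det B *: delta_mx h 0 - colsub g 1%:M *m (\adj B *m col h (rowsub f A)).

Lemma cramer_colE h : A *m cramer_col h = 0.
Proof.
have /submxP[Y ->] := sub_minor_rows; rewrite -mulmxA.
suff -> : rowsub f A *m cramer_col h = 0 by rewrite mulmx0.
rewrite /cramer_col mulmxBr -scalemxAr -colE !mulmxA minor_factor mul_mx_adj.
by rewrite mul_scalar_mx subrr.
Qed.

Lemma cramer_residual (t : 'rV[F]_V) h :
  t *m cramer_col h = (\det B *: t - cramer_row t *m rowsub f A) *m delta_mx h 0.
Proof.
rewrite mulmxBl /cramer_col mulmxBr -scalemxAr -scalemxAl; congr (_ - _).
rewrite colE !mulmxA /cramer_row; do 3 congr (_ *m _).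
by rewrite mulmx_colsub mulmx1.
Qed.

Lemma cramer_col_detect (t : 'rV[F]_V) : (forall h, t *m cramer_col h = 0) -> (t <= A)%MS.
Proof.
move=> t0; have eq_t : \det B *: t = cramer_row t *m rowsub f A.
  apply/eqP; rewrite -subr_eq0; apply/eqP/rowP => h.
  have := t0 h; rewrite cramer_residual -colE => /colP/(_ 0); rewrite mxE => ->.
  by rewrite !mxE.
rewrite -(eqmx_scale t nz_B) eq_t.
exact: submx_trans (submxMl _ _) (rowsub_sub f A).
Qed.

End Cramer.

Lemma exists_minor (F : fieldType) (N V : nat) (A : 'M[F]_(N, V)) :
  exists (f : 'I_(\rank A) -> 'I_N) (g : 'I_(\rank A) -> 'I_V),
    \det (mxsub f g A) != 0.
Proof.
have full : row_full (rowsub (maxrankfun A) A)^T.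
  by rewrite /row_full mxrank_tr; have := maxrowsub_free A.
exists (maxrankfun A), (fullrankfun full).
have := fullrowsub_unit full; rewrite unitmxE unitfE -det_tr.
by congr (\det _ != 0); apply/matrixP => i j; rewrite !mxE.
Qed.

Lemma minor_rank (F : fieldType) (N V r : nat) (A : 'M[F]_(N, V))
    (f : 'I_r -> 'I_N) (g : 'I_r -> 'I_V) :
  \det (mxsub f g A) != 0 -> (r <= \rank A)%N.
Proof.
rewrite -unitfE -unitmxE => /mxrank_unit {1}<-.
rewrite -[mxsub f g A](minor_factor A f g) (leq_trans (mxrankM_maxl _ _)) //.
by rewrite mxrankS // rowsub_sub.
Qed.

(** * Generic rank along arithmetic progressions *)

Definition eventually (P : nat -> Prop) := exists N, forall n, (N <= n)%N -> P n.

Lemma eventuallyW (P Q : nat -> Prop) : (forall n, P n -> Q n) -> eventually P -> eventually Q.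
Proof. by move=> PQ [N PN]; exists N => n /PN/PQ. Qed.

Lemma eventually_and (P Q : nat -> Prop) :
  eventually P -> eventually Q -> eventually (fun n => P n /\ Q n).
Proof.
move=> [N PN] [M QM]; exists (maxn N M) => n; rewrite geq_max => /andP[le1 le2].
by split; [apply: PN | apply: QM].
Qed.

Lemma eventually_fin (I : finType) (P : I -> nat -> Prop) :
  (forall i, eventually (P i)) -> eventually (fun n => forall i, P i n).
Proof.
move=> /fin_all_exists[N PN]; exists (\max_i N i)%N => n le_n i.
by apply: PN; apply: leq_trans le_n; apply: leq_bigmax.
Qed.

Lemma not_eventually (P : nat -> Prop) : ~ eventually P -> infinitely (fun n => ~ P n).
Proof.
move=> nevP N; apply: NNPP => no_n; apply: nevP; exists N => n le_n.
by apply: NNPP => nPn; apply: no_n; exists n.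
Qed.

Lemma infinitely_and (P Q : nat -> Prop) :
  infinitely P -> eventually Q -> infinitely (fun n => P n /\ Q n).
Proof.
move=> infP [N QN] M; have [n] := infP (maxn N M); rewrite geq_max => /andP[le1 le2] Pn.
by exists n => //; split=> //; apply: QN.
Qed.

Lemma bounded_choice (X : Type) (P : nat -> X -> Prop) d : (0 < d)%N ->
  (forall j, (j < d)%N -> exists x, P j x) ->
  exists Y, forall j, (j < d)%N -> P j (Y j).
Proof.
case: d => // d _ exP.
have /fin_all_exists[Y PY] : forall j : 'I_d.+1, exists x, P j x by move=> j; apply: exP.
exists (fun j => Y (inord j)) => j lt_jd.
by have := PY (inord j); rewrite inordK.
Qed.

Lemma eventually_classes (P : nat -> nat -> Prop) d : (0 < d)%N ->
  (forall j, (j < d)%N -> eventually (fun n => (n %% d)%N = j -> P j n)) ->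
  eventually (fun n => P (n %% d)%N n).
Proof.
move=> d_gt0 evP.
have : eventually (fun n => forall j : 'I_d, (n %% d)%N = j -> P j n).
  by apply: eventually_fin => j; apply: evP.
apply: eventuallyW => n Pn; exact: (Pn (Ordinal (ltn_pmod n d_gt0)) erefl).
Qed.

Record sequence_ring (K : fieldType) (S : (nat -> K) -> Prop) : Prop := SequenceRing {
  ring_ext : forall f g, f =1 g -> S f -> S g;
  ring_const : forall a, S (fun _ => a);
  ring_add : forall f g, S f -> S g -> S (fun n => f n + g n);
  ring_mul : forall f g, S f -> S g -> S (fun n => f n * g n);
  ring_shift : forall f, S f -> S (fun n => f n.+1)
}.

(** The conclusion of the theorem of Skolem, Mahler and Lech for all members of
    [S], with a common modulus [d]. *)
Definition class_dichotomy_in (K : fieldType) d (S : (nat -> K) -> Prop) := forall f j, S f ->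
  eventually (fun n => (n %% d)%N = j -> f n = 0) \/
  eventually (fun n => (n %% d)%N = j -> f n != 0).

(** [S] stands for the sequences whose roots are in the group of the eigenvalues and
    [C] for the C-finite sequences.  The certificates are interlaced from sequences
    in [S], one for each class; interlacing leaves [S], as it may introduce new
    roots. *)
Section SequenceRing.
Variables (K : fieldType) (S C : (nat -> K) -> Prop) (d : nat).
Hypothesis d_gt0 : (0 < d)%N.
Hypothesis ringS : sequence_ring S.
Let S_ext := ring_ext ringS.
Let S_const := ring_const ringS.
Let S_add := ring_add ringS.
Let S_mul := ring_mul ringS.
Hypothesis S_class : class_dichotomy_in d S.
Hypothesis C_glue : forall n0 (y : nat -> nat -> K), (forall j, (j < d)%N -> S (y j)) ->
  C (fun n => if (n0 <= n)%N then y (n %% d)%N n else 0).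

Lemma S_opp f : S f -> S (fun n => - f n).
Proof. by move=> Sf; apply: S_ext (S_mul (S_const (-1)) Sf) => n; rewrite mulN1r. Qed.

Lemma S_sum (I : Type) (s : seq I) (P : pred I) (f : I -> nat -> K) :
  (forall i, P i -> S (f i)) -> S (fun n => \sum_(i <- s | P i) f i n).
Proof.
move=> Sf; elim: s => [|i s IHs].
  by apply: S_ext (S_const 0) => n; rewrite big_nil.
case Pi: (P i); last by apply: S_ext IHs => n; rewrite big_cons Pi.
by apply: S_ext (S_add (Sf i Pi) IHs) => n; rewrite big_cons Pi.
Qed.

Lemma S_prod (I : Type) (s : seq I) (f : I -> nat -> K) :
  (forall i, S (f i)) -> S (fun n => \prod_(i <- s) f i n).
Proof.
move=> Sf; elim: s => [|i s IHs].
  by apply: S_ext (S_const 1) => n; rewrite big_nil.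
by apply: S_ext (S_mul (Sf i) IHs) => n; rewrite big_cons.
Qed.

Definition Smx N V (T : nat -> 'M[K]_(N, V)) := forall i j, S (fun n => T n i j).

Lemma S_det r (T : nat -> 'M[K]_r) : Smx T -> S (fun n => \det (T n)).
Proof.
by move=> ST; apply: S_sum => s _; apply: S_mul; [apply: S_const | apply: S_prod].
Qed.

Lemma Smx_mul N V W (T : nat -> 'M[K]_(N, V)) (U : nat -> 'M[K]_(V, W)) :
  Smx T -> Smx U -> Smx (fun n => T n *m U n).
Proof.
move=> ST SU i j; apply: S_ext (_ : S (fun n => \sum_k T n i k * U n k j)).
  by move=> n; rewrite mxE.
by apply: S_sum => k _; apply: S_mul.
Qed.

Lemma Smx_sub N V N' V' (f : 'I_N' -> 'I_N) (g : 'I_V' -> 'I_V) (T : nat -> 'M[K]_(N, V)) :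
  Smx T -> Smx (fun n => mxsub f g (T n)).
Proof. by move=> ST i j; apply: S_ext (ST (f i) (g j)) => n; rewrite mxE. Qed.

Lemma Smx_adj r (T : nat -> 'M[K]_r) : Smx T -> Smx (fun n => \adj (T n)).
Proof.
move=> ST i j; apply: S_ext (_ : S (fun n => (-1) ^+ (j + i) * \det (row' j (col' i (T n))))).
  by move=> n; rewrite mxE.
apply: S_mul; first exact: S_const.
by apply: S_det => a b; apply: S_ext (ST (lift j a) (lift i b)) => n; rewrite !mxE.
Qed.

(** Take the largest [r] for which some minor of size [r] is eventually nonzero on
    the class.  By the dichotomy all larger minors are eventually zero there, so
    that [r] is eventually the rank. *)
Lemma generic_minor N V (T : nat -> 'M[K]_(N, V)) j : (j < d)%N -> Smx T ->
  exists r (f : 'I_r -> 'I_N) (g : 'I_r -> 'I_V),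
    eventually (fun n => (n %% d)%N = j -> \det (mxsub f g (T n)) != 0 /\ \rank (T n) = r).
Proof.
move=> lt_jd ST.
pose P r := exists (f : 'I_r -> 'I_N) (g : 'I_r -> 'I_V),
  eventually (fun n => (n %% d)%N = j -> \det (mxsub f g (T n)) != 0).
have P0 : P 0%N.
  exists (fun i : 'I_0 => match notF (valP i) with end).
  exists (fun i : 'I_0 => match notF (valP i) with end).
  by exists 0%N => n _ _; rewrite det_mx00 oner_eq0.
have PN r : P r -> (r <= N)%N.
  move=> [f [g [n0 nz]]]; have := nz (n0 * d + j)%N.
  rewrite modnMDl modn_small // (leq_trans (leq_pmulr _ d_gt0)) ?leq_addr //.
  by move=> /(_ isT erefl)/minor_rank/leq_trans; apply; apply: rank_leq_row.
have [r Pr max_r] : exists2 r, P r & forall r', (r < r')%N -> ~ P r'.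
  have : forall k r, (N - r <= k)%N -> P r ->
      exists2 r, P r & forall r', (r < r')%N -> ~ P r'.
    elim=> [|k IHk] r le_k Pr.
      by exists r => // r' lt_r /PN; lia.
    case: (classic (exists2 r', (r < r')%N & P r')) => [[r' lt_r Pr']|no].
      by apply: (IHk r') => //; have := PN _ Pr'; lia.
    by exists r => // r' lt_r Pr'; apply: no; exists r'.
  by move/(_ _ 0%N (leqnn _) P0).
have [f [g nz]] := Pr; exists r, f, g.
have small : eventually (fun n => forall r' : 'I_N.+1, (n %% d)%N = j -> (r < r')%N ->
    forall (f' : {ffun 'I_r' -> 'I_N}) (g' : {ffun 'I_r' -> 'I_V}),
    \det (mxsub f' g' (T n)) = 0).
  apply: eventually_fin => r'.
  apply: eventuallyW (_ : eventually (fun n =>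
      forall fg : {ffun 'I_r' -> 'I_N} * {ffun 'I_r' -> 'I_V},
      (n %% d)%N = j -> (r < r')%N -> \det (mxsub fg.1 fg.2 (T n)) = 0)).
    by move=> n h nj lt_r f' g'; apply: (h (f', g')).
  apply: eventually_fin => -[f' g'] /=.
  have := S_class (f := fun n => \det (mxsub f' g' (T n))) j (S_det (Smx_sub f' g' ST)).
  case=> [ev0|evN0]; first by apply: eventuallyW ev0 => n h nj _; apply: h.
  exists 0%N => n _ _ lt_r; case: (max_r r' lt_r); exists f', g'.
  exact: evN0.
apply: eventuallyW (eventually_and nz small) => n [nzn smalln] nj.
split; first exact: nzn.
apply/eqP; rewrite eqn_leq (minor_rank (nzn nj)) andbT leqNgt; apply/negP => lt_r.
have [f' [g' /eqP[]]] := exists_minor (T n).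
have lt_rk : (\rank (T n) < N.+1)%N by rewrite ltnS rank_leq_row.
have /= := smalln (Ordinal lt_rk) nj lt_r (finfun f') (finfun g').
by move=> <-; congr (\det _); apply/matrixP => a b; rewrite !mxE !ffunE.
Qed.

(** Erasing instead of deleting row [D] preserves the indices and the shape. *)
Definition erase_row N V (D : 'I_N) (A : 'M[K]_(N, V)) : 'M[K]_(N, V) :=
  \matrix_(i, h) if i == D then 0 else A i h.

Lemma Smx_erase N V (D : 'I_N) (T : nat -> 'M[K]_(N, V)) :
  Smx T -> Smx (fun n => erase_row D (T n)).
Proof.
move=> ST i h; have [eq_iD|ne_iD] := eqVneq i D.
  by apply: S_ext (S_const 0) => n; rewrite mxE eq_iD eqxx.
by apply: S_ext (ST i h) => n; rewrite mxE (negPf ne_iD).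
Qed.

Lemma Smx_row N V (D : 'I_N) (T : nat -> 'M[K]_(N, V)) :
  Smx T -> Smx (fun n => row D (T n)).
Proof. by move=> ST i h; apply: S_ext (ST D h) => n; rewrite mxE. Qed.

Lemma Smx_cramer_row N V r (f : 'I_r -> 'I_N) (g : 'I_r -> 'I_V)
    (T : nat -> 'M[K]_(N, V)) (t : nat -> 'rV[K]_V) :
  Smx T -> Smx t -> Smx (fun n => cramer_row (T n) f g (t n)).
Proof.
move=> ST St; apply: Smx_mul; first exact: Smx_sub.
by apply: Smx_adj; apply: Smx_sub.
Qed.

(** Cramer's rule on every residue class gives multipliers in [S]; interlacing
    them, and starting late enough, gives multipliers in [C] valid for all [n].
    The multiplier of row [D] is the minor itself, so it does not vanish. *)
Lemma dependence_certificate N V (T : nat -> 'M[K]_(N, V)) (D : 'I_N) :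
    Smx T -> eventually (fun n => (row D (T n) <= erase_row D (T n))%MS) ->
  exists y : 'I_N -> nat -> K,
    [/\ forall i, C (y i), forall n h, \sum_i y i n * T n i h = 0
      & eventually (fun n => y D n != 0)].
Proof.
move=> ST evD.
have class_cert j : (j < d)%N -> exists y : 'I_N -> nat -> K, (forall i, S (y i)) /\
    eventually (fun n => (n %% d)%N = j ->
      (forall h, \sum_i y i n * T n i h = 0) /\ y D n != 0).
  move=> lt_jd.
  have [r [f [g gen]]] := generic_minor lt_jd (Smx_erase D ST).
  pose x n := cramer_row (erase_row D (T n)) f g (row D (T n)).
  pose y i n := if i == D then \det (mxsub f g (erase_row D (T n)))
                else - \sum_(k | f k == i) x n 0 k.
  have Sx : Smx x by apply: Smx_cramer_row; [apply: Smx_erase | apply: Smx_row].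
  exists y; split=> [i|].
    rewrite /y; case: eqP => _.
      by apply/S_det/Smx_sub/Smx_erase.
    by apply/S_opp/S_sum => k _; apply: Sx.
  apply: eventuallyW (eventually_and gen evD) => n [gen_n Dn] nj.
  have [nz_det rk_T] := gen_n nj.
  split=> [h|]; last by rewrite /y eqxx.
  have := cramer_rowE nz_det rk_T Dn => /rowP/(_ h); rewrite -/(x n) !mxE => eqh.
  rewrite (bigD1 D) //= {1}/y eqxx eqh.
  under [X in _ + X]eq_bigr => i ne_iD do rewrite /y (negPf ne_iD) mulNr mulr_suml.
  rewrite sumrN; apply/eqP; rewrite subr_eq0; apply/eqP.
  rewrite (partition_big f xpredT) //= (bigD1 D) //= big1 ?add0r => [|k /eqP fk]; last first.
    by rewrite !mxE fk eqxx mulr0.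
  apply: eq_bigr => i ne_iD; apply: eq_bigr => k /eqP fk.
  by rewrite !mxE fk (negPf ne_iD).
have [Y YP] := bounded_choice d_gt0 class_cert.
have [n0 n0P] : eventually (fun n => (forall h, \sum_i Y (n %% d)%N i n * T n i h = 0) /\
    Y (n %% d)%N D n != 0).
  apply: (@eventually_classes (fun j n => (forall h, \sum_i Y j i n * T n i h = 0) /\
    Y j D n != 0)) => // j lt_jd; by case: (YP j lt_jd).
exists (fun i n => if (n0 <= n)%N then Y (n %% d)%N i n else 0); split.
- by move=> i; apply: (@C_glue n0 (fun j => Y j i)) => j lt_jd; case: (YP j lt_jd).
- move=> n h; case: leqP => [/n0P[]//|_].
  by apply: big1 => i _; rewrite mul0r.
- by exists n0 => n le_n; rewrite le_n; case: (n0P n le_n).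
Qed.

(** Dually, when row [D] is infinitely often independent, it is so infinitely often
    in one class, where one of the finitely many kernel vectors of Cramer's rule
    must detect this infinitely often.  That vector, put to zero on the other
    classes, refutes every combination. *)
Lemma independence_certificate N V (T : nat -> 'M[K]_(N, V)) (D : 'I_N) :
    Smx T -> ~ eventually (fun n => (row D (T n) <= erase_row D (T n))%MS) ->
  exists v : 'I_V -> nat -> K,
    [/\ forall h, C (v h),
        forall n i, i != D -> \sum_h T n i h * v h n = 0
      & infinitely (fun n => \sum_h T n D h * v h n != 0)].
Proof.
move=> ST /not_eventually/(infinitely_class d_gt0)[j lt_jd infD].
have [r [f [g gen]]] := generic_minor lt_jd (Smx_erase D ST).
pose w h n := cramer_col (erase_row D (T n)) f g h.
have Sw h : Smx (w h).
  move=> i l; apply: S_ext (_ : S (fun n =>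
      \det (mxsub f g (erase_row D (T n))) * delta_mx h 0 i l +
      - (colsub g 1%:M *m (\adj (mxsub f g (erase_row D (T n))) *m
          col h (rowsub f (erase_row D (T n))))) i l)).
    by move=> n; rewrite /w /cramer_col !mxE.
  apply: S_add; first by apply: S_mul => //; apply/S_det/Smx_sub/Smx_erase.
  apply: S_opp; apply: (Smx_mul (T := fun _ => _)) => [a b|]; first exact: S_const.
  apply: Smx_mul; first by apply/Smx_adj/Smx_sub/Smx_erase.
  by move=> a b; apply: S_ext (Smx_sub f id (Smx_erase D ST) a h) => n; rewrite !mxE.
have [n0 genn] := gen.
have [h infh] : exists h : 'I_V, infinitely (fun n =>
    (n %% d)%N = j /\ row D (T n) *m w h n != 0).
  apply: NNPP => no_h.
  have : eventually (fun n => forall h : 'I_V, (n %% d)%N = j -> row D (T n) *m w h n = 0).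
    apply: eventually_fin => h; apply: NNPP => /not_eventually infh; apply: no_h.
    exists h => M; have [n le_n nP] := infh M; exists n => //.
    by apply: NNPP => no; apply: nP => nj; apply: NNPP => /eqP nz; apply: no.
  move=> [n1 zero]; have [n le_n] := infD (n0 + n1)%N; apply.
  have nj : ((d * n + j) %% d)%N = j by rewrite mulnC modnMDl modn_small.
  have le_dn : (n0 + n1 <= d * n + j)%N.
    by apply: leq_trans (leq_trans le_n _) (leq_addr _ _); rewrite leq_pmull.
  have [nz_det rk_T] := genn _ (leq_trans (leq_addr _ _) le_dn) nj.
  apply: (cramer_col_detect nz_det) => h.
  exact: zero (leq_trans (leq_addl _ _) le_dn) h nj.
pose Y j' h' n := if j' == j then w h n h' 0 else 0.
exists (fun h' n => if (n0 <= n)%N then Y (n %% d)%N h' n else 0); split.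
- move=> h'; apply: (@C_glue n0 (fun j' => Y j' h')) => j' _; rewrite /Y.
  by case: eqP => _; [apply: Sw | apply: S_const].
- move=> n i ne_iD; case: leqP => [le_n|_]; last by apply: big1 => ? _; rewrite mulr0.
  rewrite /Y; case: eqP => [nj|_]; last by apply: big1 => ? _; rewrite mulr0.
  have [nz_det rk_T] := genn n le_n nj.
  transitivity ((erase_row D (T n) *m w h n) i 0); last by rewrite cramer_colE // mxE.
  by rewrite mxE; apply: eq_bigr => l _; rewrite [erase_row _ _ _ _]mxE (negPf ne_iD).
- have ev0 : eventually (fun n => n0 <= n)%N by exists n0.
  move=> M; have [n le_n [[nj nz] n0n]] := infinitely_and infh ev0 M; exists n => //.
  rewrite n0n /Y nj eqxx; apply: contraNneq nz => z; apply/eqP/matrixP => a b.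
  rewrite !ord1 mxE [RHS]mxE -[RHS]z; apply: eq_bigr => l _.
  by rewrite mxE.
Qed.

(** This is where the order [d * R] comes from.  Along a class modulo [d] the ranks
    of the first [k] of the rows [w_0, w_d, w_2d, ...] are eventually constant;
    they are at most [R], so some row [w_(dk)] with [k <= R] eventually depends on
    its predecessors.  Used at [n + d (R - k)], which is in the same class as [n],
    and multiplied by the cocycle, this dependence becomes one of [w_(dR)] at
    [n]. *)
Lemma cocycle_dependence R (w : nat -> nat -> 'rV[K]_R) :
    (forall i, Smx (w i)) ->
    (forall n e, exists A : 'M_R, forall i, w (i + e)%N n = w i (n + e)%N *m A) ->
  eventually (fun n => forall u : 'cV_R,
    (forall i, (i < d * R)%N -> w i n *m u = 0) -> w (d * R)%N n *m u = 0).
Proof.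
move=> Sw cocycle.
pose T k n : 'M[K]_(k, R) := \matrix_(l < k, h < R) w (d * l)%N n 0 h.
have ST k : Smx (T k).
  by move=> l h; apply: S_ext (Sw (d * l)%N 0 h) => n; rewrite mxE.
have rowT k n (l : 'I_k) : row l (T k n) = w (d * l)%N n.
  by apply/rowP => h; rewrite !mxE.
have subT k n : (T k n <= T k.+1 n)%MS.
  apply/row_subP => l; rewrite rowT.
  by have := row_sub (widen_ord (leqnSn k) l) (T k.+1 n); rewrite rowT.
suff cls j : (j < d)%N -> eventually (fun n => (n %% d)%N = j -> forall u : 'cV_R,
    (forall i, (i < d * R)%N -> w i n *m u = 0) -> w (d * R)%N n *m u = 0).
  exact: (@eventually_classes (fun _ n => forall u : 'cV_R,
    (forall i, (i < d * R)%N -> w i n *m u = 0) -> w (d * R)%N n *m u = 0)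
    d d_gt0 cls).
move=> lt_jd.
have /fin_all_exists[rho rhoP] : forall k : 'I_R.+2, exists r,
    eventually (fun n => (n %% d)%N = j -> \rank (T k n) = r).
  move=> k; have [r [f [g ev]]] := generic_minor lt_jd (ST k); exists r.
  by apply: eventuallyW ev => n rk /rk[].
have [n0 rk] := eventually_fin rhoP.
have [k le_kR eq_rk] : exists2 k, (k <= R)%N &
    forall n, (n0 <= n)%N -> (n %% d)%N = j -> \rank (T k.+1 n) = \rank (T k n).
  apply: NNPP => no_k.
  (* Otherwise the ranks at [n1] would increase strictly [R.+1] times. *)
  pose n1 := (n0 * d + j)%N.
  have n1j : (n1 %% d)%N = j by rewrite modnMDl modn_small.
  have le_n1 : (n0 <= n1)%N by rewrite (leq_trans (leq_pmulr n0 d_gt0)) ?leq_addr.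
  have ge_k k : (k <= R.+1)%N -> (k <= \rank (T k n1))%N.
    elim: k => [|k IHk] // lt_kR; apply: leq_ltn_trans (IHk (ltnW lt_kR)) _.
    rewrite ltn_neqAle mxrankS // andbT; apply/eqP => eq_rk; apply: no_k.
    exists k => // n le_n nj.
    have e1 := rk n le_n (Ordinal (lt_kR : (k.+1 < R.+2)%N)) nj.
    have e0 := rk n le_n (Ordinal (ltnW lt_kR : (k < R.+2)%N)) nj.
    have f1 := rk n1 le_n1 (Ordinal (lt_kR : (k.+1 < R.+2)%N)) n1j.
    have f0 := rk n1 le_n1 (Ordinal (ltnW lt_kR : (k < R.+2)%N)) n1j.
    by rewrite /= in e1 e0 f1 f0; rewrite e1 e0 -f1 -f0.
  by have := leq_trans (ge_k R.+1 (leqnn _)) (rank_leq_col _); rewrite ltnn.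
exists n0 => n le_n nj u wu0.
pose e := (d * (R - k))%N.
have [A wA] := cocycle n e.
have ne_j : ((n + e) %% d)%N = j by rewrite /e mulnC addnC modnMDl.
have le_ne : (n0 <= n + e)%N by rewrite (leq_trans le_n) ?leq_addr.
have dep : (w (d * k)%N (n + e)%N <= T k (n + e)%N)%MS.
  have := row_sub ord_max (T k.+1 (n + e)%N); rewrite rowT => /submx_trans; apply.
  by rewrite -(geq_leqif (mxrank_leqif_sup (subT _ _))) eq_rk.
have defD : (d * R = d * k + e)%N by rewrite -mulnDr subnKC.
rewrite defD wA -mulmxA.
have [y ->] := submxP dep; rewrite -mulmxA.
suff -> : T k (n + e)%N *m (A *m u) = 0 by rewrite mulmx0.
apply/row_matrixP => l; rewrite row_mul rowT row0 mulmxA -wA wu0 //.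
by rewrite defD ltn_add2r ltn_pmul2l.
Qed.

End SequenceRing.

(** * C-finite sequences over a number field *)

Section CfiniteRing.
Variables (K : fieldExtType rat) (iota : {rmorphism K -> algC}).
Implicit Types (c f g : nat -> K) (G : algC -> Prop).

(** Zero roots are exempt: they are not eigenvalues and only change finitely many
    terms. *)
Definition roots_in G c :=
  exists Z, kill Z (fun n => iota (c n)) /\ forall z, z \in Z -> z != 0 -> G z.

Lemma roots_in_ext G f g : f =1 g -> roots_in G f -> roots_in G g.
Proof.
by move=> eqfg [Z [kf GZ]]; exists Z; split=> //; apply: eq_kill kf => n; rewrite eqfg.
Qed.

Lemma roots_inW G G' f : (forall z, G z -> G' z) -> roots_in G f -> roots_in G' f.
Proof. by move=> GG' [Z [kf GZ]]; exists Z; split=> // z zZ /(GZ _ zZ)/GG'. Qed.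

Lemma roots_in_add G f g : roots_in G f -> roots_in G g ->
  roots_in G (fun n => f n + g n).
Proof.
move=> [Z [kf GZ]] [W [kg GW]]; exists (Z ++ W); split.
  by apply: eq_kill (killD kf kg) => n; rewrite rmorphD.
by move=> z; rewrite mem_cat => /orP[/GZ|/GW].
Qed.

Lemma roots_in_const G a : G 1 -> roots_in G (fun _ => a).
Proof.
move=> G1; exists [:: 1]; split; last by move=> z; rewrite inE => /eqP->.
by apply: (kill_cons _ _ _).2; apply: (kill_nil _).2 => n; rewrite mul1r subrr.
Qed.

Lemma roots_in_mul G f g : (forall z w, G z -> G w -> G (z * w)) ->
  roots_in G f -> roots_in G g -> roots_in G (fun n => f n * g n).
Proof.
move=> GM [Z [kf GZ]] [W [kg GW]].
have PZW z w : z \in Z -> w \in W -> z * w != 0 -> G (z * w).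
  by move=> zZ wW; rewrite mulf_eq0 negb_or => /andP[/(GZ _ zZ) ? /(GW _ wW) ?]; apply: GM.
have [U [kU _ GU]] := @killM _ (fun u => u != 0 -> G u) _ _ _ _ PZW kf kg; exists U; split=> //.
by apply: eq_kill kU => n; rewrite rmorphM.
Qed.

Lemma roots_in_shift G f k : roots_in G f -> roots_in G (fun n => f (n + k)%N).
Proof. by move=> [Z [kf GZ]]; exists Z; split=> //; exact: (kill_shift k kf). Qed.

Lemma satisfies_rec_act (p : {poly K}) c :
  satisfies_rec p c -> act (map_poly iota p) (fun n => iota (c n)) =1 (fun _ => 0).
Proof. by move=> pc n; rewrite act_map -[RHS](rmorph0 iota); congr (iota _); apply: pc. Qed.

Lemma rootpoly_of (p : {poly K}) : p \is monic ->
  exists2 Z : seq algC, map_poly iota p = rootpoly Z & size Z = (size p).-1.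
Proof.
move=> mon_p; have [Z defp] := closed_field_poly_normal (map_poly iota p).
have mon_ip : map_poly iota p \is monic by rewrite map_monic.
exists Z; first by rewrite defp (monicP mon_ip) scale1r.
by rewrite -(size_map_poly iota) defp (monicP mon_ip) scale1r size_prod_XsubC.
Qed.

Lemma monic_rec (p : {poly K}) c : p != 0 -> satisfies_rec p c ->
  exists q, [/\ q \is monic, size q = size p & satisfies_rec q c].
Proof.
move=> nz_p pc; have nz_lc : lead_coef p != 0 by rewrite lead_coef_eq0.
exists ((lead_coef p)^-1 *: p); split.
- by rewrite monicE lead_coefZ mulVf.
- by rewrite size_scale ?invr_eq0.
- move=> n; have := actZl (lead_coef p)^-1 p c n; rewrite /act => ->.
  by rewrite pc mulr0.
Qed.

Lemma rec_roots_in (p : {poly K}) c : p \is monic -> satisfies_rec p c ->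
  roots_in (fun z => root (map_poly iota p) z) c.
Proof.
move=> mon_p pc; have [Z defZ _] := rootpoly_of mon_p; exists Z; split.
  by move=> n; rewrite -defZ satisfies_rec_act.
by move=> z zZ _; rewrite defZ root_prod_XsubC.
Qed.

(** Closure properties are obtained over [algC], where characteristic polynomials
    split; a rational multiple of the polynomial brings the recurrence back
    to [K]. *)
Lemma Cfinite_monic c : roots_in (fun _ => True) c ->
  exists p : {poly K}, p \is monic /\ satisfies_rec p c.
Proof.
move=> [Z [kc _]]; have [Q [mon_Q dvQ _]] := rational_multiple Z.
exists (map_poly (in_alg K) Q); split; first by rewrite map_monic.
exact: (kill_rational dvQ kc).
Qed.

Lemma Cfinite_roots_in c : Cfinite c <-> roots_in (fun _ => True) c.
Proof.
split=> [[p [nz_p pc]]|/Cfinite_monic[p [mon_p pc]]]; last first.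
  by exists p; rewrite monic_neq0.
have [q [mon_q _ qc]] := monic_rec nz_p pc.
exact: roots_inW (rec_roots_in mon_q qc).
Qed.

Lemma Cfinite_add f g : Cfinite f -> Cfinite g -> Cfinite (fun n => f n + g n).
Proof.
move=> /Cfinite_roots_in Cf /Cfinite_roots_in Cg; apply/Cfinite_roots_in.
exact: roots_in_add.
Qed.

Lemma Cfinite_mul f g : Cfinite f -> Cfinite g -> Cfinite (fun n => f n * g n).
Proof.
move=> /Cfinite_roots_in Cf /Cfinite_roots_in Cg; apply/Cfinite_roots_in.
exact: roots_in_mul.
Qed.

Lemma Cfinite_ext f g : f =1 g -> Cfinite f -> Cfinite g.
Proof. by move=> eqfg /Cfinite_roots_in/(roots_in_ext eqfg)/Cfinite_roots_in. Qed.

Lemma Cfinite_zero : Cfinite (fun _ => 0 : K).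
Proof. by apply/Cfinite_roots_in/roots_in_const. Qed.

Lemma Cfinite_sum (I : Type) (s : seq I) (f : I -> nat -> K) :
  (forall i, Cfinite (f i)) -> Cfinite (fun n => \sum_(i <- s) f i n).
Proof.
move=> Cf; elim: s => [|i s IHs].
  by apply: Cfinite_ext Cfinite_zero => n; rewrite big_nil.
by apply: Cfinite_ext (Cfinite_add (Cf i) IHs) => n; rewrite big_cons.
Qed.

Lemma Cfinite_residue d j : (0 < d)%N -> Cfinite (fun n => ((n %% d)%N == j)%:R : K).
Proof.
move=> d_gt0; exists ('X^d - 1); split; first by rewrite monic_neq0 // monic_Xn_sub_1.
move=> n; rewrite -/(act _ (fun n => ((n %% d)%N == j)%:R) n).
by rewrite actDl actXn -scaleN1r actZl act1 modnDr mulN1r subrr.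
Qed.

Lemma Cfinite_from n0 : Cfinite (fun n => (n0 <= n)%N%:R : K).
Proof.
exists ('X^n0 * ('X - 1%:P)); split.
  by rewrite monic_neq0 // rpredM ?monicXn ?monicXsubC.
move=> n; rewrite -/(act _ (fun n => (n0 <= n)%N%:R) n) actM actXn act_XsubC.
by rewrite !leq_addl leqW ?leq_addl // mul1r subrr.
Qed.

(** The residue indicators are periodic and the indicator of [n0 <= n] is killed by
    [E^n0 (E - 1)]. *)
Lemma Cfinite_glue d n0 (y : nat -> nat -> K) : (0 < d)%N ->
  (forall j, (j < d)%N -> Cfinite (y j)) ->
  Cfinite (fun n => if (n0 <= n)%N then y (n %% d)%N n else 0).
Proof.
move=> d_gt0 Cy.
have Csum : Cfinite (fun n => (n0 <= n)%N%:R * \sum_(j < d) ((n %% d)%N == j)%:R * y j n).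
  apply: Cfinite_mul; first exact: Cfinite_from.
  apply: Cfinite_sum => j; apply: Cfinite_mul; first exact: Cfinite_residue.
  exact: Cy.
apply: Cfinite_ext Csum => n; case: leqP => _; last by rewrite mul0r.
rewrite mul1r (bigD1 (Ordinal (ltn_pmod n d_gt0))) //= eqxx mul1r big1 ?addr0 //.
by move=> j ne_j; rewrite eq_sym (negPf (ne_j : (j : nat) != n %% d)%N) mul0r.
Qed.

Lemma char_poly_exists c : Cfinite c -> exists p, is_char_poly c p.
Proof.
move=> [p0 [nz_p0 pc0]]; have [p [mon_p _ pc]] := monic_rec nz_p0 pc0.
move: {2}(size p) (leqnn (size p)) => k.
elim: k p mon_p pc => [|k IHk] p mon_p pc le_pk.
  by move: (monic_neq0 mon_p); rewrite -size_poly_eq0 -leqn0 le_pk.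
case: (classic (exists q, [/\ q \is monic, satisfies_rec q c & (size q < size p)%N])).
  move=> [q [mon_q qc lt_q]]; apply: (IHk q) => //.
  by rewrite -ltnS (leq_trans lt_q).
move=> no; exists p; split=> // q mon_q qc; rewrite leqNgt; apply/negP => lt_q.
by apply: no; exists q.
Qed.

(** The difference of two monic recurrences of minimal order would be a shorter
    one. *)
Lemma char_poly_unique c p q : is_char_poly c p -> is_char_poly c q -> p = q.
Proof.
move=> [mon_p pc min_p] [mon_q qc min_q].
have eq_sz : size p = size q by apply/eqP; rewrite eqn_leq min_p ?min_q.
apply/eqP; rewrite -subr_eq0; apply/negPn/negP => nz_pq.
have pqc : satisfies_rec (p - q) c.
  move=> n; rewrite -/(act _ c n) actDl -scaleN1r actZl.
  by have -> := pc n : act p c n = 0; have -> := qc n : act q c n = 0; rewrite mulr0 addr0.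
have [r [mon_r sz_r rc]] := monic_rec nz_pq pqc.
have := min_p r mon_r rc; rewrite sz_r leqNgt => /negP[].
have nz_p := monic_neq0 mon_p.
have sz_p : size p = (size p).-1.+1 by rewrite prednK // size_poly_gt0.
rewrite sz_p ltnS; apply/leq_sizeP => i; rewrite leq_eqVlt => /orP[/eqP<-|lt_i].
  rewrite coefB -/(lead_coef p) (monicP mon_p) eq_sz -/(lead_coef q) (monicP mon_q).
  by rewrite subrr.
by rewrite coefB !nth_default ?subrr // -?eq_sz sz_p.
Qed.

Lemma eigenvalue_roots c : Cfinite c -> roots_in (Defs.eigenvalue iota c) c.
Proof.
move=> /char_poly_exists[p char_p]; have [mon_p pc _] := char_p.
have [Z [kc rZ]] := rec_roots_in mon_p pc; exists Z; split=> // z zZ nz_z.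
by split=> //; exists p; split=> //; apply: rZ.
Qed.

Lemma eigenvalue_finite c : Cfinite c ->
  exists Z : seq algC, forall z, Defs.eigenvalue iota c z -> z \in Z.
Proof.
move=> /char_poly_exists[p char_p]; have [mon_p _ _] := char_p.
have [Z defZ _] := rootpoly_of mon_p; exists Z => z [_ [q [/(char_poly_unique char_p) <-]]].
by rewrite defZ root_prod_XsubC.
Qed.

(** The lcm property alone would allow [d = 0], as the lcm of an unbounded set of
    orders; the orders are bounded because the eigenvalues are finite in
    number. *)
Lemma torsion_number_gt0 (r1 r2 : nat) (c1 : 'I_r1.+1 -> nat -> K)
    (c2 : 'I_r2.+1 -> nat -> K) d :
  (forall i, Cfinite (c1 i)) -> (forall i, Cfinite (c2 i)) ->
  torsion_number (rec_eigenvalue iota c1 c2) d -> (0 < d)%N.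
Proof.
move=> C1 C2 [_ dvd].
have /fin_all_exists[Z1 Z1P] : forall i, exists Z : seq algC,
    forall z, Defs.eigenvalue iota (c1 i) z -> z \in Z by move=> i; apply: eigenvalue_finite.
have /fin_all_exists[Z2 Z2P] : forall i, exists Z : seq algC,
    forall z, Defs.eigenvalue iota (c2 i) z -> z \in Z by move=> i; apply: eigenvalue_finite.
pose Z := flatten [seq Z1 i | i : 'I_r1.+1] ++ flatten [seq Z2 i | i : 'I_r2.+1].
have EZ z : rec_eigenvalue iota c1 c2 z -> z \in Z.
  rewrite mem_cat => Ez; apply/orP; case: Ez => [[i /Z1P zZ]|[i /Z2P zZ]]; [left|right];
    by apply/flatten_mapP; exists i; rewrite ?mem_enum.
have [M M_gt0 /dvd dvM] := torsion_exponent_exists EZ.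
exact: dvdn_gt0 M_gt0 dvM.
Qed.

Lemma roots_in_ring G : G 1 -> (forall z w, G z -> G w -> G (z * w)) ->
  sequence_ring (roots_in G).
Proof.
move=> G1 GM; split=> [f g|a|f g|f g|f Sf].
- exact: roots_in_ext.
- exact: roots_in_const.
- exact: roots_in_add.
- exact: roots_in_mul.
by apply: roots_in_ext (roots_in_shift 1 Sf) => n; rewrite addn1.
Qed.

Lemma mulgen_ring (E : algC -> Prop) : sequence_ring (roots_in (mulgen E)).
Proof. by apply: roots_in_ring; [apply: mulgen_1 | apply: mulgen_M]. Qed.

(** The torsion number of the eigenvalues is a modulus for all sequences built from
    the coefficients by ring operations and shifts: their roots remain in the
    group generated by the eigenvalues. *)
Lemma mulgen_class (E : algC -> Prop) d : (0 < d)%N -> torsion_exponent E d ->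
  class_dichotomy_in d (roots_in (mulgen E)).
Proof.
move=> d_gt0 torE f j [Z [kf GZ]].
have torZ z z' k : z \in Z -> z' \in Z -> z != 0 -> z' != 0 ->
    k.-primitive_root (z / z') -> (k %| d)%N.
  move=> zZ z'Z nz_z nz_z'; apply: torE; apply: mulgen_M; first exact: GZ.
  by apply: mulgen_V; apply: GZ.
have back N n : (d * N.+1 <= n)%N -> (n %% d)%N = j -> exists2 m, (N <= m)%N & n = (d * m + j)%N.
  move=> le_n nj; exists (n %/ d)%N; last by rewrite -nj mulnC -divn_eq.
  by rewrite leq_divRL // mulnC (leq_trans _ le_n) // leq_mul2l leqnSn orbT.
have [f0|[N fN]] := class_dichotomy j d_gt0 kf torZ; [left|right].
  by exists (d * (size Z).+1)%N => n le_n /(back _ _ le_n)[m le_m ->]; apply: f0.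
by exists (d * N.+1)%N => n le_n /(back _ _ le_n)[m le_m ->]; apply: fN.
Qed.

End CfiniteRing.

(** * One recurrence as a companion cocycle *)

Section Companion.
Variables (K : fieldType) (r : nat) (c : nat -> nat -> K).

(** [c r n] times the usual companion matrix. *)
Definition companion n : 'M[K]_r := \matrix_(a, b)
  if a.+1 == r then - c b n else if (b : nat) == a.+1 then c r n else 0.

(** [term_row i n] expresses [X_i], up to the factor [lead i n], by the initial
    values [X_0, ..., X_(r-1)] of a solution of the recurrence started at [n].
    Multiplying by leading coefficients avoids all divisions. *)
Fixpoint term_row i n : 'rV[K]_r :=
  if i is i'.+1 then term_row i' n.+1 *m companion n else \row_b ((b : nat) == 0%N)%:R.

Fixpoint companion_prod e n : 'M[K]_r :=
  if e is e'.+1 then companion_prod e' n.+1 *m companion n else 1%:M.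

Lemma term_row_cocycle i e n : term_row (i + e) n = term_row i (n + e)%N *m companion_prod e n.
Proof.
elim: e n => [|e IHe] n; first by rewrite !addn0 mulmx1.
by rewrite addnS /= IHe mulmxA addSnnS.
Qed.

Definition lead i n := \prod_(k < i) c r (n + k)%N.

Definition state (X : nat -> K) : 'cV[K]_r := \col_a X a.

Lemma term_rowE (X : nat -> K) i n :
    (forall k, (k <= i)%N -> \sum_(m < r.+1) c m (n + k)%N * X (k + m)%N = 0) ->
    (forall k, (k <= i)%N -> c r (n + k)%N != 0) ->
  term_row i n *m state X = (lead i n * X i)%:M.
Proof.
elim: i n X => [|i IHi] n X relX nzX.
  apply/rowP => z; rewrite !mxE ord1 eqxx mulr1n /lead big_ord0 mul1r.
  have [r0|r_gt0] := posnP r.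
    have no_a (a : 'I_r) : False by have := ltn_ord a; rewrite [X in (_ < X)%N]r0.
    have := relX 0%N isT; rewrite big_ord_recr /= !big1 ?add0r; try by move=> a; case: (no_a a).
    move/eqP; rewrite mulf_eq0 (negPf (nzX 0%N isT)) add0n => /eqP.
    by rewrite {1}r0 => ->.
  rewrite (bigD1 (Ordinal r_gt0)) //= !mxE eqxx mul1r big1 ?addr0 // => a ne_a0.
  by rewrite !mxE (negPf (ne_a0 : (a : nat) != 0%N)) mul0r.
have step : companion n *m state X = c r n *: state (fun k => X k.+1).
  apply/colP => a; rewrite !mxE.
  have [eq_a|ne_a] := eqVneq a.+1 r.
    have := relX 0%N isT; rewrite addn0 big_ord_recr /= !add0n.
    move/eqP; rewrite addrC addr_eq0 => /eqP; rewrite eq_a => ->; rewrite -sumrN.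
    by apply: eq_bigr => b _; rewrite !mxE eq_a eqxx mulNr.
  have lt_a : (a.+1 < r)%N by rewrite ltn_neqAle ne_a ltn_ord.
  rewrite (bigD1 (Ordinal lt_a)) //= !mxE (negPf ne_a) eqxx big1 ?addr0 // => b ne_b.
  by rewrite !mxE (negPf ne_a) (negPf (ne_b : (b : nat) != a.+1)) mul0r.
rewrite /= -mulmxA step -scalemxAr (IHi n.+1 (fun k => X k.+1)); last first.
- by move=> k le_k; have := nzX k.+1 le_k; rewrite addnS.
- by move=> k le_k; have := relX k.+1 le_k; rewrite addnS.
rewrite scale_scalar_mx mulrA /lead big_ord_recl addn0; congr (_ * _ * _)%:M.
by apply: eq_bigr => k _; rewrite /= /bump /= add1n addnS.
Qed.

Lemma lead_neq0 i n : (forall k, (k < i)%N -> c r (n + k)%N != 0) -> lead i n != 0.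
Proof. by move=> nz; apply/prodf_neq0 => k _; apply: nz. Qed.

End Companion.

Section CompanionRing.
Variables (K : fieldType) (S : (nat -> K) -> Prop).
Hypothesis ringS : sequence_ring S.
Let S_ext := ring_ext ringS.
Let S_const := ring_const ringS.

Lemma Smx_companion r (c : nat -> nat -> K) : (forall m, S (c m)) -> Smx S (companion r c).
Proof.
move=> Sc a b; apply: S_ext (_ : S (fun n =>
    if a.+1 == r then - c b n else if (b : nat) == a.+1 then c r n else 0)).
  by move=> n; rewrite mxE.
case: eqP => _; first exact: (S_opp ringS (Sc b)).
by case: eqP.
Qed.

Lemma Smx_term_row r (c : nat -> nat -> K) i : (forall m, S (c m)) ->
  Smx S (term_row r c i).
Proof.
move=> Sc; elim: i => [|i IHi] /=.
  by move=> a b; apply: S_ext (S_const ((b : nat) == 0%N)%:R) => n; rewrite mxE.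
apply: (Smx_mul ringS) (Smx_companion Sc) => a b.
exact: (ring_shift ringS (IHi a b)).
Qed.

End CompanionRing.

(** * Sums indexed by flattened pairs *)

Lemma sum_flatten (K : nmodType) A L (G : nat -> nat -> K) :
  \sum_(h < A * L) G (h %/ L)%N (h %% L)%N = \sum_(a < A) \sum_(i < L) G a i.
Proof.
rewrite -(big_mkord xpredT (fun h => G (h %/ L)%N (h %% L)%N)) big_nat_mul.
rewrite big_mkord; apply: eq_bigr => a _.
rewrite -{1}[(a * L)%N]add0n mulSn big_addn addnK big_mkord; apply: eq_bigr => i _.
have L_gt0 : (0 < L)%N by case: L i => [[]|].
by rewrite addnC divnMDl // divn_small // addn0 modnMDl modn_small.
Qed.

Lemma sum_offset (K : pzRingType) (c : nat -> K) (X : nat -> K) r k L :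
    (k + r < L)%N -> (forall m, (r < m)%N -> c m = 0) ->
  \sum_(i < L) (if (k <= i)%N then c (i - k)%N else 0) * X i
    = \sum_(m < r.+1) c m * X (k + m)%N.
Proof.
move=> lt_L c0; have -> : (L = k + (r.+1 + (L - (k + r).+1)))%N by lia.
rewrite big_split_ord big1 /= => [|i _]; last by rewrite leqNgt ltn_ord mul0r.
rewrite add0r big_split_ord /= [X in _ + X]big1 ?addr0 => [|i _]; last first.
  by rewrite leq_addr addKn c0 ?mul0r // ltnS leq_addr.
by apply: eq_bigr => i _; rewrite leq_addr addKn.
Qed.

(** * The linear systems for sums and products *)

Section Systems.
Variables (K : fieldType) (r1 r2 : nat) (c1 c2 : nat -> nat -> K).
Hypothesis c1_0 : forall m, (r1 < m)%N -> c1 m =1 (fun _ => 0).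
Hypothesis c2_0 : forall m, (r2 < m)%N -> c2 m =1 (fun _ => 0).

(** A recurrence of order [D] involves [a(n), ..., a(n + D)], and the recurrences
    started at [n, ..., n + D] reach [a(n + D + r1)] and [b(n + D + r2)]; one
    block size serves for both. *)
Definition block D := (D + r1 + r2).+1.

Definition cof (q : nat) := if q == 0%N then c1 else c2.

Definition sum_rows D := (D.+1 + 2 * D.+1)%N.
Definition sum_cols D := (2 * block D)%N.

(** A recurrence of order [D] for [a + b] that follows from those of [a] and [b] is
    a linear dependence between the rows of this matrix.
    The unknowns are [X_i = a(n+i)] and [Y_i = b(n+i)].  Row [t <= D] is
    [X_t + Y_t]; the other rows are the two recurrences started at [n+k]. *)
Definition sum_entry D (row col n : nat) : K :=
  if (row <= D)%N then ((col %% block D)%N == row)%:R else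
  let k := ((row - D.+1) %% D.+1)%N in
  if ((row - D.+1) %/ D.+1 == col %/ block D)%N && (k <= col %% block D)%N
  then cof ((row - D.+1) %/ D.+1)%N (col %% block D - k)%N (n + k)%N else 0.

Definition prod_rows D := (D.+1 + 2 * D.+1 * block D)%N.
Definition prod_cols D := (block D * block D)%N.

(** The unknowns are [Z_(i,j) = a(n+i) b(n+j)].  Row [t <= D] is [Z_(t,t)]; the
    other rows are the recurrence of one factor, started at [n+k], the index [l]
    of the other factor being fixed; they are numbered by [q * D.+1 * block + k *
    block + l], with [q] for the choice of the factor. *)
Definition prod_entry D (row col n : nat) : K :=
  let i := (col %/ block D)%N in let j := (col %% block D)%N in
  if (row <= D)%N then ((i == row) && (j == row))%:R else
  let m := (row - D.+1)%N in
  let l := (m %% block D)%N in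
  let k := (m %/ block D %% D.+1)%N in
  if (m %/ block D %/ D.+1 == 0)%N
  then if (j == l) && (k <= i)%N then c1 (i - k)%N (n + k)%N else 0
  else if (i == l) && (k <= j)%N then c2 (j - k)%N (n + k)%N else 0.

Lemma sum_entry_target D t n (z : nat -> nat -> K) : (t <= D)%N ->
  \sum_(h < sum_cols D) sum_entry D t h n * z (h %/ block D)%N (h %% block D)%N
    = z 0%N t + z 1%N t.
Proof.
move=> le_tD; rewrite /sum_entry le_tD.
rewrite (@sum_flatten _ 2 (block D) (fun q i => (i == t)%:R * z q i)).
have lt_tL : (t < block D)%N by rewrite /block; lia.
have E q : \sum_(i < block D) ((i : nat) == t)%:R * z q i = z q t.
  rewrite (bigD1 (Ordinal lt_tL)) //= eqxx mul1r big1 ?addr0 // => i ne_i.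
  by rewrite (negPf (ne_i : (i : nat) != t)) mul0r.
by rewrite big_ord_recr big_ord1 !E.
Qed.

Lemma sum_entry_relator D q k n (z : nat -> nat -> K) : (q < 2)%N -> (k <= D)%N ->
  \sum_(h < sum_cols D) sum_entry D (D.+1 + (q * D.+1 + k)) h n
      * z (h %/ block D)%N (h %% block D)%N
    = \sum_(m < (if q == 0%N then r1 else r2).+1) cof q m (n + k)%N * z q (k + m)%N.
Proof.
move=> lt_q le_kD; rewrite /sum_entry leqNgt leq_addr /= addKn.
rewrite modnMDl modn_small // divnMDl // divn_small // addn0.
rewrite (@sum_flatten _ 2 (block D) (fun q' i => (if (q == q') && (k <= i)%N then
   cof q (i - k)%N (n + k)%N else 0) * z q' i)).
rewrite (bigD1 (Ordinal lt_q)) //= eqxx [X in _ + X]big1 ?addr0 => [|q' ne_q']; last first.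
  by apply: big1 => i _; rewrite eq_sym (negPf (ne_q' : (q' : nat) != q)) mul0r.
rewrite /= (@sum_offset _ (fun m => cof q m (n + k)%N) _ (if q == 0%N then r1 else r2)) //.
  by rewrite /block; case: ifP; lia.
by rewrite /cof => m; case: ifP => _ lt_m; rewrite ?c1_0 ?c2_0.
Qed.

Lemma prod_entry_target D t n (z : nat -> nat -> K) : (t <= D)%N ->
  \sum_(h < prod_cols D) prod_entry D t h n * z (h %/ block D)%N (h %% block D)%N
    = z t t.
Proof.
move=> le_tD; rewrite /prod_entry le_tD.
rewrite (@sum_flatten _ (block D) (block D) (fun i j => ((i == t) && (j == t))%:R * z i j)).
have lt_tL : (t < block D)%N by rewrite /block; lia.
rewrite (bigD1 (Ordinal lt_tL)) //= eqxx [X in _ + X]big1 ?addr0 => [|i ne_i]; last first.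
  by apply: big1 => j _; rewrite (negPf (ne_i : (i : nat) != t)) mul0r.
rewrite (bigD1 (Ordinal lt_tL)) //= eqxx mul1r big1 ?addr0 // => i ne_i.
by rewrite (negPf (ne_i : (i : nat) != t)) mul0r.
Qed.

Lemma prod_entry_relator1 D k l n (z : nat -> nat -> K) : (k <= D)%N -> (l < block D)%N ->
  \sum_(h < prod_cols D) prod_entry D (D.+1 + (k * block D + l)) h n
      * z (h %/ block D)%N (h %% block D)%N
    = \sum_(m < r1.+1) c1 m (n + k)%N * z (k + m)%N l.
Proof.
move=> le_kD lt_l; rewrite /prod_entry leqNgt leq_addr /= addKn.
rewrite modnMDl (modn_small lt_l) divnMDl // (divn_small lt_l) addn0.
rewrite modn_small // divn_small //=.
rewrite (@sum_flatten _ (block D) (block D) (fun i j => (if (j == l) && (k <= i)%N then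
   c1 (i - k)%N (n + k)%N else 0) * z i j)) exchange_big.
rewrite (bigD1 (Ordinal lt_l)) //= eqxx [X in _ + X]big1 ?addr0 => [|j ne_j]; last first.
  by apply: big1 => i _; rewrite (negPf (ne_j : (j : nat) != l)) mul0r.
rewrite /= (@sum_offset _ (fun m => c1 m (n + k)%N) (fun i => z i l) r1) //.
  by rewrite /block; lia.
by move=> m lt_m; rewrite c1_0.
Qed.

Lemma prod_entry_relator2 D k l n (z : nat -> nat -> K) : (k <= D)%N -> (l < block D)%N ->
  \sum_(h < prod_cols D) prod_entry D (D.+1 + ((D.+1 + k) * block D + l)) h n
      * z (h %/ block D)%N (h %% block D)%N
    = \sum_(m < r2.+1) c2 m (n + k)%N * z l (k + m)%N.
Proof.
move=> le_kD lt_l; rewrite /prod_entry leqNgt leq_addr /= addKn.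
rewrite modnMDl (modn_small lt_l) divnMDl // (divn_small lt_l) addn0.
rewrite modnDl modn_small // divnDl // divnn divn_small //=.
rewrite (@sum_flatten _ (block D) (block D) (fun i j => (if (i == l) && (k <= j)%N then
   c2 (j - k)%N (n + k)%N else 0) * z i j)).
rewrite (bigD1 (Ordinal lt_l)) //= eqxx [X in _ + X]big1 ?addr0 => [|i ne_i]; last first.
  by apply: big1 => j _; rewrite (negPf (ne_i : (i : nat) != l)) mul0r.
rewrite /= (@sum_offset _ (fun m => c2 m (n + k)%N) (fun j => z l j) r2) //.
  by rewrite /block; lia.
by move=> m lt_m; rewrite c2_0.
Qed.

End Systems.

(** * Dependence at order [d * R] *)

(** Row spaces are determined by their kernels. *)
Lemma erase_row_kernel (K : fieldType) N V (D : 'I_N) (A : 'M[K]_(N, V)) :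
  (forall z : 'cV_V, erase_row D A *m z = 0 -> row D A *m z = 0) ->
  (row D A <= erase_row D A)%MS.
Proof.
move=> kerD; rewrite submxE; apply/eqP/row_matrixP => i; rewrite row0.
apply/rowP => h; rewrite !ord1.
have e : erase_row D A *m (cokermx (erase_row D A) *m delta_mx h 0) = 0 :> 'cV_N.
  by rewrite mulmxA mulmx_coker mul0mx.
have /matrixP/(_ 0 0) := kerD _ e.
by rewrite mulmxA -colE !mxE.
Qed.

Section Dependence.
Variables (K : fieldType) (S : (nat -> K) -> Prop) (d r1 r2 : nat).
Variables (c1 c2 : nat -> nat -> K).
Hypothesis d_gt0 : (0 < d)%N.
Hypothesis ringS : sequence_ring S.
Let S_ext := ring_ext ringS.
Let S_mul := ring_mul ringS.
Hypothesis S_class : class_dichotomy_in d S.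
Hypothesis Sc1 : forall m, S (c1 m).
Hypothesis Sc2 : forall m, S (c2 m).
Hypothesis c1_0 : forall m, (r1 < m)%N -> c1 m =1 (fun _ => 0).
Hypothesis c2_0 : forall m, (r2 < m)%N -> c2 m =1 (fun _ => 0).
Hypothesis nz1 : eventually (fun n => c1 r1 n != 0).
Hypothesis nz2 : eventually (fun n => c2 r2 n != 0).

Definition entry_mx N V (T : nat -> nat -> nat -> K) n : 'M[K]_(N, V) :=
  \matrix_(i, h) T i h n.

Lemma S_shiftn f k : S f -> S (fun n => f (n + k)%N).
Proof.
move=> Sf; elim: k => [|k IHk]; first by apply: S_ext Sf => n; rewrite addn0.
by apply: S_ext (ring_shift ringS IHk) => n; rewrite addnS addSn.
Qed.

Lemma S_lead r (c : nat -> nat -> K) i : (forall m, S (c m)) -> S (lead r c i).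
Proof.
by move=> Sc; apply: (S_prod ringS) => k; apply: S_shiftn.
Qed.

Lemma lead_cocycle r (c : nat -> nat -> K) i e n :
  lead r c (i + e) n = lead r c i (n + e)%N * lead r c e n.
Proof.
rewrite /lead addnC big_split_ord mulrC; congr (_ * _).
by apply: eq_bigr => k _; rewrite /= addnA.
Qed.

Lemma leads_neq0 : eventually (fun n => (forall k, c1 r1 (n + k)%N != 0) /\
  (forall k, c2 r2 (n + k)%N != 0)).
Proof.
have [n1 nzn1] := nz1; have [n2 nzn2] := nz2; exists (n1 + n2)%N => n le_n.
by split=> k; [apply: nzn1 | apply: nzn2]; lia.
Qed.

(** The inverse of flattening, extended by zero. *)
Let flat_vec V L (z : 'cV[K]_V) q i : K := if insub (q * L + i)%N is Some h then z h 0 else 0.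

Lemma flat_vecE V L (z : 'cV[K]_V) (h : 'I_V) : z h 0 = flat_vec L z (h %/ L)%N (h %% L)%N.
Proof. by rewrite /flat_vec -divn_eq valK. Qed.

Lemma erased_rows N V (T : nat -> nat -> nat -> K) (D : 'I_N) L n (z : 'cV[K]_V) i :
    erase_row D (entry_mx N V T n) *m z = 0 -> (i < N)%N -> i != D ->
  \sum_(h < V) T i h n * flat_vec L z (h %/ L)%N (h %% L)%N = 0.
Proof.
move=> Tz lt_iN ne_iD.
transitivity ((erase_row D (entry_mx N V T n) *m z) (Ordinal lt_iN) 0); last by rewrite Tz mxE.
rewrite mxE; apply: eq_bigr => h _.
by rewrite !mxE -(flat_vecE L z h) -(inj_eq val_inj) /= (negPf ne_iD).
Qed.

Definition target_row D m : 'I_(D.+1 + m) := lshift m ord_max.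

(** For a solution [z] of the relator rows, [X_i] and [Y_i] are linear in the two
    initial states.  [w_i] applied to the pair of states is [X_i + Y_i] times the
    product of the two leads, each half carrying the lead of the other
    recurrence so that both acquire the same factor.  The dimension is [r1 + r2],
    so if [X_i + Y_i] vanishes for all [i < D] it does at [D]. *)
Lemma sum_dependence D : D = (d * (r1 + r2))%N ->
  eventually (fun n =>
    let A := entry_mx (sum_rows D) (sum_cols r1 r2 D) (sum_entry r1 r2 c1 c2 D) n in
    (row (target_row D _) A <= erase_row (target_row D _) A)%MS).
Proof.
move=> defD.
pose w i n : 'rV[K]_(r1 + r2) :=
  row_mx (lead r2 c2 i n *: term_row r1 c1 i n) (lead r1 c1 i n *: term_row r2 c2 i n).
have Sw i : Smx S (w i).
  move=> a h; rewrite -(splitK h); case: (split h) => h' /=.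
    have X := S_mul (S_lead r2 i Sc2) (Smx_term_row ringS (r := r1) i Sc1 a h').
    by apply: S_ext X => n; rewrite /w row_mxEl mxE.
  have X := S_mul (S_lead r1 i Sc1) (Smx_term_row ringS (r := r2) i Sc2 a h').
  by apply: S_ext X => n; rewrite /w row_mxEr mxE.
have cocycle n e : exists A : 'M_(r1 + r2), forall i, w (i + e)%N n = w i (n + e)%N *m A.
  exists (block_mx (lead r2 c2 e n *: companion_prod r1 c1 e n) 0
                   0 (lead r1 c1 e n *: companion_prod r2 c2 e n)) => i.
  rewrite /w mul_row_block !mulmx0 addr0 add0r !lead_cocycle !term_row_cocycle.
  by rewrite -!scalemxAl -!scalemxAr !scalerA.
have := cocycle_dependence d_gt0 ringS S_class Sw cocycle.
move=> /(eventually_and leads_neq0); apply: eventuallyW => n [[nzl1 nzl2] dep] /=.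
apply: erase_row_kernel => z Tz; set zf := flat_vec (block r1 r2 D) z.
have rowE i : (i < sum_rows D)%N -> i != D ->
    \sum_(h < sum_cols r1 r2 D) sum_entry r1 r2 c1 c2 D i h n
      * zf (h %/ block r1 r2 D)%N (h %% block r1 r2 D)%N = 0.
  exact: (erased_rows (T := sum_entry r1 r2 c1 c2 D) (block r1 r2 D) Tz).
have wE i : (i <= D)%N -> w i n *m col_mx (state r1 (zf 0%N)) (state r2 (zf 1%N)) =
    (lead r1 c1 i n * lead r2 c2 i n * (zf 0%N i + zf 1%N i))%:M.
  move=> le_iD; rewrite /w mul_row_col -!scalemxAl.
  rewrite (@term_rowE _ r1 c1 (zf 0%N)) // => [|k le_k].
    rewrite (@term_rowE _ r2 c2 (zf 1%N)) // => [|k le_k].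
      by rewrite !scale_scalar_mx -raddfD; congr (_%:M); ring.
    have := sum_entry_relator c1_0 c2_0 n zf (isT : (1 < 2)%N) (leq_trans le_k le_iD).
    rewrite /cof /= => <-.
    by apply: rowE; rewrite /sum_rows /=; lia.
  have := sum_entry_relator c1_0 c2_0 n zf (isT : (0 < 2)%N) (leq_trans le_k le_iD).
  rewrite /cof /= => <-.
  by apply: rowE; rewrite /sum_rows /=; lia.
have wu0 : w D n *m col_mx (state r1 (zf 0%N)) (state r2 (zf 1%N)) = 0.
  rewrite {1}defD; apply: dep => i lt_i; rewrite wE; last by rewrite defD ltnW.
  have lt_iD : (i < D)%N by rewrite defD.
  have <- := sum_entry_target r1 r2 c1 c2 n zf (ltnW lt_iD).
  rewrite [X in _ * X](_ : _ = 0) ?mulr0 ?raddf0 //.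
  by apply: rowE; [rewrite /sum_rows; lia | rewrite /= ltn_eqF].
have := wE D (leqnn D); rewrite wu0 => /esym/matrixP/(_ 0 0); rewrite !mxE eqxx mulr1n.
move/eqP; rewrite !mulf_eq0 (negPf (lead_neq0 _)) // (negPf (lead_neq0 _)) //=.
rewrite -(sum_entry_target r1 r2 c1 c2 n zf (leqnn D)) => /eqP z0.
apply/matrixP => i j; rewrite !ord1 !mxE -[RHS]z0; apply: eq_bigr => h _.
by rewrite !mxE (flat_vecE (block r1 r2 D) z h).
Qed.

(** The same with the tensor product of the two companion cocycles, of dimension
    [r1 * r2], applied to the matrix of the unknowns [Z_(a,b)] with [a < r1] and
    [b < r2]: the recurrence of the first factor reduces [Z_(i,b)] to that matrix,
    and the one of the second reduces [Z_(i,i)] to the [Z_(i,b)]. *)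
Lemma prod_dependence D : D = (d * (r1 * r2))%N ->
  eventually (fun n =>
    let A := entry_mx (prod_rows r1 r2 D) (prod_cols r1 r2 D) (prod_entry r1 r2 c1 c2 D) n in
    (row (target_row D _) A <= erase_row (target_row D _) A)%MS).
Proof.
move=> defD.
pose w i n : 'rV[K]_(r1 * r2) := mxvec ((term_row r1 c1 i n)^T *m term_row r2 c2 i n).
have Sw i : Smx S (w i).
  move=> a h; case/mxvec_indexP: h => h1 h2.
  have X := S_mul (Smx_term_row ringS (r := r1) i Sc1 0 h1)
    (Smx_term_row ringS (r := r2) i Sc2 0 h2).
  apply: S_ext X => n.
  by rewrite ord1 mxvecE mxE big_ord1 !mxE.
have cocycle n e : exists A : 'M_(r1 * r2), forall i, w (i + e)%N n = w i (n + e)%N *m A.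
  exists (lin_mulmx (companion_prod r1 c1 e n)^T *m lin_mulmxr (companion_prod r2 c2 e n)) => i.
  rewrite /w !term_row_cocycle [RHS]mulmxA /lin_mulmx /lin_mulmxr !mul_vec_lin /= trmx_mul.
  by rewrite !mulmxA.
have := cocycle_dependence d_gt0 ringS S_class Sw cocycle.
move=> /(eventually_and leads_neq0); apply: eventuallyW => n [[nzl1 nzl2] dep] /=.
apply: erase_row_kernel => z Tz; set zf := flat_vec (block r1 r2 D) z.
have rowE i : (i < prod_rows r1 r2 D)%N -> i != D ->
    \sum_(h < prod_cols r1 r2 D) prod_entry r1 r2 c1 c2 D i h n
      * zf (h %/ block r1 r2 D)%N (h %% block r1 r2 D)%N = 0.
  exact: (erased_rows (T := prod_entry r1 r2 c1 c2 D) (block r1 r2 D) Tz).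
pose U := \matrix_(a < r1, b < r2) zf a b.
have wE i : (i <= D)%N -> w i n *m (mxvec U)^T = (lead r1 c1 i n * lead r2 c2 i n * zf i i)%:M.
  move=> le_iD; rewrite /w mxvec_dotmul.
  have -> : term_row r1 c1 i n *m U = lead r1 c1 i n *: (state r2 (zf i))^T.
    apply/matrixP => a b; rewrite ord1.
    have := @term_rowE _ r1 c1 (fun k => zf k b) i n.
    have -> : state r1 (fun k => zf k b) = col b U by apply/matrixP => a' b'; rewrite /state !mxE.
    rewrite colE mulmxA -colE => E.
    have lt_bL : (b < block r1 r2 D)%N by rewrite /block; have := ltn_ord b; lia.
    have /matrixP/(_ 0 0) : col b (term_row r1 c1 i n *m U) = (lead r1 c1 i n * zf i b)%:M.
      apply: E => // k le_k.
      have <- := prod_entry_relator1 c2 c1_0 n zf (leq_trans le_k le_iD) lt_bL.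
      by apply: rowE; rewrite /prod_rows /=; nia.
    by rewrite mxE => ->; rewrite !mxE eqxx mulr1n.
  rewrite -scalemxAl -trmx_mul (@term_rowE _ r2 c2 (zf i)) // => [|k le_k].
    by rewrite tr_scalar_mx scale_scalar_mx mulrA.
  have lt_iL : (i < block r1 r2 D)%N by rewrite /block; lia.
  have <- := prod_entry_relator2 c1 c2_0 n zf (leq_trans le_k le_iD) lt_iL.
  by apply: rowE; rewrite /prod_rows /=; nia.
have wu0 : w D n *m (mxvec U)^T = 0.
  rewrite {1}defD; apply: dep => i lt_i; rewrite wE; last by rewrite defD ltnW.
  have lt_iD : (i < D)%N by rewrite defD.
  have <- := prod_entry_target r1 r2 c1 c2 n zf (ltnW lt_iD).
  rewrite [X in _ * X](_ : _ = 0) ?mulr0 ?raddf0 //.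
  by apply: rowE; [rewrite /prod_rows; lia | rewrite /= ltn_eqF].
have := wE D (leqnn D); rewrite wu0 => /esym/matrixP/(_ 0 0); rewrite !mxE eqxx mulr1n.
move/eqP; rewrite !mulf_eq0 (negPf (lead_neq0 _)) // (negPf (lead_neq0 _)) //=.
rewrite -(prod_entry_target r1 r2 c1 c2 n zf (leqnn D)) => /eqP z0.
apply/matrixP => i j; rewrite !ord1 !mxE -[RHS]z0; apply: eq_bigr => h _.
by rewrite !mxE (flat_vecE (block r1 r2 D) z h).
Qed.

End Dependence.

(** * Computable functions of natural numbers *)

(** Only total functions occur before the final unbounded search, so computability
    is stated for functions instead of graphs. *)
Definition computable k (F : k.-tuple nat -> nat) :=
  exists f : recfun k, forall v, reval f v (F v).

(** The step function receives the index first, as in [RPrim]. *)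
Fixpoint nrec (x : nat) (g : nat -> nat -> nat) (n : nat) : nat :=
  if n is n'.+1 then g n' (nrec x g n') else x.

Lemma eq_nrec x g g' n : (forall j a, g j a = g' j a) -> nrec x g n = nrec x g' n.
Proof. by move=> eqg; elim: n => //= n ->. Qed.

Section Computable.
Local Open Scope nat_scope.

Lemma computable_ext k (F G : k.-tuple nat -> nat) :
  F =1 G -> computable F -> computable G.
Proof. by move=> eqFG [f fF]; exists f => v; rewrite -eqFG. Qed.

Lemma computable_proj k (i : 'I_k) : computable (fun v => tnth v i).
Proof. by exists (RProj i). Qed.

Lemma computable_comp k m (F : m.-tuple nat -> nat) (G : 'I_m -> k.-tuple nat -> nat) :
  computable F -> (forall i, computable (G i)) ->
  computable (fun v => F [tuple G i v | i < m]).
Proof.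
move=> [f fF] /fin_all_exists[g gG]; exists (RComp f g) => v.
by exists [tuple G i v | i < m]; split=> // i; rewrite tnth_mktuple.
Qed.

Lemma computable_prim k (F : k.-tuple nat -> nat) (G : k.+2.-tuple nat -> nat) :
  computable F -> computable G ->
  computable (fun v : k.+1.-tuple nat => nrec (F [tuple of behead v])
    (fun j acc => G [tuple of j :: acc :: behead v]) (thead v)).
Proof.
move=> [f fF] [g gG]; exists (RPrim f g) => v.
by exists (nrec (F [tuple of behead v]) (fun j acc => G [tuple of j :: acc :: behead v])).
Qed.

Definition computable1 (H : nat -> nat) := computable (fun v : 1.-tuple nat => H (thead v)).
Definition computable2 (H : nat -> nat -> nat) :=
  computable (fun v : 2.-tuple nat => H (thead v) (tnth v (lift ord0 ord0))).

Lemma computable_comp1 H k (A : k.-tuple nat -> nat) :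
  computable1 H -> computable A -> computable (fun v => H (A v)).
Proof.
move=> cH cA; apply: computable_ext (computable_comp cH (fun _ => cA)) => v.
by rewrite /thead tnth_mktuple.
Qed.

Lemma computable_comp2 H k (A B : k.-tuple nat -> nat) :
  computable2 H -> computable A -> computable B -> computable (fun v => H (A v) (B v)).
Proof.
move=> cH cA cB.
have cG (i : 'I_2) : computable (if i == ord0 then A else B) by case: ifP.
apply: computable_ext (computable_comp cH cG) => v.
by rewrite /thead !tnth_mktuple.
Qed.

Lemma computable_succ k (A : k.-tuple nat -> nat) : computable A -> computable (fun v => (A v).+1).
Proof. by apply: (@computable_comp1 S); exists RSucc. Qed.

Lemma computable_const k c : computable (fun _ : k.-tuple nat => c).
Proof.
elim: c => [|c IHc]; first by exists (RZero k).
exact: computable_succ IHc.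
Qed.

(** One parameter suffices: several are packed into one coded list. *)
Lemma computable_rec x (g : nat -> nat -> nat -> nat) :
  computable1 x ->
  computable (fun v : 3.-tuple nat =>
    g (thead v) (tnth v (lift ord0 ord0)) (tnth v (lift ord0 (lift ord0 ord0)))) ->
  computable2 (fun n e => nrec (x e) (fun j acc => g j acc e) n).
Proof.
move=> cx cg; apply: computable_ext (computable_prim cx cg) => v.
have -> : thead [tuple of behead v] = tnth v (lift ord0 ord0).
  by case/tupleP: v => a v; case/tupleP: v => b v; rewrite /thead !(tnth_nth 0).
apply: eq_nrec => j acc; rewrite /thead !(tnth_nth 0) /=.
by case/tupleP: v => a v; case/tupleP: v => b v.
Qed.

Let var3 (i : 'I_3) : computable (fun v : 3.-tuple nat => tnth v i) := computable_proj i.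
Let id1 : computable1 (fun e => e).
Proof. exact: computable_proj. Qed.

Lemma computable_rec_eq x g H :
  (forall n e, nrec (x e) (fun j acc => g j acc e) n = H n e) ->
  computable1 x ->
  computable (fun v : 3.-tuple nat =>
    g (thead v) (tnth v (lift ord0 ord0)) (tnth v (lift ord0 (lift ord0 ord0)))) ->
  computable2 H.
Proof. by move=> defH cx cg; apply: computable_ext (computable_rec cx cg) => v; apply: defH. Qed.

Lemma computable2_diag H : computable2 H -> computable1 (fun e => H e e).
Proof. by move=> cH; apply: (computable_comp2 cH); apply: id1. Qed.

Lemma computable_add : computable2 addn.
Proof.
apply: (@computable_rec_eq (fun e => e) (fun j acc e => acc.+1)) => //.
  by elim=> //= n IHn e; rewrite IHn.
by apply: computable_succ; apply: var3.
Qed.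

Lemma computable_pred : computable1 predn.
Proof.
suff : computable2 (fun n e => n.-1) by move/computable2_diag.
apply: (@computable_rec_eq (fun e => 0) (fun j acc e => j)); first by case.
  exact: computable_const.
exact: (var3 ord0).
Qed.

Lemma computable2_swap H : computable2 H -> computable2 (fun a b => H b a).
Proof.
move=> cH; apply: (computable_comp2 cH); first exact: computable_proj.
exact: (computable_proj ord0).
Qed.

Lemma computable_sub : computable2 subn.
Proof.
apply: (@computable2_swap (fun n e => e - n)).
apply: (@computable_rec_eq (fun e => e) (fun j acc e => acc.-1)) => //.
  by elim=> [|n IHn] e /=; rewrite ?subn0 // IHn subnS.
by apply: (computable_comp1 computable_pred); apply: var3.
Qed.

Lemma computable_mul : computable2 muln.
Proof.
apply: (@computable_rec_eq (fun e => 0) (fun j acc e => e + acc)) => //.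
- by elim=> //= n IHn e; rewrite IHn mulSn.
- exact: computable_const.
- by apply: (computable_comp2 computable_add); apply: var3.
Qed.

Lemma computable_pow2 : computable1 (expn 2).
Proof.
suff : computable2 (fun n e => 2 ^ n) by move/computable2_diag.
apply: (@computable_rec_eq (fun e => 1) (fun j acc e => acc + acc)).
- by elim=> // n IHn e; rewrite [LHS]/= (IHn e) expnS mul2n addnn.
- exact: computable_const.
- by apply: (computable_comp2 computable_add); apply: var3.
Qed.

Lemma computable_half : computable1 half.
Proof.
suff : computable2 (fun n e => n./2) by move/computable2_diag.
apply: (@computable_rec_eq (fun e => 0) (fun j acc e => j - acc)).
- by elim=> //= n IHn e; rewrite (IHn e) uphalf_half -{1}(odd_double_half n) -addnn addnA addnK.
- exact: computable_const.
- apply: (computable_comp2 computable_sub); first exact: (var3 ord0).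
  exact: (var3 (lift ord0 ord0)).
Qed.

(** Lists are the codes of [CodeSeq], whose first element is a 2-adic valuation. *)
Definition cons_code a b := 2 ^ a * b.*2.+1.

(** The arithmetic form of [if odd s then s else s./2], [s - s./2.*2] being the
    parity of [s].  Iterated, it removes the factors [2]. *)
Definition strip s := (s - s./2.*2) * s + (1 - (s - s./2.*2)) * s./2.

(** Counts the iterations of [strip] after which the number is still even. *)
Definition hd n := nrec 0 (fun j acc => acc + (1 - (iter j strip n - (iter j strip n)./2.*2))) n.

Definition tl n := (iter n strip n)./2.

Lemma iter_strip a b j : iter j strip (cons_code a b) = cons_code (a - j) b.
Proof.
elim: j => [|j IHj] /=; first by rewrite subn0.
have sub_odd s : s - s./2.*2 = odd s by rewrite -{1}(odd_double_half s) addnK.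
rewrite IHj /strip sub_odd; case: (ltnP j a) => [lt_ja|le_aj].
  rewrite /cons_code -(subnSK lt_ja).
  by rewrite expnS -mulnA mul2n odd_double doubleK !mul0n subn0 mul1n.
have /eqP-> : a - j == 0 by rewrite subn_eq0.
have /eqP-> : a - j.+1 == 0 by rewrite subn_eq0 leqW.
by rewrite /cons_code mul1n /= odd_double mul1n subnn mul0n addn0.
Qed.

Lemma leq_cons_code a b : a < cons_code a b.
Proof. by apply: leq_trans (ltn_expl a (leqnn 2)) _; rewrite leq_pmulr. Qed.

Lemma tl_cons a b : tl (cons_code a b) = b.
Proof.
have /eqP le_a : a - cons_code a b == 0 by rewrite subn_eq0 ltnW ?leq_cons_code.
rewrite /tl iter_strip le_a.
by rewrite /cons_code mul1n /= uphalf_double.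
Qed.

Lemma hd_cons a b : hd (cons_code a b) = a.
Proof.
have sub_odd s : s - s./2.*2 = odd s by rewrite -{1}(odd_double_half s) addnK.
rewrite /hd; set m := cons_code a b.
have defm j : odd (iter j strip m) = (a <= j).
  by rewrite /m iter_strip /cons_code oddM oddX /= odd_double /= andbT orbF subn_eq0.
suff -> n : nrec 0
    (fun j acc => acc + (1 - (iter j strip m - (iter j strip m)./2.*2))) n = minn a n.
  by apply/minn_idPl/ltnW/leq_cons_code.
elim: n => [|n /= ->]; first by rewrite minn0.
rewrite sub_odd defm; case: (leqP a n) => [le_an|lt_na].
  by rewrite addn0; apply/esym/minn_idPl/leqW.
by rewrite addn1; apply/esym/minn_idPr.
Qed.

Lemma decode_cons a b : CodeSeq.decode (cons_code a b) = a :: CodeSeq.decode b.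
Proof.
rewrite -{1}(CodeSeq.decodeK b) /cons_code.
by rewrite -[2 ^ _ * _]/(CodeSeq.code (a :: CodeSeq.decode b)) CodeSeq.codeK.
Qed.

Lemma decode_hd_tl n : n != 0 -> CodeSeq.decode n = hd n :: CodeSeq.decode (tl n).
Proof.
move=> nz_n; have := CodeSeq.decodeK n; case: (CodeSeq.decode n) => [|a s] /= defn.
  by rewrite -defn in nz_n.
by rewrite -defn -/(cons_code a (CodeSeq.code s)) hd_cons tl_cons CodeSeq.codeK.
Qed.

Lemma computable_cons : computable2 cons_code.
Proof.
apply: (computable_comp2 computable_mul).
  by apply: (computable_comp1 computable_pow2); apply: computable_proj.
apply: computable_ext (_ : computable (fun v : 2.-tuple nat =>
  (tnth v (lift ord0 ord0) + tnth v (lift ord0 ord0)).+1)).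
  by move=> v; rewrite addnn.
by apply: computable_succ; apply: (computable_comp2 computable_add); apply: computable_proj.
Qed.

Let computable_oddn k (A : k.-tuple nat -> nat) :
  computable A -> computable (fun v => A v - (A v)./2.*2).
Proof.
move=> cA; apply: computable_ext (_ : computable (fun v => A v - ((A v)./2 + (A v)./2))).
  by move=> v; rewrite addnn.
have cH := computable_comp1 computable_half cA.
by do 2?[apply: computable_comp2 => //; try exact: computable_sub; try exact: computable_add].
Qed.

Lemma computable_strip : computable1 strip.
Proof.
have cs := computable_oddn id1.
apply: (computable_comp2 computable_add); apply: (computable_comp2 computable_mul) => //.
- by apply: (computable_comp2 computable_sub) => //; apply: computable_const.
- exact: computable_half.
Qed.

Lemma computable_iter_strip : computable2 (fun n e => iter n strip e).
Proof.
apply: (@computable_rec_eq (fun e => e) (fun j acc e => strip acc)) => //.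
  by elim=> //= n IHn e; rewrite IHn.
by apply: (computable_comp1 computable_strip); apply: var3.
Qed.

Lemma computable_hd : computable1 hd.
Proof.
pose g j acc e := acc + (1 - (iter j strip e - (iter j strip e)./2.*2)).
apply: (@computable2_diag (fun n e => nrec 0 (fun j acc => g j acc e) n)).
apply: (computable_rec (x := fun=> 0)); first exact: computable_const.
apply: (computable_comp2 computable_add); first exact: (var3 (lift ord0 ord0)).
apply: (computable_comp2 computable_sub); first exact: computable_const.
apply: computable_oddn; apply: (computable_comp2 computable_iter_strip); first exact: (var3 ord0).
exact: var3.
Qed.

Lemma computable_tl : computable1 tl.
Proof. exact: (computable_comp1 computable_half (computable2_diag computable_iter_strip)). Qed.

End Computable.

(** * Closure properties of unary computable functions *)

(** The single argument serves as an environment, a coded list of variables. *)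
Section Closure.
Local Open Scope nat_scope.
Implicit Types A B C : nat -> nat.

Lemma cf_id : computable1 (fun e => e).
Proof. exact: computable_proj. Qed.

Lemma cf_const c : computable1 (fun _ => c).
Proof. exact: computable_const. Qed.

Lemma cf_comp F A : computable1 F -> computable1 A -> computable1 (fun e => F (A e)).
Proof. exact: computable_comp1. Qed.

Lemma cf_comp2 F A B : computable2 F -> computable1 A -> computable1 B ->
  computable1 (fun e => F (A e) (B e)).
Proof. exact: computable_comp2. Qed.

Lemma cf_succ A : computable1 A -> computable1 (fun e => (A e).+1).
Proof. exact: computable_succ. Qed.

Lemma cf_add A B : computable1 A -> computable1 B -> computable1 (fun e => A e + B e).
Proof. exact: cf_comp2 computable_add. Qed.

Lemma cf_sub A B : computable1 A -> computable1 B -> computable1 (fun e => A e - B e).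
Proof. exact: cf_comp2 computable_sub. Qed.

Lemma cf_mul A B : computable1 A -> computable1 B -> computable1 (fun e => A e * B e).
Proof. exact: cf_comp2 computable_mul. Qed.

Lemma cf_pred A : computable1 A -> computable1 (fun e => (A e).-1).
Proof. exact: cf_comp computable_pred. Qed.

Lemma cf_pow2 A : computable1 A -> computable1 (fun e => 2 ^ A e).
Proof. exact: (@cf_comp (expn 2)) computable_pow2. Qed.

Lemma cf_cons A B : computable1 A -> computable1 B -> computable1 (fun e => cons_code (A e) (B e)).
Proof. exact: cf_comp2 computable_cons. Qed.

Lemma cf_hd A : computable1 A -> computable1 (fun e => hd (A e)).
Proof. exact: cf_comp computable_hd. Qed.

Lemma cf_tl A : computable1 A -> computable1 (fun e => tl (A e)).
Proof. exact: cf_comp computable_tl. Qed.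

(** The index and the accumulator are pushed onto the environment. *)
Lemma cf_rec A (G : nat -> nat -> nat -> nat) N : computable1 A -> computable1 N ->
  computable1 (fun z => G (hd z) (hd (tl z)) (tl (tl z))) ->
  computable1 (fun e => nrec (A e) (fun j acc => G j acc e) (N e)).
Proof.
move=> cA cN cG; pose H z := G (hd z) (hd (tl z)) (tl (tl z)).
have cg : computable (fun v : 3.-tuple nat => H (cons_code (thead v)
    (cons_code (tnth v (lift ord0 ord0)) (tnth v (lift ord0 (lift ord0 ord0)))))).
  apply: (computable_comp1 cG); apply: (computable_comp2 computable_cons).
    exact: (computable_proj ord0).
  by apply: (computable_comp2 computable_cons); apply: computable_proj.
have cR := computable_rec cA
  (cg : computable (fun v : 3.-tuple nat => (fun j acc e => H (cons_code j (cons_code acc e)))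
     (thead v) (tnth v (lift ord0 ord0)) (tnth v (lift ord0 (lift ord0 ord0))))).
apply: computable_ext (cf_comp2 cR cN cf_id) => v /=.
by apply: eq_nrec => j acc; rewrite /H !(hd_cons, tl_cons).
Qed.

Lemma cf_if (P : nat -> bool) A B : computable1 (fun e => P e) -> computable1 A ->
  computable1 B -> computable1 (fun e => if P e then A e else B e).
Proof.
move=> cP cA cB.
have c := cf_add (cf_mul cP cA) (cf_mul (cf_sub (cf_const 1) cP) cB).
apply: computable_ext c => v.
by case: (P _); rewrite ?mul1n ?mul0n ?addn0.
Qed.

Lemma cf_leq A B : computable1 A -> computable1 B -> computable1 (fun e => A e <= B e).
Proof.
move=> cA cB; apply: computable_ext (cf_sub (cf_const 1) (cf_sub cA cB)) => v.
by rewrite -subn_eq0; case: (A _ - B _).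
Qed.

Lemma cf_and (P Q : nat -> bool) : computable1 (fun e => P e) -> computable1 (fun e => Q e) ->
  computable1 (fun e => P e && Q e).
Proof.
by move=> cP cQ; apply: computable_ext (cf_mul cP cQ) => v; case: (P _); case: (Q _).
Qed.

Lemma cf_neg (P : nat -> bool) : computable1 (fun e => P e) -> computable1 (fun e => ~~ P e).
Proof.
by move=> cP; apply: computable_ext (cf_sub (cf_const 1) cP) => v; case: (P _).
Qed.

Lemma cf_or (P Q : nat -> bool) : computable1 (fun e => P e) -> computable1 (fun e => Q e) ->
  computable1 (fun e => P e || Q e).
Proof.
move=> cP cQ; apply: computable_ext (cf_neg (cf_and (cf_neg cP) (cf_neg cQ))) => v.
by rewrite negb_and !negbK.
Qed.

Lemma cf_eq A B : computable1 A -> computable1 B -> computable1 (fun e => A e == B e).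
Proof.
move=> cA cB; apply: computable_ext (cf_and (cf_leq cA cB) (cf_leq cB cA)) => v.
by rewrite eqn_leq.
Qed.

Lemma cf_all (P : nat -> nat -> bool) N : computable1 N ->
  computable1 (fun z => P (hd z) (tl z)) ->
  computable1 (fun e => all (fun i => P i e) (iota 0 (N e))).
Proof.
move=> cN cP.
have cG : computable1 (fun z => hd (tl z) * P (hd z) (tl (tl z))).
  apply: cf_mul; first exact: (cf_hd (cf_tl cf_id)).
  apply: computable_ext (cf_comp cP (cf_cons (cf_hd cf_id) (cf_tl (cf_tl cf_id)))) => v.
  by rewrite hd_cons tl_cons.
apply: computable_ext (@cf_rec _ (fun j acc e => acc * P j e) _ (cf_const 1) cN cG) => v.
elim: (N _) => // n IHn; rewrite [LHS]/= IHn -addn1 iotaD all_cat /= andbT add0n.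
by rewrite mulnb.
Qed.

Lemma cf_has (P : nat -> nat -> bool) N : computable1 N ->
  computable1 (fun z => P (hd z) (tl z)) ->
  computable1 (fun e => has (fun i => P i e) (iota 0 (N e))).
Proof.
move=> cN cP; apply: computable_ext (cf_neg (@cf_all (fun i e => ~~ P i e) N cN (cf_neg cP))) => v.
congr (nat_of_bool _); apply: negbLR; exact: (all_predC (fun i => P i (thead v))).
Qed.

Lemma cf_fact A : computable1 A -> computable1 (fun e => (A e)`!).
Proof.
move=> cA.
have cG : computable1 (fun z => (hd z).+1 * hd (tl z)).
  by apply: cf_mul; [apply/cf_succ/cf_hd/cf_id | apply/cf_hd/cf_tl/cf_id].
apply: computable_ext (@cf_rec _ (fun j acc e => j.+1 * acc) _ (cf_const 1) cA cG) => v.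
by elim: (A _) => // n IHn; rewrite [LHS]/= IHn factS.
Qed.

(** The quotient is counted as the number of multiples of [B] up to [A]; no test
    succeeds for [B = 0], in accordance with [divn0]. *)
Lemma cf_div A B : computable1 A -> computable1 B -> computable1 (fun e => A e %/ B e).
Proof.
move=> cA cB.
pose g j acc e := acc + ((0 < B e) && (j.+1 * B e <= A e)).
have cG : computable1 (fun z => g (hd z) (hd (tl z)) (tl (tl z))).
  have c2 := cf_tl (cf_tl cf_id); apply: cf_add; first exact: cf_hd (cf_tl cf_id).
  apply: cf_and; apply: cf_leq; first exact: cf_const.
  - exact: cf_comp cB c2.
  - by apply: cf_mul (cf_comp cB c2); apply/cf_succ/cf_hd/cf_id.
  - exact: cf_comp cA c2.
apply: computable_ext (@cf_rec _ g _ (cf_const 0) cA cG) => v.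
move: (thead v) => e; rewrite /g.
suff E n : nrec 0 (fun j acc => acc + ((0 < B e) && (j.+1 * B e <= A e))) n = minn n (A e %/ B e).
  by rewrite E; apply/minn_idPr/leq_div.
have [B0|B_gt0] := posnP (B e).
  by rewrite B0 divn0 minn0; elim: n => //= n ->.
elim: n => [|n /= ->]; first by rewrite min0n.
by rewrite -leq_divRL //; case: (leqP n.+1 (A e %/ B e)); lia.
Qed.

Lemma cf_mod A B : computable1 A -> computable1 B -> computable1 (fun e => A e %% B e).
Proof.
move=> cA cB; apply: computable_ext (cf_sub cA (cf_mul (cf_div cA cB) cB)) => v.
by rewrite {1}(divn_eq (A (thead v)) (B (thead v))) addKn.
Qed.

Lemma iter_tl i x : item x i = hd (iter i tl x).
Proof.
rewrite /item; elim: i x => [|i IHi] x.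
  by have [->|nz_x] := eqVneq x 0 => //=; rewrite decode_hd_tl.
rewrite iterSr -IHi; have [->|nz_x] := eqVneq x 0; first by rewrite /= nth_nil.
by rewrite (decode_hd_tl nz_x).
Qed.

Lemma cf_item A B : computable1 A -> computable1 B -> computable1 (fun e => item (A e) (B e)).
Proof.
move=> cA cB.
have cG : computable1 (fun z => tl (hd (tl z))) by apply/cf_tl/cf_hd/cf_tl/cf_id.
apply: computable_ext (cf_hd (@cf_rec _ (fun j acc e => tl acc) _ cA cB cG)) => v.
by rewrite iter_tl; congr hd; elim: (B _) => //= n ->.
Qed.

Definition sizec x := size (CodeSeq.decode x).

Lemma iter_tl_eq0 i x : (iter i tl x == 0) = (sizec x <= i).
Proof.
rewrite /sizec; elim: i x => [|i IHi] x.
  rewrite leqn0 size_eq0 /=; have [->|nz_x] := eqVneq x 0; first by [].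
  by rewrite decode_hd_tl.
rewrite iterSr IHi; have [->|nz_x] := eqVneq x 0; first by [].
by rewrite (decode_hd_tl nz_x).
Qed.

Lemma sizec_leq x : sizec x <= x.
Proof.
rewrite /sizec -{2}(CodeSeq.decodeK x); elim: (CodeSeq.decode x) => //= a s IHs.
by apply: leq_ltn_trans IHs _; rewrite -muln2; have := expn_gt0 2 a; nia.
Qed.

Lemma cf_size A : computable1 A -> computable1 (fun e => sizec (A e)).
Proof.
move=> cA; pose g j acc e := acc + ~~ (iter j tl (A e) == 0).
have ctl : computable1 (fun z => tl (hd (tl z))) by apply/cf_tl/cf_hd/cf_tl/cf_id.
have cit : computable1 (fun z => iter (hd z) tl (A (tl (tl z)))).
  apply: computable_ext (@cf_rec _ (fun j acc e => tl acc) _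
    (cf_comp cA (cf_tl (cf_tl cf_id))) (cf_hd cf_id) ctl) => v.
  by elim: (hd _) => //= n ->.
have cG : computable1 (fun z => g (hd z) (hd (tl z)) (tl (tl z))).
  apply: cf_add; first exact: cf_hd (cf_tl cf_id).
  by apply/cf_neg/cf_eq; last exact: cf_const.
apply: computable_ext (@cf_rec _ g _ (cf_const 0) cA cG) => v.
move: (thead v) => e; rewrite /g.
suff E n : nrec 0 (fun j acc => acc + ~~ (iter j tl (A e) == 0)) n = minn n (sizec (A e)).
  by rewrite E; apply/minn_idPr/sizec_leq.
elim: n => [|n /= ->]; first by rewrite min0n.
by rewrite iter_tl_eq0; case: (leqP (sizec (A e)) n); lia.
Qed.

Lemma cf_code (l : seq nat) (F : nat -> nat -> nat) : (forall i, computable1 (F i)) ->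
  computable1 (fun e => CodeSeq.code [seq F i e | i <- l]).
Proof.
move=> cF; elim: l => [|i l IHl]; first exact: cf_const.
by apply: computable_ext (cf_cons (cF i) IHl) => v.
Qed.

End Closure.

(* Dispatch on the syntactic shape, which avoids unification up to unfolding. *)
Ltac computability_step :=
  cbn beta;
  lazymatch goal with
  | |- computable1 (fun _ => ?c) => exact (cf_const c)
  | |- computable1 (fun e => e) => exact cf_id
  | |- computable1 hd => exact computable_hd
  | |- computable1 tl => exact computable_tl
  | |- computable1 (fun e => hd (@?A e)) => apply (@cf_hd A)
  | |- computable1 (fun e => tl (@?A e)) => apply (@cf_tl A)
  | |- computable1 (fun e => item (@?A e) (@?B e)) => apply (@cf_item A B)
  | |- computable1 (fun e => sizec (@?A e)) => apply (@cf_size A)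
  | |- computable1 (fun e => cons_code (@?A e) (@?B e)) => apply (@cf_cons A B)
  | |- computable1 (fun e => S (@?A e)) => apply (@cf_succ A)
  | |- computable1 (fun e => predn (@?A e)) => apply (@cf_pred A)
  | |- computable1 (fun e => addn (@?A e) (@?B e)) => apply (@cf_add A B)
  | |- computable1 (fun e => subn (@?A e) (@?B e)) => apply (@cf_sub A B)
  | |- computable1 (fun e => muln (@?A e) (@?B e)) => apply (@cf_mul A B)
  | |- computable1 (fun e => expn 2 (@?A e)) => apply (@cf_pow2 A)
  | |- computable1 (fun e => divn (@?A e) (@?B e)) => apply (@cf_div A B)
  | |- computable1 (fun e => modn (@?A e) (@?B e)) => apply (@cf_mod A B)
  | |- computable1 (fun e => factorial (@?A e)) => apply (@cf_fact A)
  | |- computable1 (fun e => nat_of_bool (andb (@?A e) (@?B e))) => apply (@cf_and A B)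
  | |- computable1 (fun e => nat_of_bool (orb (@?A e) (@?B e))) => apply (@cf_or A B)
  | |- computable1 (fun e => nat_of_bool (negb (@?A e))) => apply (@cf_neg A)
  | |- computable1 (fun e => nat_of_bool (leq (@?A e) (@?B e))) => apply (@cf_leq A B)
  | |- computable1 (fun e => nat_of_bool (@?A e == @?B e)) => apply (@cf_eq A B)
  | |- computable1 (fun e => nat_of_bool (all (fun i => @?P i e) (iota 0 (@?N e)))) =>
      apply (@cf_all (fun i e => P i e) N)
  | |- computable1 (fun e => nat_of_bool (has (fun i => @?P i e) (iota 0 (@?N e)))) =>
      apply (@cf_has (fun i e => P i e) N)
  | H : computable1 ?A |- computable1 (fun e => ?A (@?B e)) => apply (@cf_comp A B H)
  end.

Ltac computability := repeat (first [assumption | computability_step]).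

(** * Arithmetic of the number field on codes *)

Lemma item_code l i : item (CodeSeq.code l) i = nth 0%N l i.
Proof. by rewrite /item CodeSeq.codeK. Qed.

Lemma item0 i : item 0 i = 0%N.
Proof. by rewrite /item nth_nil. Qed.

Definition triple a b c := cons_code a (cons_code b (cons_code c 0)).

Definition addQ x y := triple
      (item x 0 * (item y 2).+1 + item y 0 * (item x 2).+1)%N
      (item x 1 * (item y 2).+1 + item y 1 * (item x 2).+1)%N
      (item x 2 * item y 2 + item x 2 + item y 2)%N.

Definition mulQ x y := triple
      (item x 0 * item y 0 + item x 1 * item y 1)%N
      (item x 0 * item y 1 + item x 1 * item y 0)%N
      (item x 2 * item y 2 + item x 2 + item y 2)%N.

Definition oppQ x := triple (item x 1) (item x 0) (item x 2).

Lemma rat_of_code_list a b c :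
  rat_of_code (triple a b c) = (a%:R - b%:R) / c.+1%:R.
Proof.
by rewrite /rat_of_code -[triple a b c]/(CodeSeq.code [:: a; b; c]) !item_code.
Qed.

Lemma common_denominator m n : (m * n + m + n).+1 = (m.+1 * n.+1)%N.
Proof. lia. Qed.

Lemma rat_of_code_add x y : rat_of_code (addQ x y) = rat_of_code x + rat_of_code y.
Proof.
rewrite rat_of_code_list /rat_of_code.
rewrite common_denominator !natrD !natrM addf_div ?pnatr_eq0 //.
by congr (_ / _); ring.
Qed.

Lemma rat_of_code_mul x y : rat_of_code (mulQ x y) = rat_of_code x * rat_of_code y.
Proof.
rewrite rat_of_code_list /rat_of_code.
rewrite common_denominator !natrD !natrM mulf_div.
by congr (_ / _); ring.
Qed.

Lemma rat_of_code_opp x : rat_of_code (oppQ x) = - rat_of_code x.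
Proof. by rewrite rat_of_code_list -mulNr opprB. Qed.

Lemma rat_of_code0 : rat_of_code 0 = 0.
Proof. by rewrite /rat_of_code !item0 subrr mul0r. Qed.

Lemma rat_of_code_eq0 x : (rat_of_code x == 0) = (item x 0 == item x 1).
Proof. by rewrite mulf_eq0 invr_eq0 pnatr_eq0 orbF subr_eq0 eqr_nat. Qed.

Definition code_of_rat (a : rat) :=
  triple (if 0 <= numq a then `|numq a|%N else 0%N)
         (if 0 <= numq a then 0%N else `|numq a|%N) `|denq a|.-1%N.

Lemma code_of_ratK a : rat_of_code (code_of_rat a) = a.
Proof.
rewrite rat_of_code_list prednK ?absz_denq_gt0 ?absz_gt0 ?denq_neq0 //.
have -> : (`|denq a|%N)%:R = (denq a)%:~R :> rat.
  by rewrite -[RHS](_ : (`|denq a|%N%:Z)%:~R = _) // gez0_abs ?denq_ge0.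
rewrite -[RHS](divq_num_den a); congr (_ / _).
case: ifP => [ge0|/negbT]; rewrite ?subr0 ?sub0r.
  by rewrite -[LHS]/((`|numq a|%N%:Z)%:~R) gez0_abs.
rewrite -ltNge => lt0.
by rewrite -[X in - X]/((`|numq a|%N%:Z)%:~R) ltz0_abs // mulrNz opprK.
Qed.

Lemma cf_addQ A B : computable1 A -> computable1 B -> computable1 (fun e => addQ (A e) (B e)).
Proof. by move=> cA cB; rewrite /addQ /triple; computability. Qed.

Lemma cf_mulQ A B : computable1 A -> computable1 B -> computable1 (fun e => mulQ (A e) (B e)).
Proof. by move=> cA cB; rewrite /mulQ /triple; computability. Qed.

Lemma cf_oppQ A : computable1 A -> computable1 (fun e => oppQ (A e)).
Proof. by move=> cA; rewrite /oppQ /triple; computability. Qed.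

Section FieldCodes.
Variable K : fieldExtType rat.
Local Notation s := (\dim {:K}).
Local Notation E := (@elt_of_code K).
Local Notation b := (vbasis {:K}).

Definition addK x y := CodeSeq.code [seq addQ (item x i) (item y i) | i <- iota 0 s].
Definition oppK x := CodeSeq.code [seq oppQ (item x i) | i <- iota 0 s].
Definition zeroK x := all (fun i => item (item x i) 0 == item (item x i) 1) (iota 0 s).

(** Finitely many rationals determine the multiplication of [K]; the program
    contains their codes as constants. *)
Definition structure_constant (i j k : nat) : nat :=
  if insub k is Some k' then code_of_rat (coordK k' (b`_i * b`_j)) else 0%N.

Definition index_pairs := [seq (i, j) | i <- iota 0 s, j <- iota 0 s].

Definition mulK x y := CodeSeq.code
  [seq foldr (fun ij acc => addQ (mulQ (mulQ (item x ij.1) (item y ij.2))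
                                       (structure_constant ij.1 ij.2 k)) acc) 0%N index_pairs
  | k <- iota 0 s].

Definition code_of_elt (z : K) := CodeSeq.code
  [seq code_of_rat (coordK i z) | i <- enum 'I_s].

Definition sumK n F := nrec 0 (fun i acc => addK (F i) acc) n.

Lemma elt_of_codeE F :
  E (CodeSeq.code [seq F i | i <- iota 0 s]) = \sum_(i < s) rat_of_code (F i) *: b`_i.
Proof.
apply: eq_bigr => i _; rewrite item_code (nth_map 0%N) ?size_iota ?ltn_ord //.
by rewrite nth_iota ?ltn_ord.
Qed.

Lemma elt_of_code0 : E 0 = 0.
Proof. by apply: big1 => i _; rewrite item0 rat_of_code0 scale0r. Qed.

Lemma elt_of_code_add x y : E (addK x y) = E x + E y.
Proof.
rewrite elt_of_codeE -big_split; apply: eq_bigr => i _.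
by rewrite rat_of_code_add scalerDl.
Qed.

Lemma elt_of_code_opp x : E (oppK x) = - E x.
Proof.
rewrite elt_of_codeE -sumrN; apply: eq_bigr => i _.
by rewrite rat_of_code_opp scaleNr.
Qed.

Lemma elt_of_code_mul x y : E (mulK x y) = E x * E y.
Proof.
rewrite elt_of_codeE {1 2}/elt_of_code mulr_suml.
under [RHS]eq_bigr => i _.
  rewrite mulr_sumr; under eq_bigr => j _.
    rewrite -scalerAl -scalerAr scalerA (coord_vbasis (memvf (b`_i * b`_j))) scaler_sumr.
    under eq_bigr => k _ do rewrite scalerA.
    over.
  over.
transitivity (\sum_(k < s) (\sum_(i < s) \sum_(j < s)
    rat_of_code (item x i) * rat_of_code (item y j) * coordK k (b`_i * b`_j)) *: b`_k).
  apply: eq_bigr => k _; congr (_ *: _).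
  transitivity (\sum_(ij <- index_pairs) rat_of_code (item x ij.1) *
      rat_of_code (item y ij.2) * rat_of_code (structure_constant ij.1 ij.2 k)).
    elim: index_pairs => [|ij l IHl]; first by rewrite big_nil rat_of_code0.
    by rewrite big_cons [foldr _ _ _]/= rat_of_code_add IHl !rat_of_code_mul.
  have iotaE G : \sum_(i <- iota 0 s) G i = \sum_(i < s) G i :> rat.
    by rewrite -(big_mkord xpredT G) /index_iota subn0.
  rewrite big_allpairs iotaE; apply: eq_bigr => i _; rewrite iotaE.
  by apply: eq_bigr => j _; rewrite /structure_constant valK code_of_ratK.
under [LHS]eq_bigr => k _ do rewrite scaler_suml.
rewrite exchange_big; apply: eq_bigr => i _.
rewrite [RHS]exchange_big; apply: eq_bigr => k _.
by rewrite scaler_suml.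
Qed.

Lemma zeroKP x : zeroK x = (E x == 0).
Proof.
apply/allP/eqP => [x0|Ex0 i].
  apply: big1 => i _; apply/eqP; rewrite scaler_eq0 rat_of_code_eq0 x0 //.
  by rewrite mem_iota ltn_ord.
rewrite mem_iota add0n /= => lt_is; rewrite -rat_of_code_eq0.
have /freeP/(_ (fun i : 'I_s => rat_of_code (item x i))) := basis_free (vbasisP {:K}).
by move=> /(_ Ex0 (Ordinal lt_is)) /= ->.
Qed.

Lemma code_of_eltK z : E (code_of_elt z) = z.
Proof.
rewrite [RHS](coord_vbasis (memvf z)); apply: eq_bigr => i _.
rewrite item_code (nth_map i) ?size_enum_ord ?ltn_ord // nth_ord_enum.
by rewrite code_of_ratK.
Qed.

Lemma elt_of_code_sum n F : E (sumK n F) = \sum_(i < n) E (F i).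
Proof.
elim: n => [|n IHn]; first by rewrite big_ord0 elt_of_code0.
by rewrite [sumK _ _]/= elt_of_code_add -/(sumK n F) IHn big_ord_recr addrC.
Qed.

Lemma cf_addK A B : computable1 A -> computable1 B -> computable1 (fun e => addK (A e) (B e)).
Proof.
move=> cA cB; apply: (@cf_code _ (fun i e => addQ (item (A e) i) (item (B e) i))) => i.
by apply: cf_addQ; computability.
Qed.

Lemma cf_oppK A : computable1 A -> computable1 (fun e => oppK (A e)).
Proof.
move=> cA; apply: (@cf_code _ (fun i e => oppQ (item (A e) i))) => i.
by apply: cf_oppQ; computability.
Qed.

Lemma cf_mulK A B : computable1 A -> computable1 B -> computable1 (fun e => mulK (A e) (B e)).
Proof.
move=> cA cB; apply: (@cf_code _ (fun k e => foldr (fun ij acc =>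
  addQ (mulQ (mulQ (item (A e) ij.1) (item (B e) ij.2))
             (structure_constant ij.1 ij.2 k)) acc) 0%N index_pairs)) => k.
elim: index_pairs => [|ij l IHl]; first exact: cf_const.
apply: cf_addQ IHl; apply: cf_mulQ; last exact: cf_const.
by apply: cf_mulQ; computability.
Qed.

Lemma cf_zeroK A : computable1 A -> computable1 (fun e => zeroK (A e)).
Proof.
by move=> cA; apply: (@cf_all (fun i e => item (item (A e) i) 0 == item (item (A e) i) 1)
  (fun _ => s)); computability.
Qed.

Lemma cf_sumK N (F : nat -> nat -> nat) : computable1 N ->
  computable1 (fun z => F (hd z) (tl z)) ->
  computable1 (fun e => sumK (N e) (fun i => F i e)).
Proof.
move=> cN cF; apply: (@cf_rec _ (fun i acc e => addK (F i e) acc)) => //; first exact: cf_const.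
apply: cf_addK; last by computability.
have c := cf_comp cF (cf_cons (cf_hd cf_id) (cf_tl (cf_tl cf_id))).
by apply: computable_ext c => v; rewrite hd_cons tl_cons.
Qed.

(** * Evaluating named C-finite sequences *)

(** A name is evaluated by recursion on the list of all values so far, most recent
    first; the [i]-th of the last [t] values is at position [t.-1 - i]. *)
Definition next_value x j acc :=
  if (j < sizec (item x 0))%N then item (item x 1) j
  else oppK (sumK (sizec (item x 0)) (fun i =>
    mulK (item (item x 0) i) (item acc ((sizec (item x 0)).-1 - i)))).

Definition history x n := nrec 0 (fun j acc => cons_code (next_value x j acc) acc) n.

Definition value x n := hd (history x n.+1).

Definition seq_of x n : K := E (value x n).

Definition order_of x := sizec (item x 0).

Lemma history_item x n l : (l < n)%N -> item (history x n) l = value x (n.-1 - l).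
Proof.
elim: n l => // n IHn [|l] lt_l.
  by rewrite subn0 iter_tl.
rewrite iter_tl iterSr [history x n.+1]/= tl_cons -iter_tl IHn //.
by congr (value x _); lia.
Qed.

Lemma valueE x n : value x n = next_value x n (history x n).
Proof. by rewrite /value /= hd_cons. Qed.

Lemma seq_of_init x n : (n < order_of x)%N -> seq_of x n = E (item (item x 1) n).
Proof. by move=> lt_n; rewrite /seq_of valueE /next_value lt_n. Qed.

Lemma seq_of_rec x n : seq_of x (n + order_of x) =
  - \sum_(i < order_of x) E (item (item x 0) i) * seq_of x (n + i)%N.
Proof.
rewrite /seq_of valueE /next_value -/(order_of x) ltnNge leq_addl /=.
rewrite elt_of_code_opp elt_of_code_sum.
congr (- _); apply: eq_bigr => i _; rewrite elt_of_code_mul; congr (_ * E _).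
have lt_i := ltn_ord i; move: (order_of x) (nat_of_ord i) lt_i => t k lt_kt.
by rewrite history_item; [congr (value x _) |]; lia.
Qed.

Lemma elts_of_code_nth x i : (elts_of_code K x)`_i = E (item x i).
Proof.
rewrite /elts_of_code /item; case: (ltnP i (size (CodeSeq.decode x))) => lt_i.
  by rewrite (nth_map 0%N).
by rewrite !nth_default ?size_map ?elt_of_code0.
Qed.

Lemma Cfinite_code_seq_of x : sizec (item x 1) = sizec (item x 0) ->
  Cfinite_code x (seq_of x).
Proof.
move=> eq_sz; split; first by rewrite !size_map.
  by move=> i; rewrite size_map => lt_i; rewrite seq_of_init // elts_of_code_nth.
move=> n; rewrite size_map -/(sizec _) -/(order_of x) seq_of_rec.
under eq_bigr => i _ do rewrite elts_of_code_nth.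
exact: subrr.
Qed.

Lemma Cfinite_code_eq x c : Cfinite_code x c -> c =1 seq_of x.
Proof.
move=> [_ c_init c_rec] n; elim/ltn_ind: n => n IHn.
move: c_init c_rec; rewrite size_map -/(sizec _) -/(order_of x) => c_init c_rec.
case: (ltnP n (order_of x)) => [lt_n|le_n].
  by rewrite c_init // elts_of_code_nth seq_of_init.
have e1 := c_rec (n - order_of x)%N; have e2 := seq_of_rec x (n - order_of x)%N.
rewrite (subnK le_n) in e1 e2; move/eqP: e1; rewrite addrC addr_eq0 e2 => /eqP ->.
congr (- _); apply: eq_bigr => i _.
rewrite elts_of_code_nth IHn //.
by move: (nat_of_ord i) (ltn_ord i) le_n; move: (order_of x) => t k; lia.
Qed.

Lemma seq_of_out x i : (sizec x <= i)%N -> seq_of (item x i) =1 (fun _ => 0).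
Proof.
rewrite /sizec => le_i n; have -> : item x i = 0%N by rewrite /item nth_default.
have ord0 : order_of 0 = 0%N by rewrite /order_of item0.
by have := seq_of_rec 0 n; rewrite ord0 big_ord0 addn0 oppr0.
Qed.

Definition rec_poly x : {poly K} :=
  \poly_(i < (order_of x).+1) (if i == order_of x then 1 else E (item (item x 0) i)).

Lemma size_rec_poly x : size (rec_poly x) = (order_of x).+1.
Proof.
apply/eqP; rewrite eqn_leq size_poly ltnNge; apply/negP => le_sz.
have : (rec_poly x)`_(order_of x) = 1 by rewrite coef_poly ltnSn eqxx.
by rewrite nth_default // => /esym/eqP; rewrite oner_eq0.
Qed.

Lemma rec_poly_monic x : rec_poly x \is monic.
Proof. by rewrite monicE lead_coefE size_rec_poly coef_poly ltnSn eqxx. Qed.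

Lemma rec_polyP x : satisfies_rec (rec_poly x) (seq_of x).
Proof.
move=> n; rewrite size_rec_poly big_ord_recr /= coef_poly ltnSn eqxx mul1r seq_of_rec.
rewrite -[X in X - _](_ : \sum_(i < order_of x) E (item (item x 0) i) * seq_of x (n + i)%N = _).
  exact: subrr.
by apply: eq_bigr => i _; rewrite coef_poly ltnW ?ltnS // ltn_eqF.
Qed.

Lemma Cfinite_seq_of x : Cfinite (seq_of x).
Proof. by exists (rec_poly x); split; [apply/monic_neq0/rec_poly_monic | apply: rec_polyP]. Qed.

(** Names need no minimality: any monic recurrence over [K] will do. *)
Lemma Cfinite_has_code c (p : {poly K}) : p \is monic -> satisfies_rec p c ->
  exists x, Cfinite_code x c.
Proof.
move=> mon_p pc; pose t := (size p).-1.
have sz_p : size p = t.+1 by rewrite prednK // size_poly_gt0 monic_neq0.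
pose x := CodeSeq.code [:: CodeSeq.code [seq code_of_elt p`_i | i <- iota 0 t];
                           CodeSeq.code [seq code_of_elt (c i) | i <- iota 0 t]].
have nth_code (F : nat -> K) i : (i < t)%N ->
    (elts_of_code K (CodeSeq.code [seq code_of_elt (F i) | i <- iota 0 t]))`_i = F i.
  move=> lt_i; rewrite elts_of_code_nth item_code (nth_map 0%N) ?size_iota //.
  by rewrite nth_iota // code_of_eltK.
have szE (F : nat -> K) :
    size (elts_of_code K (CodeSeq.code [seq code_of_elt (F i) | i <- iota 0 t])) = t.
  by rewrite size_map CodeSeq.codeK size_map size_iota.
exists x; rewrite /Cfinite_code /x !item_code /= !szE; split=> // [i lt_i|n].
  by rewrite nth_code.
have := pc n; rewrite sz_p big_ord_recr /=.
have -> : p`_t = 1 by have /monicP := mon_p; rewrite lead_coefE sz_p.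
rewrite mul1r => pcn; rewrite -[RHS]pcn; congr (_ + _); apply: eq_bigr => i _.
by rewrite nth_code.
Qed.

Lemma cf_value A N : computable1 A -> computable1 N -> computable1 (fun e => value (A e) (N e)).
Proof.
move=> cA cN; apply: cf_hd.
apply: (@cf_rec _ (fun j acc e => cons_code (next_value (A e) j acc) acc)).
- exact: cf_const.
- exact: cf_succ.
rewrite /next_value; apply: cf_cons; last by computability.
apply: (@cf_if (fun z => (hd z < sizec (item (A (tl (tl z))) 0))%N)); [by computability..|].
apply: cf_oppK; apply: (@cf_sumK _ (fun i z => mulK (item (item (A (tl (tl z))) 0) i)
   (item (hd (tl z)) ((sizec (item (A (tl (tl z))) 0)).-1 - i)))); first by computability.
by apply: cf_mulK; computability.
Qed.

End FieldCodes.

(** * Deciding properties of C-finite sequences from finitely many values *)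

Lemma kill_nseq0 (F : fieldType) m (g : nat -> F) :
  (forall n, (m <= n)%N -> g n = 0) -> kill (nseq m 0) g.
Proof.
elim: m g => [|m IHm] g g0; first by apply: (kill_nil _).2 => n; apply: g0.
have IH := IHm (fun n => g n.+1) (fun n le_n => g0 n.+1 le_n).
by apply: (kill_cons _ _ _).2; apply: eq_kill IH => n; rewrite mul0r subr0.
Qed.

Section Orders.
Variables (K : fieldExtType rat) (iota : {rmorphism K -> algC}).
Implicit Types f g : nat -> K.

(** Bounds on orders, computed without the recurrences themselves, tell how many
    values decide whether an expression in C-finite sequences vanishes. *)
Definition order_le N f :=
  exists Z, kill Z (fun n => iota (f n)) /\ (size Z <= N)%N.

Lemma order_leW N M f : (N <= M)%N -> order_le N f -> order_le M f.
Proof. by move=> le_NM [Z [kf le_Z]]; exists Z; split=> //; apply: leq_trans le_NM. Qed.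

Lemma order_le_ext N f g : f =1 g -> order_le N f -> order_le N g.
Proof.
by move=> eqfg [Z [kf le_Z]]; exists Z; split=> //; apply: eq_kill kf => n; rewrite eqfg.
Qed.

Lemma order_le_const a : order_le 1 (fun _ => a).
Proof.
exists [:: 1]; split=> //.
by apply: (kill_cons _ _ _).2; apply: (kill_nil _).2 => n; rewrite mul1r subrr.
Qed.

Lemma order_le_shift N f k : order_le N f -> order_le N (fun n => f (n + k)%N).
Proof. by move=> [Z [kf le_Z]]; exists Z; split=> //; exact: (kill_shift k kf). Qed.

Lemma order_le_mul N M f g : order_le N f -> order_le M g ->
  order_le (2 ^ (N + M)) (fun n => f n * g n).
Proof.
move=> [Z [kf le_Z]] [W [kg le_W]].
have [U [kU lt_U _]] := @killM _ (fun _ => True) _ _ _ _ (fun _ _ _ _ => I) kf kg.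
exists U; split; first by apply: eq_kill kU => n; rewrite rmorphM.
by rewrite (leq_trans (ltnW lt_U)) // leq_exp2l // leq_add.
Qed.

Lemma order_le_sum n N (f : nat -> nat -> K) : (forall i, (i < n)%N -> order_le N (f i)) ->
  order_le (n * N) (fun m => \sum_(i < n) f i m).
Proof.
elim: n => [|n IHn] of_.
  by exists [::]; split=> //; apply: (kill_nil _).2 => m; rewrite big_ord0 rmorph0.
have [Z [kZ le_Z]] := IHn (fun i lt_i => of_ i (leqW lt_i)).
have [W [kW le_W]] := of_ n (leqnn _).
exists (Z ++ W); split; last by rewrite size_cat mulSn addnC leq_add.
by apply: eq_kill (killD kZ kW) => m; rewrite big_ord_recr rmorphD.
Qed.

Lemma order_le_window N f m : order_le N f ->
  (forall i, (i < N)%N -> f (m + i)%N = 0) -> forall n, (m <= n)%N -> f n = 0.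
Proof.
move=> [Z [kf le_Z]] f0 n le_n; apply: (fmorph_inj iota); rewrite rmorph0.
apply: (kill_window kf _ le_n) => i lt_i.
by rewrite f0 ?rmorph0 // (leq_trans lt_i).
Qed.

(** Beyond the order, the zero roots no longer contribute, so that a sequence
    vanishing from some index on vanishes from there on. *)
Lemma order_le_tail N f : order_le N f -> eventually (fun n => f n = 0) ->
  forall n, (N <= n)%N -> f n = 0.
Proof.
move=> [Z [kf le_Z]] [m f0].
have kf' := kill_drop0 kf le_Z; set Z0 := [seq _ <- _ | _] in kf'.
have co : coprimep (rootpoly Z0) (rootpoly (nseq m 0)).
  apply: coprimep_rootpoly => z; rewrite mem_filter => /andP[nz_z _].
  by apply: contra nz_z => /nseqP[->].
have km : kill (nseq m 0) (fun n => iota (f (n + N)%N)).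
  apply: kill_nseq0 => n le_n; rewrite f0 ?rmorph0 //.
  by apply: leq_trans (leq_addr _ _).
have /Bezout_eq1_coprimepP[[u v] /= uv1] := co.
move=> n le_n; apply: (fmorph_inj iota); rewrite rmorph0 -(subnK le_n).
rewrite -(act1 (fun n => iota (f (n + N)%N))) -uv1 actDl !actM.
by rewrite (act0r _ kf') (act0r _ km) addr0.
Qed.

(** A multiple of the orders of all roots of unity that are ratios of roots of a
    recurrence of order [t] over [K].  It serves as modulus in the zero tests, so
    that the torsion number need not be computed. *)
Definition ratio_exponent t := (2 * (\dim {:K} * t * t))`!.

Lemma rec_class_dichotomy (c : nat -> K) (p : {poly K}) t j :
    p \is monic -> size p = t.+1 -> satisfies_rec p c ->
  (forall n, (t <= n)%N -> c (ratio_exponent t * n + j)%N = 0) \/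
  eventually (fun n => c (ratio_exponent t * n + j)%N != 0).
Proof.
move=> mon_p sz_p pc; have [Z defZ sz_Z] := rootpoly_of iota mon_p.
have kc : kill Z (fun n => iota (c n)) by move=> n; rewrite -defZ satisfies_rec_act.
have -> : t = size Z by rewrite sz_Z sz_p.
apply: class_dichotomy => //; first exact: fact_gt0.
move=> z z' k zZ z'Z _ _; rewrite sz_Z sz_p.
by apply: (@root_ratio_order _ iota _ _ _ _ _ mon_p sz_p); rewrite defZ root_prod_XsubC.
Qed.

(** Finiteness of the zero set is decided by inspecting, along each class modulo
    the ratio exponent, as many terms as the order. *)
Lemma eventually_nonzero_test (c : nat -> K) (p : {poly K}) t :
    p \is monic -> size p = t.+1 -> satisfies_rec p c ->
  eventually (fun n => c n != 0) <->
  (forall j, (j < ratio_exponent t)%N ->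
     exists2 n, (n < t)%N & c (ratio_exponent t * (t + n) + j)%N != 0).
Proof.
move=> mon_p sz_p pc; set M := ratio_exponent t; have M_gt0 : (0 < M)%N by apply: fact_gt0.
split=> [[N nzc] j lt_jM|test].
  apply: NNPP => no_n.
  have [Z defZ sz_Z] := rootpoly_of iota mon_p.
  have kc : kill Z (fun n => iota (c n)) by move=> n; rewrite -defZ satisfies_rec_act.
  have ord : order_le t (fun n => c (M * n + j)%N).
    exists [seq z ^+ M | z <- Z]; rewrite size_map sz_Z sz_p; split=> //.
    exact: (kill_progression M j kc).
  have le_N : (N <= M * (t + N) + j)%N.
    by rewrite (leq_trans (leq_addl t N)) // (leq_trans (leq_pmull _ M_gt0)) ?leq_addr.
  have := nzc _ le_N; rewrite (order_le_window (m := t) ord) ?leq_addr ?eqxx //.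
  move=> i lt_i; apply/eqP/negPn/negP => nz; apply: no_n; by exists i.
have : eventually (fun n => forall j : 'I_M, c (M * n + j)%N != 0).
  apply: eventually_fin => j; have [n lt_n nz_n] := test j (ltn_ord j).
  have [c0|//] := rec_class_dichotomy j mon_p sz_p pc.
  by rewrite c0 ?eqxx ?leq_addr in nz_n.
move=> [N nz]; exists (M * N)%N => n le_n.
have := nz (n %/ M)%N _ (Ordinal (ltn_pmod n M_gt0)); rewrite /= mulnC -divn_eq; apply.
by rewrite leq_divRL // mulnC.
Qed.

End Orders.

Ltac field_step :=
  cbn beta;
  lazymatch goal with
  | |- computable1 (fun e => value ?K (@?A e) (@?B e)) => apply (@cf_value K A B)
  | |- computable1 (fun e => nat_of_bool (zeroK ?K (@?A e))) => apply (@cf_zeroK K A)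
  | |- computable1 (fun e => mulK ?K (@?A e) (@?B e)) => apply (@cf_mulK K A B)
  | |- computable1 (fun e => sumK ?K (@?N e) (fun i => @?F i e)) =>
      apply (@cf_sumK K N (fun i e => F i e))
  end.

(** * The search for a minimal recurrence *)

Definition computable_entry (entry : nat -> nat -> nat -> nat -> nat -> nat -> nat) :=
  forall X1 X2 D I H N, computable1 X1 -> computable1 X2 ->
  computable1 D -> computable1 I -> computable1 H -> computable1 N ->
  computable1 (fun e => entry (X1 e) (X2 e) (D e) (I e) (H e) (N e)).

Definition computable_size (size : nat -> nat -> nat -> nat) :=
  forall X1 X2 D, computable1 X1 -> computable1 X2 -> computable1 D ->
  computable1 (fun e => size (X1 e) (X2 e) (D e)).

(** The search is independent of the linear system: [entry x1 x2 D i h n] is the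
    code of the entry in row [i] and column [h], at [n], of the system for order
    [D]. *)
Section Program.
Variables (K : fieldExtType rat).
Variables (entry : nat -> nat -> nat -> nat -> nat -> nat -> nat).
Variables (extra cols : nat -> nat -> nat -> nat).
Hypotheses (cf_entry : computable_entry entry).
Hypotheses (cf_extra : computable_size extra) (cf_cols : computable_size cols).

(** Rows [0] to [D] are the targets [op a b (n + i)], the others the relators, and
    row [D] is the one that must depend on all others. *)
Definition rows x1 x2 D := (D.+1 + extra x1 x2 D)%N.

Definition multiplier y D i :=
  if (i <= D)%N then item (item y 0) i else item (item y 1) (i - D.+1).

(** [y] names the coefficients of a recurrence of order [D], with multipliers of the
    relators proving it.  Names bound orders, as a code is at least the length of
    its list, so the combination has order at most the number of values tested:
    each product of a multiplier by an entry has order at most the power of 2. *)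
Definition dependence_test x1 x2 y D :=
  all (fun n => all (fun h => zeroK K (sumK K (rows x1 x2 D) (fun i =>
        mulK K (value K (multiplier y D i) n) (entry x1 x2 D i h n))))
      (iota 0 (cols x1 x2 D)))
    (iota 0 (rows x1 x2 D * 2 ^ (y + (x1 + x2).+1))).

Definition nonzero_test c :=
  all (fun j => has (fun n => ~~ zeroK K (value K c
        ((2 * (\dim {:K} * order_of c * order_of c))`! * (order_of c + n) + j)))
      (iota 0 (order_of c)))
    (iota 0 (2 * (\dim {:K} * order_of c * order_of c))`!).

Definition shape_test y :=
  all (fun i => order_of (item (item y 0) i) == sizec (item (item (item y 0) i) 1))
    (iota 0 (sizec (item y 0))).

Definition pairing x1 x2 v D i n :=
  sumK K (cols x1 x2 D) (fun h => mulK K (entry x1 x2 D i h n) (value K (item v h) n)).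

(** [v] names a vector refuting the order [D]: it is orthogonal to the rows other
    than [D], and infinitely often not to row [D].  A C-finite sequence that
    vanishes from some index on vanishes beyond its order, hence the second test,
    on a window that starts there. *)
Definition independence_test x1 x2 v D :=
  all (fun n => all (fun i => (i == D) || zeroK K (pairing x1 x2 v D i n))
      (iota 0 (rows x1 x2 D)))
    (iota 0 (cols x1 x2 D * 2 ^ ((x1 + x2).+1 + v))) &&
  has (fun n => ~~ zeroK K (pairing x1 x2 v D D
      (cols x1 x2 D * 2 ^ ((x1 + x2).+1 + v) + n)))
    (iota 0 (cols x1 x2 D * 2 ^ ((x1 + x2).+1 + v))).

Definition order_named y := (sizec (item y 0)).-1.

(** The independence vectors for all smaller orders certify that the order is
    minimal.  So it is at most [d * R], although the program does not know the
    torsion number [d]. *)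
Definition accepts x1 x2 y :=
  [&& (0 < sizec (item y 0))%N, shape_test y, dependence_test x1 x2 y (order_named y),
      nonzero_test (item (item y 0) (order_named y))
    & all (fun D => independence_test x1 x2 (item (item y 2) D) D) (iota 0 (order_named y))].

Ltac program := repeat first
  [ assumption | computability_step | field_step
  | (cbn beta; first [apply cf_entry | apply cf_extra | apply cf_cols]) ].

Lemma cf_multiplier Y D I : computable1 Y -> computable1 D -> computable1 I ->
  computable1 (fun e => multiplier (Y e) (D e) (I e)).
Proof.
move=> cY cD cI; rewrite /multiplier.
by apply: (@cf_if (fun e => (I e <= D e)%N)); program.
Qed.

Lemma cf_dependence_test X1 X2 Y D : computable1 X1 -> computable1 X2 -> computable1 Y ->
  computable1 D -> computable1 (fun e => dependence_test (X1 e) (X2 e) (Y e) (D e)).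
Proof.
move=> c1 c2 cY cD; rewrite /dependence_test /rows; program.
by apply: cf_multiplier; program.
Qed.

Lemma cf_nonzero_test C : computable1 C -> computable1 (fun e => nonzero_test (C e)).
Proof. by move=> cC; rewrite /nonzero_test /order_of; program. Qed.

Lemma cf_shape_test Y : computable1 Y -> computable1 (fun e => shape_test (Y e)).
Proof. by move=> cY; rewrite /shape_test /order_of; program. Qed.

Lemma cf_independence_test X1 X2 V D : computable1 X1 -> computable1 X2 -> computable1 V ->
  computable1 D -> computable1 (fun e => independence_test (X1 e) (X2 e) (V e) (D e)).
Proof.
by move=> c1 c2 cV cD; rewrite /independence_test /pairing /rows; program.
Qed.

Lemma cf_accepts X1 X2 Y : computable1 X1 -> computable1 X2 -> computable1 Y ->
  computable1 (fun e => accepts (X1 e) (X2 e) (Y e)).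
Proof.
move=> c1 c2 cY; rewrite /accepts /order_named; program.
- exact: cf_shape_test.
- by apply: cf_dependence_test; program.
- by apply: cf_nonzero_test; program.
- by apply: cf_independence_test; program.
Qed.

Lemma search_program : exists f : recfun 2, forall x1 x2,
  (exists y, accepts x1 x2 y) ->
  exists2 y, accepts x1 x2 y & reval f [tuple x1; x2] (item y 0).
Proof.
have [g gP] : computable (fun v : 3.-tuple nat =>
    ~~ accepts (tnth v (lift ord0 ord0)) (tnth v (lift ord0 (lift ord0 ord0))) (thead v)).
  have c : computable1 (fun e => ~~ accepts (item e 1) (item e 2) (item e 0)).
    by apply: cf_neg; apply: cf_accepts; program.
  have cl : computable (fun v : 3.-tuple nat => cons_code (thead v)
      (cons_code (tnth v (lift ord0 ord0)) (cons_code (tnth v (lift ord0 (lift ord0 ord0))) 0))).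
    apply: (computable_comp2 computable_cons); first exact: (computable_proj ord0).
    apply: (computable_comp2 computable_cons); first exact: computable_proj.
    apply: (computable_comp2 computable_cons); last exact: computable_const.
    exact: computable_proj.
  apply: computable_ext (computable_comp1 c cl) => v.
  by rewrite /item !decode_cons.
have [h hP] : computable1 (fun y => item y 0) by program.
exists (RComp h (fun _ => RMu g)) => x1 x2 exy.
exists (ex_minn exy); first by case: ex_minnP.
case: ex_minnP => y acc_y min_y.
exists [tuple y]; split; last exact: (hP [tuple y]).
move=> i; rewrite ord1 tnth0 /=; split.
  have := gP [tuple y; x1; x2]; rewrite /= (tnth_nth 0%N) /= (tnth_nth 0%N) /= acc_y.
  by congr reval; apply: val_inj.
move=> j lt_jy; exists 0%N.
have := gP [tuple j; x1; x2]; rewrite /= (tnth_nth 0%N) /= (tnth_nth 0%N) /=.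
rewrite (contraNF (fun acc => min_y j acc)) -?ltnNge //.
Qed.

End Program.

(** * Correctness of the search *)

Lemma item_leq x i : (item x i <= x)%N.
Proof.
rewrite /item; case: (ltnP i (size (CodeSeq.decode x))) => [lt_i|le_i].
  have /allP/(_ _ (mem_nth 0%N lt_i)) := CodeSeq.ltn_code (CodeSeq.decode x).
  by rewrite CodeSeq.decodeK => /ltnW.
by rewrite nth_default.
Qed.

Lemma order_le_seq_of (K : fieldExtType rat) (emb : {rmorphism K -> algC}) z :
  order_le emb z (seq_of K z).
Proof.
have [Z defZ sz_Z] := rootpoly_of emb (rec_poly_monic K z).
exists Z; split; first by move=> n; rewrite -defZ satisfies_rec_act //; apply: rec_polyP.
rewrite sz_Z size_rec_poly /= (leq_trans (sizec_leq _)) //.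
exact: item_leq.
Qed.

Lemma nonzero_testP (K : fieldExtType rat) (emb : {rmorphism K -> algC}) c :
  reflect (eventually (fun n => seq_of K c n != 0)) (nonzero_test K c).
Proof.
have test := eventually_nonzero_test emb (rec_poly_monic K c) (size_rec_poly K c)
  (rec_polyP K c).
apply: (iffP allP) => [c_test|/test.1 c_test j].
  apply: test.2 => j lt_j; have := c_test j; rewrite mem_iota /= => /(_ lt_j)/hasP[n].
  by rewrite mem_iota zeroKP => /= lt_n nz; exists n.
rewrite mem_iota /= => /c_test[n lt_n nz]; apply/hasP; exists n; first by rewrite mem_iota.
by rewrite zeroKP.
Qed.

Section Correctness.
Variables (K : fieldExtType rat) (emb : {rmorphism K -> algC}).
Variables (entry : nat -> nat -> nat -> nat -> nat -> nat -> nat).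
Variables (extra cols : nat -> nat -> nat -> nat).
Variables x1 x2 : nat.

Local Notation rows D := (rows extra x1 x2 D).
Local Notation cols_ D := (cols x1 x2 D).

Definition system D i h n : K := elt_of_code K (entry x1 x2 D i h n).

Definition system_mx D n := entry_mx (rows D) (cols_ D) (system D) n.

(** The order [D] is feasible: for large [n] the last target is a combination of
    the other targets and the relators. *)
Definition dependent D := eventually (fun n =>
  (row (target_row D _) (system_mx D n) <= erase_row (target_row D _) (system_mx D n))%MS).

Hypothesis order_system : forall D i h, order_le emb (x1 + x2).+1 (system D i h).

Lemma dependence_testP y D :
  reflect (forall n h, (h < cols_ D)%N ->
      \sum_(i < rows D) seq_of K (multiplier y D i) n * system D i h n = 0)
    (dependence_test K entry extra cols x1 x2 y D).
Proof.
have sumE n h : elt_of_code K (sumK K (rows D) (fun i => mulK K (value K (multiplier y D i) n)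
    (entry x1 x2 D i h n))) = \sum_(i < rows D) seq_of K (multiplier y D i) n * system D i h n.
  by rewrite elt_of_code_sum; apply: eq_bigr => i _; rewrite elt_of_code_mul.
apply: (iffP allP) => [test n h lt_h|test n _]; last first.
  by apply/allP => h; rewrite mem_iota zeroKP sumE /= => lt_h; rewrite test.
have ord : order_le emb (rows D * 2 ^ (y + (x1 + x2).+1))
    (fun n => \sum_(i < rows D) seq_of K (multiplier y D i) n * system D i h n).
  apply: (order_le_sum (f := fun i n => seq_of K (multiplier y D i) n * system D i h n)) => i _.
  apply: order_le_mul => //; apply: order_leW (order_le_seq_of emb _).
  by rewrite /multiplier; case: ifP => _; rewrite (leq_trans (item_leq _ _)) ?item_leq.
apply: (order_le_window ord _ (leq0n n)) => k lt_k; rewrite add0n -sumE.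
have := test k; rewrite mem_iota /= => /(_ lt_k)/allP/(_ h).
by rewrite mem_iota zeroKP /= => /(_ lt_h)/eqP.
Qed.

Lemma pairingE v D i n : elt_of_code K (pairing K entry cols x1 x2 v D i n) =
  \sum_(h < cols_ D) system D i h n * seq_of K (item v h) n.
Proof. by rewrite elt_of_code_sum; apply: eq_bigr => h _; rewrite elt_of_code_mul. Qed.

Lemma order_le_pairing v D i : order_le emb (cols_ D * 2 ^ ((x1 + x2).+1 + v))
  (fun n => \sum_(h < cols_ D) system D i h n * seq_of K (item v h) n).
Proof.
apply: (order_le_sum (f := fun h n => system D i h n * seq_of K (item v h) n)) => h _.
by apply: order_le_mul => //; apply: order_leW (order_le_seq_of emb _); apply: item_leq.
Qed.

Lemma independence_testP v D :
  independence_test K entry extra cols x1 x2 v D <->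
  (forall n (i : 'I_(rows D)), i != target_row D _ ->
      \sum_(h < cols_ D) system D i h n * seq_of K (item v h) n = 0) /\
  infinitely (fun n => \sum_(h < cols_ D) system D D h n * seq_of K (item v h) n != 0).
Proof.
set B := (cols_ D * 2 ^ ((x1 + x2).+1 + v))%N.
split=> [/andP[/allP test0 /hasP[n0]]|[eq0 inf]].
  rewrite mem_iota zeroKP pairingE /= => lt_n0 nz; split.
    move=> n i ne_iD; have ord := order_le_pairing v D i.
    apply: (order_le_window ord _ (leq0n n)) => k lt_k; rewrite add0n.
    have := test0 k; rewrite mem_iota leq0n add0n andTb => /(_ lt_k)/allP/(_ (val i)).
    rewrite mem_iota leq0n add0n andTb ltn_ord zeroKP pairingE => /(_ isT)/orP[|/eqP//].
    by move=> eq_iD; case/eqP: ne_iD; apply/val_inj/eqP.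
  apply: NNPP => fin; case/eqP: nz.
  apply: (order_le_tail (order_le_pairing v D D)); last exact: leq_addr.
  apply: NNPP => /not_eventually inf; apply: fin => N; have [n le_n nz] := inf N.
  by exists n => //; apply/eqP.
apply/andP; split.
  apply/allP => n _; apply/allP => i; rewrite mem_iota /= add0n => lt_i.
  rewrite zeroKP pairingE; have [//|ne_iD] := eqVneq i D.
  by apply/eqP/(eq0 n (Ordinal lt_i)); rewrite -(inj_eq val_inj).
apply: contraT => no.
have all0 n : (B <= n)%N -> \sum_(h < cols_ D) system D D h n * seq_of K (item v h) n = 0.
  apply: (order_le_window (order_le_pairing v D D)) => k lt_k.
  apply/eqP/negPn/negP => nz; move/negP: no; apply; apply/hasP; exists k; first by rewrite mem_iota.
  by rewrite zeroKP pairingE.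
have [n le_n] := inf B; by rewrite all0 ?eqxx.
Qed.

(** A vector orthogonal to the other rows is orthogonal to their combinations. *)
Lemma independence_sound v D : independence_test K entry extra cols x1 x2 v D -> ~ dependent D.
Proof.
move=> /independence_testP[eq0 inf] dep.
have [n _ [nz dep_n]] := infinitely_and inf dep 0.
pose z : 'cV[K]_(cols_ D) := \col_h seq_of K (item v h) n.
have ez : erase_row (target_row D _) (system_mx D n) *m z = 0.
  apply/colP => i; rewrite !mxE; have [eq_iD|ne_iD] := eqVneq i (target_row D _).
    by apply: big1 => h _; rewrite !mxE eq_iD eqxx mul0r.
  rewrite -[RHS](eq0 n i ne_iD); apply: eq_bigr => h _.
  by rewrite !mxE (negPf ne_iD).
have [w ew] := submxP dep_n.
have tz : row (target_row D _) (system_mx D n) *m z = 0 by rewrite ew -mulmxA ez mulmx0.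
case/eqP: nz; have /matrixP/(_ 0 0) := tz; rewrite !mxE => tz0; rewrite -[RHS]tz0.
by apply: eq_bigr => h _; rewrite !mxE.
Qed.

(** On a vector [z] satisfying the relators, the certified identity between rows
    leaves only the targets: it is the recurrence. *)
Lemma accepts_sound y : accepts K entry extra cols x1 x2 y ->
  let D := order_named y in let c i := seq_of K (item (item y 0) i) in
  [/\ sizec (item y 0) = D.+1,
      forall i, (i <= D)%N -> Cfinite_code (item (item y 0) i) (c i),
      eventually (fun n => c D n != 0),
      forall D', dependent D' -> (D <= D')%N
    & forall n (z : nat -> K),
        (forall i, (D < i < rows D)%N -> \sum_(h < cols_ D) system D i h n * z h = 0) ->
        \sum_(i < D.+1) c i n * (\sum_(h < cols_ D) system D i h n * z h) = 0].
Proof.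
case/and5P=> sz_gt0 /allP shape /dependence_testP dep /(nonzero_testP emb) nz /allP indep D c.
have szD : sizec (item y 0) = D.+1 by rewrite prednK.
split=> // [i le_iD|D' depD'|n z rel].
- apply/Cfinite_code_seq_of/esym/eqP/shape.
  by rewrite mem_iota szD.
- rewrite leqNgt; apply/negP => lt_D'; have := indep D'; rewrite mem_iota => /(_ lt_D').
  by move/independence_sound; apply.
have : \sum_(i < rows D) seq_of K (multiplier y D i) n *
    (\sum_(h < cols_ D) system D i h n * z h) = 0.
  under eq_bigr => i _ do rewrite mulr_sumr.
  rewrite exchange_big big1 // => h _ /=.
  under eq_bigr => i _ do rewrite mulrA.
  by rewrite -mulr_suml (dep n h) ?mul0r.
rewrite big_split_ord /= [X in _ + X]big1 ?addr0 => [|i _]; last first.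
  by rewrite rel ?mulr0 // leq_addr ltn_add2l ltn_ord.
move=> sum0; rewrite -[RHS]sum0; apply: eq_bigr => i _.
by rewrite /multiplier -ltnS ltn_ord.
Qed.

Section Completeness.
Variables (Eig : algC -> Prop) (d : nat).
Hypothesis d_gt0 : (0 < d)%N.
Hypothesis torsion_d : torsion_exponent Eig d.
Hypothesis roots_system : forall D i h, roots_in emb (mulgen Eig) (system D i h).

Local Notation S := (roots_in emb (mulgen Eig)).

Let C_glue n0 (y : nat -> nat -> K) : (forall j, (j < d)%N -> S (y j)) ->
  Cfinite (fun n => if (n0 <= n)%N then y (n %% d)%N n else 0).
Proof.
move=> Sy; apply: (Cfinite_glue emb) => // j lt_j; apply: (Cfinite_roots_in emb _).2.
exact: roots_inW (Sy j lt_j).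
Qed.

Let S_system D : Smx S (system_mx D).
Proof. by move=> i h; apply: roots_in_ext (roots_system D i h) => n; rewrite mxE. Qed.

Lemma Cfinite_codes N (c : nat -> nat -> K) : (forall i, (i < N)%N -> Cfinite (c i)) ->
  exists x : nat -> nat, forall i, (i < N)%N -> Cfinite_code (x i) (c i).
Proof.
case: N => [|N] Cc; first by exists id.
apply: (@bounded_choice _ (fun i x => Cfinite_code x (c i))) => // i lt_i.
have [p [mon_p pc]] := Cfinite_monic ((Cfinite_roots_in emb _).1 (Cc i lt_i)).
exact: Cfinite_has_code mon_p pc.
Qed.

Lemma independence_complete D : ~ dependent D ->
  exists v, independence_test K entry extra cols x1 x2 v D.
Proof.
move=> ndep.
have [w [Cw w0 winf]] := @independence_certificate K S (@Cfinite K) d d_gt0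
  (mulgen_ring emb Eig) (mulgen_class (iota := emb) d_gt0 torsion_d) C_glue
  _ _ (system_mx D) (target_row D _) (@S_system D) ndep.
pose w' h := if insub h is Some h' then w h' else (fun _ => 0).
have [x xP] : exists x : nat -> nat, forall h, (h < cols_ D)%N -> Cfinite_code (x h) (w' h).
  by apply: Cfinite_codes => h lt_h; rewrite /w' insubT.
have xE (h : 'I_(cols_ D)) :
    seq_of K (item (CodeSeq.code [seq x h | h <- iota 0 (cols_ D)]) h) =1 w h.
  move=> n; rewrite item_code (nth_map 0%N) ?size_iota // nth_iota // add0n.
  by rewrite -(Cfinite_code_eq (xP h (ltn_ord h))) /w' valK.
exists (CodeSeq.code [seq x h | h <- iota 0 (cols_ D)]); apply/independence_testP; split.
  move=> n i ne_iD; rewrite -[RHS](w0 n i ne_iD); apply: eq_bigr => h _.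
  by rewrite xE mxE.
move=> N; have [n le_n nz] := winf N; exists n => //; apply: contraNneq nz => s0.
apply/eqP; rewrite -[RHS]s0; apply: eq_bigr => h _; by rewrite xE mxE.
Qed.

(** The minimal feasible order has a dependence certificate, and all smaller orders
    have independence certificates.  Certificates are C-finite, hence have
    names. *)
Lemma accepts_complete D0 : dependent D0 -> exists y, accepts K entry extra cols x1 x2 y.
Proof.
move=> dep0; have {D0 dep0} [D [dep min_D]] :
    exists D, dependent D /\ forall D', (D' < D)%N -> ~ dependent D'.
  elim/ltn_ind: D0 dep0 => D0 IH dep0.
  case: (classic (exists2 D', (D' < D0)%N & dependent D')) => [[D' lt_D' dep']|no].
    exact: IH dep'.
  by exists D0; split=> // D' lt_D' dep'; apply: no; exists D'.
have [w wP] : exists w : nat -> nat, forall D', (D' < D)%N ->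
    independence_test K entry extra cols x1 x2 (w D') D'.
  case: D min_D {dep} => [|D] min_D; first by exists id.
  apply: (@bounded_choice _ (fun D' v => independence_test K entry extra cols x1 x2 v D')) => //.
  by move=> D' /min_D/independence_complete.
have [c [Cc c0 nz]] := @dependence_certificate K S (@Cfinite K) d d_gt0
  (mulgen_ring emb Eig) (mulgen_class (iota := emb) d_gt0 torsion_d) C_glue
  _ _ (system_mx D) (target_row D _) (@S_system D) dep.
pose c' i := if insub i is Some i' then c i' else (fun _ => 0).
have [x xP] : exists x : nat -> nat, forall i, (i < rows D)%N -> Cfinite_code (x i) (c' i).
  by apply: Cfinite_codes => i lt_i; rewrite /c' insubT.
have xE (i : 'I_(rows D)) : seq_of K (x i) =1 c i.
  by move=> n; rewrite -(Cfinite_code_eq (xP i (ltn_ord i))) /c' valK.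
pose ec := CodeSeq.code [seq x i | i <- iota 0 D.+1].
pose lc := CodeSeq.code [seq x (i + D.+1)%N | i <- iota 0 (extra x1 x2 D)].
pose y := CodeSeq.code [:: ec; lc; CodeSeq.code [seq w D' | D' <- iota 0 D]].
have y0 : item y 0 = ec by rewrite item_code.
have ecE i : (i <= D)%N -> item ec i = x i.
  by move=> le_i; rewrite item_code (nth_map 0%N) ?size_iota // nth_iota.
have sz_ec : sizec ec = D.+1 by rewrite /sizec CodeSeq.codeK size_map size_iota.
have multE i : (i < rows D)%N -> multiplier y D i = x i.
  move=> lt_i; rewrite /multiplier y0; case: leqP => [/ecE//|lt_Di].
  have lt_e : (i - D.+1 < extra x1 x2 D)%N by rewrite ltn_subLR.
  by rewrite item_code /= item_code (nth_map 0%N) ?size_iota // nth_iota // add0n subnK.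
have ordy : order_named y = D by rewrite /order_named y0 sz_ec.
exists y; rewrite /accepts ordy y0 sz_ec; apply/and5P; split=> //.
- apply/allP => i; rewrite mem_iota leq0n add0n andTb y0 sz_ec => le_i; rewrite ecE //.
  have [sz_u _ _] := xP i (leq_trans le_i (leq_addr _ _)).
  by move: sz_u; rewrite !size_map /order_of /sizec => ->.
- apply/dependence_testP => n h lt_h; rewrite -[RHS](c0 n (Ordinal lt_h)).
  by apply: eq_bigr => i _; rewrite multE // xE mxE.
- rewrite ecE //; apply/(nonzero_testP emb); apply: eventuallyW nz => n.
  by rewrite -xE.
- apply/allP => D'; rewrite mem_iota leq0n add0n andTb => lt_D'.
  by rewrite item_code /= item_code (nth_map 0%N) ?size_iota // nth_iota // add0n; apply: wP.
Qed.

End Completeness.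
End Correctness.

(** * The programs for sums and products *)

Section Programs.
Variable K : fieldExtType rat.

Definition coded_block x1 x2 D := block (sizec x1).-1 (sizec x2).-1 D.

Definition sum_program x1 x2 D row col n : nat :=
  let L := coded_block x1 x2 D in
  if (row <= D)%N then if ((col %% L)%N == row) then code_of_elt (1 : K) else 0%N else
  if ((row - D.+1) %/ D.+1 == col %/ L)%N && ((row - D.+1) %% D.+1 <= col %% L)%N
  then if ((row - D.+1) %/ D.+1)%N == 0%N
       then value K (item x1 (col %% L - (row - D.+1) %% D.+1)) (n + (row - D.+1) %% D.+1)
       else value K (item x2 (col %% L - (row - D.+1) %% D.+1)) (n + (row - D.+1) %% D.+1)
  else 0%N.

Definition sum_extra (x1 x2 D : nat) := (2 * D.+1)%N.
Definition sum_width x1 x2 D := (2 * coded_block x1 x2 D)%N.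

Definition prod_program x1 x2 D row col n : nat :=
  let L := coded_block x1 x2 D in
  if (row <= D)%N then
    if ((col %/ L)%N == row) && ((col %% L)%N == row) then code_of_elt (1 : K) else 0%N else
  if ((row - D.+1) %/ L %/ D.+1 == 0)%N
  then if ((col %% L) == (row - D.+1) %% L)%N && ((row - D.+1) %/ L %% D.+1 <= col %/ L)%N
       then value K (item x1 (col %/ L - (row - D.+1) %/ L %% D.+1)) (n + (row - D.+1) %/ L %% D.+1)
       else 0%N
  else if ((col %/ L) == (row - D.+1) %% L)%N && ((row - D.+1) %/ L %% D.+1 <= col %% L)%N
       then value K (item x2 (col %% L - (row - D.+1) %/ L %% D.+1)) (n + (row - D.+1) %/ L %% D.+1)
       else 0%N.

Definition prod_extra x1 x2 D := (2 * D.+1 * coded_block x1 x2 D)%N.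
Definition prod_width x1 x2 D := (coded_block x1 x2 D * coded_block x1 x2 D)%N.

(** The coefficients read off a name; beyond the order they are zero, which is
    what the systems expect. *)
Definition coded (x m n : nat) : K := seq_of K (item x m) n.

Definition annihilates_coded x (a : nat -> K) :=
  forall n, \sum_(m < (sizec x).-1.+1) coded x m n * a (n + m)%N = 0.

Lemma sum_programE x1 x2 D row col n : elt_of_code K (sum_program x1 x2 D row col n) =
  sum_entry (sizec x1).-1 (sizec x2).-1 (coded x1) (coded x2) D row col n.
Proof.
rewrite /sum_program /sum_entry /cof -/(coded_block x1 x2 D); case: ifP => _.
  by case: eqP; rewrite ?code_of_eltK ?elt_of_code0.
by case: ifP => _; rewrite ?elt_of_code0 //; case: ifP.
Qed.

Lemma prod_programE x1 x2 D row col n : elt_of_code K (prod_program x1 x2 D row col n) =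
  prod_entry (sizec x1).-1 (sizec x2).-1 (coded x1) (coded x2) D row col n.
Proof.
rewrite /prod_program /prod_entry -/(coded_block x1 x2 D); case: ifP => _.
  by case: ifP; rewrite ?code_of_eltK ?elt_of_code0.
by case: ifP => _; case: ifP => _; rewrite ?elt_of_code0.
Qed.

Lemma cf_sum_program : computable_entry sum_program.
Proof.
move=> X1 X2 D I H N c1 c2 cD cI cH cN; rewrite /sum_program /coded_block /block.
apply: (@cf_if (fun e => (I e <= D e)%N)); first by computability.
  by apply: (@cf_if (fun e => (_ %% _)%N == I e)); computability.
apply: (@cf_if (fun e => (_ == _)%N && (_ <= _)%N)); [by computability| |by computability].
by apply: (@cf_if (fun e => _ == 0%N));
  repeat (first [computability_step | field_step | assumption]).
Qed.

Lemma cf_prod_program : computable_entry prod_program.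
Proof.
move=> X1 X2 D I H N c1 c2 cD cI cH cN; rewrite /prod_program /coded_block /block.
apply: (@cf_if (fun e => (I e <= D e)%N)); first by computability.
  by apply: (@cf_if (fun e => (_ == I e) && (_ == I e))); computability.
apply: (@cf_if (fun e => _ == 0%N)); first by computability.
  by apply: (@cf_if (fun e => (_ == _)%N && (_ <= _)%N));
    repeat (first [computability_step | field_step | assumption]).
by apply: (@cf_if (fun e => (_ == _)%N && (_ <= _)%N));
  repeat (first [computability_step | field_step | assumption]).
Qed.

End Programs.

Section Closure.
Variables (K : fieldExtType rat) (emb : {rmorphism K -> algC}).

Local Notation sum_system x1 x2 :=
  (sum_entry (sizec x1).-1 (sizec x2).-1 (coded K x1) (coded K x2)).
Local Notation prod_system x1 x2 :=
  (prod_entry (sizec x1).-1 (sizec x2).-1 (coded K x1) (coded K x2)).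

Lemma coded_out x m : ((sizec x).-1 < m)%N -> coded K x m =1 (fun _ => 0).
Proof. by move=> lt_m; apply: seq_of_out; lia. Qed.

Lemma rec_code_coded x r (c : 'I_r.+1 -> nat -> K) : rec_code x c ->
  (sizec x).-1 = r /\ forall i, c i =1 coded K x i.
Proof.
by move=> [sz_x codes]; split=> [|i]; [rewrite /sizec sz_x | apply: Cfinite_code_eq].
Qed.

Lemma coded_roots (E : algC -> Prop) x r (c : 'I_r.+1 -> nat -> K) :
  (forall i, Cfinite (c i)) -> rec_code x c -> (forall i z, Defs.eigenvalue emb (c i) z -> E z) ->
  forall m, roots_in emb (mulgen E) (coded K x m).
Proof.
move=> Cc /rec_code_coded[sz_x cE] eigE m; case: (ltnP r m) => [lt_m|le_m].
  have c0 : (fun _ => 0) =1 coded K x m by move=> n; rewrite coded_out ?sz_x.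
  exact: roots_in_ext c0 (roots_in_const emb 0 (mulgen_1 _)).
have := eigenvalue_roots emb (Cc (Ordinal (le_m : (m < r.+1)%N))).
by move=> /(roots_in_ext (cE _)); apply: roots_inW => z /eigE/mulgen_in.
Qed.

Lemma order_le_coded x m : order_le emb x (coded K x m).
Proof. by apply: order_leW (order_le_seq_of emb _); apply: item_leq. Qed.

(** The coefficients of the system are constants and shifted coefficients of the
    given recurrences: this carries over bounds on orders and on roots. *)
Definition entries_from_coefficients entry :=
  forall (P : (nat -> K) -> Prop) x1 x2,
  (forall f g, f =1 g -> P f -> P g) -> (forall a, P (fun _ => a)) ->
  (forall m k, P (fun n => coded K x1 m (n + k)%N)) ->
  (forall m k, P (fun n => coded K x2 m (n + k)%N)) ->
  forall D i h, P (system K entry x1 x2 D i h).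

Lemma sum_entries : entries_from_coefficients (sum_program K).
Proof.
move=> P x1 x2 P_ext P_const P1 P2 D i h.
apply: (P_ext (sum_system x1 x2 D i h)); first by move=> n; rewrite /system sum_programE.
rewrite /sum_entry; case: (i <= D)%N => //; case: (_ && _) => //.
by rewrite /cof; case: (_ == 0)%N.
Qed.

Lemma prod_entries : entries_from_coefficients (prod_program K).
Proof.
move=> P x1 x2 P_ext P_const P1 P2 D i h.
apply: (P_ext (prod_system x1 x2 D i h)); first by move=> n; rewrite /system prod_programE.
rewrite /prod_entry /=; case: (i <= D)%N => //.
by case: (_ == 0)%N; case: (_ && _).
Qed.

(** What remains of a name of a recurrence in the proof that the order
    [d * bound r1 r2] is feasible. *)
Definition admissible (E : algC -> Prop) x :=
  (forall m, roots_in emb (mulgen E) (coded K x m)) /\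
  eventually (fun n => coded K x (sizec x).-1 n != 0).

Definition solvable entry extra cols x1 x2 D n (target : nat -> K) :=
  exists z : nat -> K,
    (forall i, (D < i < rows extra x1 x2 D)%N ->
       \sum_(h < cols x1 x2 D) system K entry x1 x2 D i h n * z h = 0) /\
    (forall i, (i <= D)%N ->
       \sum_(h < cols x1 x2 D) system K entry x1 x2 D i h n * z h = target i).

(** Sums and products only differ in their systems.  Completeness of the search needs
    the order [d * bound r1 r2] to be feasible; soundness needs the terms of [a]
    and [b] to solve the relators, with the terms of [op a b] as targets. *)
Lemma search_computes_closure (op : (nat -> K) -> (nat -> K) -> nat -> K)
    (bound : nat -> nat -> nat)
    (entry : nat -> nat -> nat -> nat -> nat -> nat -> nat)
    (extra cols : nat -> nat -> nat -> nat) :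
  computable_entry entry -> computable_size extra -> computable_size cols ->
  entries_from_coefficients entry ->
  (forall E d x1 x2, (0 < d)%N -> torsion_exponent E d ->
     admissible E x1 -> admissible E x2 ->
     dependent K entry extra cols x1 x2 (d * bound (sizec x1).-1 (sizec x2).-1)) ->
  (forall x1 x2 a b, annihilates_coded x1 a -> annihilates_coded x2 b ->
     forall D n, solvable entry extra cols x1 x2 D n (fun i => op a b (n + i)%N)) ->
  exists f : recfun 2,
    computes_closure emb op (fun d r1 r2 => (d * bound r1 r2)%N) f.
Proof.
move=> cf_e cf_x cf_c ents dep sound.
have ord y1 y2 : forall D i h, order_le emb (y1 + y2).+1 (system K entry y1 y2 D i h).
  apply: ents => [u v|a|m k|m k]; first exact: order_le_ext.
  - by apply: order_leW (order_le_const emb a).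
  - by apply/order_le_shift/order_leW/order_le_coded; lia.
  by apply/order_le_shift/order_leW/order_le_coded; lia.
have [f fP] := search_program K cf_e cf_x cf_c.
exists f => x1 x2 r1 r2 c1 c2 d [C1 nz1] [C2 nz2] code1 code2 tor.
have d_gt0 := torsion_number_gt0 C1 C2 tor.
have [sz1 cE1] := rec_code_coded code1; have [sz2 cE2] := rec_code_coded code2.
pose E := rec_eigenvalue emb c1 c2.
have adm1 : admissible E x1.
  split; first by apply: coded_roots C1 code1 _ => i z Ez; left; exists i.
  by rewrite sz1; apply: eventuallyW nz1 => n; rewrite (cE1 ord_max).
have adm2 : admissible E x2.
  split; first by apply: coded_roots C2 code2 _ => i z Ez; right; exists i.
  by rewrite sz2; apply: eventuallyW nz2 => n; rewrite (cE2 ord_max).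
have rts : forall D i h, roots_in emb (mulgen E) (system K entry x1 x2 D i h).
  apply: ents => [u v|a|m k|m k]; first exact: roots_in_ext.
  - exact/roots_in_const/mulgen_1.
  - exact/roots_in_shift/adm1.1.
  - exact/roots_in_shift/adm2.1.
have depD := dep E d x1 x2 d_gt0 tor.1 adm1 adm2; rewrite sz1 sz2 in depD.
have := accepts_complete (ord x1 x2) d_gt0 tor.1 rts depD.
move=> /fP[y acc_y eval_y].
have [sz_y codes_y nz_y min_y rel_y] := accepts_sound (ord x1 x2) acc_y.
exists (item y 0), (order_named y), (fun i n => seq_of K (item (item y 0) i) n).
split=> //.
- by split=> // i; apply: codes_y; rewrite -ltnS.
- exact: min_y.
- by split=> // i; apply: Cfinite_seq_of.
move=> a b ann_a ann_b n.
have ann1 : annihilates_coded x1 a.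
  by move=> k; rewrite -[RHS](ann_a k) sz1; apply: eq_bigr => m _; rewrite cE1.
have ann2 : annihilates_coded x2 b.
  by move=> k; rewrite -[RHS](ann_b k) sz2; apply: eq_bigr => m _; rewrite cE2.
have [z [rel tgt]] := sound x1 x2 a b ann1 ann2 (order_named y) n.
rewrite -[RHS](rel_y n z rel); apply: eq_bigr => i _.
by rewrite tgt // -ltnS.
Qed.

End Closure.

Section Applications.
Variables (K : fieldExtType rat) (emb : {rmorphism K -> algC}).

Lemma sum_program_dependent E d x1 x2 : (0 < d)%N -> torsion_exponent E d ->
  admissible emb E x1 -> admissible emb E x2 ->
  dependent K (sum_program K) sum_extra sum_width x1 x2 (d * ((sizec x1).-1 + (sizec x2).-1)).
Proof.
move=> d_gt0 torE [S1 nz1] [S2 nz2].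
have := sum_dependence d_gt0 (mulgen_ring emb E) (mulgen_class d_gt0 torE) S1 S2
  (@coded_out K x1) (@coded_out K x2) nz1 nz2 (erefl _).
apply: eventuallyW => n /=; set A := entry_mx _ _ _ _.
suff -> : A = system_mx K (sum_program K) sum_extra sum_width x1 x2
   (d * ((sizec x1).-1 + (sizec x2).-1)) n by [].
by apply/matrixP => i h; rewrite !mxE /system sum_programE.
Qed.

Lemma prod_program_dependent E d x1 x2 : (0 < d)%N -> torsion_exponent E d ->
  admissible emb E x1 -> admissible emb E x2 ->
  dependent K (prod_program K) prod_extra prod_width x1 x2 (d * ((sizec x1).-1 * (sizec x2).-1)).
Proof.
move=> d_gt0 torE [S1 nz1] [S2 nz2].
have := prod_dependence d_gt0 (mulgen_ring emb E) (mulgen_class d_gt0 torE) S1 S2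
  (@coded_out K x1) (@coded_out K x2) nz1 nz2 (erefl _).
apply: eventuallyW => n /=; set A := entry_mx _ _ _ _.
suff -> : A = system_mx K (prod_program K) prod_extra prod_width x1 x2
   (d * ((sizec x1).-1 * (sizec x2).-1)) n by [].
by apply/matrixP => i h; rewrite !mxE /system prod_programE.
Qed.

(** Inverts the numbering of the relator rows. *)
Lemma row_split D L i : (D < i < D.+1 + 2 * D.+1 * L)%N -> exists q k l,
  [/\ (q < 2)%N, (k <= D)%N, (l < L)%N & i = (D.+1 + ((q * D.+1 + k) * L + l))%N].
Proof.
move=> /andP[lt_D lt_i]; have L_gt0 : (0 < L)%N by case: L lt_i; lia.
exists ((i - D.+1) %/ L %/ D.+1)%N, ((i - D.+1) %/ L %% D.+1)%N, ((i - D.+1) %% L)%N.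
split.
- by rewrite ltn_divLR // ltn_divLR // mulnC ltn_subLR // mulnC.
- by rewrite -ltnS ltn_mod.
- by rewrite ltn_mod.
- by rewrite -!divn_eq subnKC.
Qed.

Lemma sum_program_sound x1 x2 (a b : nat -> K) :
  annihilates_coded x1 a -> annihilates_coded x2 b ->
  forall D n, solvable (sum_program K) sum_extra sum_width x1 x2 D n
    (fun i => a (n + i)%N + b (n + i)%N).
Proof.
move=> ann_a ann_b D n; set L := block (sizec x1).-1 (sizec x2).-1 D.
pose zf q i := if q == 0%N then a (n + i)%N else b (n + i)%N.
exists (fun h => zf (h %/ L)%N (h %% L)%N); split=> i lt_i.
  have [q [k [l [lt_q le_k]]]] : exists q k l, [/\ (q < 2)%N, (k <= D)%N, (l < 1)%N &
      i = (D.+1 + ((q * D.+1 + k) * 1 + l))%N].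
    by apply: row_split; rewrite muln1.
  rewrite ltnS leqn0 muln1 => /eqP-> ->; rewrite addn0.
  under eq_bigr => h _ do rewrite /system sum_programE.
  rewrite (sum_entry_relator (@coded_out K x1) (@coded_out K x2) n zf lt_q le_k).
  case: q lt_q => [|[|//]] _; rewrite /cof /zf /=.
    by rewrite -[RHS](ann_a (n + k)%N); apply: eq_bigr => m _; rewrite addnA.
  by rewrite -[RHS](ann_b (n + k)%N); apply: eq_bigr => m _; rewrite addnA.
under eq_bigr => h _ do rewrite /system sum_programE.
by rewrite (sum_entry_target (sizec x1).-1 (sizec x2).-1 (coded K x1) (coded K x2) n zf lt_i).
Qed.

Lemma prod_program_sound x1 x2 (a b : nat -> K) :
  annihilates_coded x1 a -> annihilates_coded x2 b ->
  forall D n, solvable (prod_program K) prod_extra prod_width x1 x2 D n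
    (fun i => a (n + i)%N * b (n + i)%N).
Proof.
move=> ann_a ann_b D n; set L := block (sizec x1).-1 (sizec x2).-1 D.
pose zf i j := a (n + i)%N * b (n + j)%N.
exists (fun h => zf (h %/ L)%N (h %% L)%N); split=> i lt_i.
  have [q [k [l [lt_q le_k lt_l ->]]]] := row_split lt_i.
  under eq_bigr => h _ do rewrite /system prod_programE.
  case: q lt_q => [|[|//]] _.
    rewrite mul0n add0n (prod_entry_relator1 (coded K x2) (@coded_out K x1) n zf le_k lt_l).
    transitivity ((\sum_(m < (sizec x1).-1.+1) coded K x1 m (n + k)%N * a (n + k + m)%N)
      * b (n + l)%N); last by rewrite ann_a mul0r.
    rewrite mulr_suml.
    by apply: eq_bigr => m _; rewrite /zf addnA mulrA.
  rewrite mul1n (prod_entry_relator2 (coded K x1) (@coded_out K x2) n zf le_k lt_l).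
  transitivity (a (n + l)%N * (\sum_(m < (sizec x2).-1.+1)
    coded K x2 m (n + k)%N * b (n + k + m)%N)); last by rewrite ann_b mulr0.
  rewrite mulr_sumr.
  by apply: eq_bigr => m _; rewrite /zf addnA mulrCA.
under eq_bigr => h _ do rewrite /system prod_programE.
by rewrite (prod_entry_target (sizec x1).-1 (sizec x2).-1 (coded K x1) (coded K x2) n zf lt_i).
Qed.

Lemma sum_computes : exists f : recfun 2, computes_closure emb (fun a b n => a n + b n)
  (fun d r1 r2 => (d * (r1 + r2))%N) f.
Proof.
apply: (@search_computes_closure K emb _ addn (sum_program K) sum_extra sum_width).
- exact: cf_sum_program.
- by move=> X1 X2 D c1 c2 cD; rewrite /sum_extra; computability.
- by move=> X1 X2 D c1 c2 cD; rewrite /sum_width /coded_block /block; computability.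
- exact: sum_entries.
- exact: sum_program_dependent.
- exact: sum_program_sound.
Qed.

Lemma prod_computes : exists f : recfun 2, computes_closure emb (fun a b n => a n * b n)
  (fun d r1 r2 => (d * (r1 * r2))%N) f.
Proof.
apply: (@search_computes_closure K emb _ muln (prod_program K) prod_extra prod_width).
- exact: cf_prod_program.
- by move=> X1 X2 D c1 c2 cD; rewrite /prod_extra /coded_block /block; computability.
- by move=> X1 X2 D c1 c2 cD; rewrite /prod_width /coded_block /block; computability.
- exact: prod_entries.
- exact: prod_program_dependent.
- exact: prod_program_sound.
Qed.

Lemma rec_code_exists r (c : 'I_r.+1 -> nat -> K) : (forall i, Cfinite (c i)) ->
  exists x, rec_code x c.
Proof.
move=> Cc; have /fin_all_exists[x xP] : forall i, exists x, Cfinite_code x (c i).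
  move=> i; have [p [mon_p pc]] := Cfinite_monic ((Cfinite_roots_in emb _).1 (Cc i)).
  exact: Cfinite_has_code mon_p pc.
exists (CodeSeq.code [seq x i | i <- enum 'I_r.+1]); split.
  by rewrite CodeSeq.codeK size_map size_enum_ord.
move=> i; rewrite item_code (nth_map i) ?size_enum_ord ?ltn_ord // nth_ord_enum.
exact: xP.
Qed.

(** Every C-finite sequence has a name, so the program also yields the bare
    existence statement. *)
Lemma computes_closure_order_le op bound f : computes_closure emb op bound f ->
  forall (a b : nat -> K) r1 r2 (c1 : 'I_r1.+1 -> nat -> K) (c2 : 'I_r2.+1 -> nat -> K) d,
  C2recurrence c1 a -> C2recurrence c2 b ->
  torsion_number (rec_eigenvalue emb c1 c2) d ->
  C2finite_order_le (bound d r1 r2) (op a b).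
Proof.
move=> comp a b r1 r2 c1 c2 d [C1 ann_a] [C2 ann_b] tor.
have [x1 code1] := rec_code_exists C1.1; have [x2 code2] := rec_code_exists C2.1.
have [y [r [e [_ _ le_r Ce ann]]]] := comp x1 x2 r1 r2 c1 c2 d C1 C2 code1 code2 tor.
by exists r, e; split=> //; split=> //; apply: ann.
Qed.

End Applications.

Theorem theorem16 (K : fieldExtType rat) (iota : {rmorphism K -> algC}) :
  (forall (a b : nat -> K) (r1 r2 : nat)
     (c1 : 'I_r1.+1 -> nat -> K) (c2 : 'I_r2.+1 -> nat -> K) (d : nat),
     C2recurrence c1 a -> C2recurrence c2 b ->
     torsion_number (rec_eigenvalue iota c1 c2) d ->
     C2finite_order_le (d * (r1 + r2))%N (fun n => a n + b n) /\
     C2finite_order_le (d * (r1 * r2))%N (fun n => a n * b n)) /\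
  (exists f : recfun 2,
     computes_closure iota (fun a b n => a n + b n)
       (fun d r1 r2 => (d * (r1 + r2))%N) f) /\
  (exists f : recfun 2,
     computes_closure iota (fun a b n => a n * b n)
       (fun d r1 r2 => (d * (r1 * r2))%N) f).
Proof.
have [f fP] := sum_computes iota; have [g gP] := prod_computes iota.
split; last by split; [exists f | exists g].
move=> a b r1 r2 c1 c2 d rec_a rec_b tor; split.
  exact: (computes_closure_order_le fP rec_a rec_b tor).
exact: (computes_closure_order_le gP rec_a rec_b tor).
Qed.
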